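(* Let $\Delta$ be a unit interval pure $(m-1)$-dimensional simplicial complex on $[n]$, with determinantal facet ideal $J_\Delta$. With respect to some monomial order $\omega'$ on $R[\mathbf T_\Delta]$, the presentation ideal $\mathcal J=\ker\phi$ of the Rees algebra $\mathcal R(J_\Delta)$ has a Gröbner basis consisting of polynomials of types (A), (B) and (C) described in the context. In addition, the presentation ideal $\mathcal K=\ker\psi$ of the special fiber ring $\mathcal F(J_\Delta)$ has a Gröbner basis given by polynomials of type (C) with respect to some monomial order $\omega$ on $\mathbb K[\mathbf T_\Delta]$. In particular, $J_\Delta$ is of fiber type.
   Context: Let $\mathbb K$ be a field, $m\le n$ positive integers, $X=(x_{ij})$ an $m\times n$ matrix of indeterminates and $R=\mathbb K[X]$. Let $\Delta$ be a pure $(m-1)$-dimensional simplicial complex on $[n]=\{1,\dots,n\}$; its $(m-1)$-dimensional faces (facets) are identified with $m$-subsets $\mathbf a=\{a_1<\dots<a_m\}$. A clique of $\Delta$ is an induced subcomplex any $m$ vertices of which lie together in a face; write $\Delta=\Delta_1\cup\dots\cup\Delta_r$ for the decomposition into maximal cliques. $\Delta$ is unit interval if each $\Delta_i$ may be written as an interval $[u_i,v_i]=\{u_i,u_i+1,\dots,v_i\}$ (its vertex set) with $u_i<v_i$, indexed so that $1=u_1<u_2<\dots<u_r$ and $v_r=n$. The clique complex $\Delta^{\mathrm{clique}}$ is the simplicial complex whose facets are the maximal cliques of $\Delta$, i.e. the vertex sets $[u_i,v_i]$. For a facet $\mathbf a$ of $\Delta$, let $i_a$ be the smallest index with $\mathbf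 a\in\Delta_{i_a}$. $[\mathbf a]$ is the maximal minor of $X$ on columns $\mathbf a$, and $J_\Delta=([\mathbf a]:\mathbf a\text{ a facet of }\Delta)\subseteq R$. Let $\mathbf T_\Delta=\{T_{\mathbf a}:\mathbf a\text{ a facet of }\Delta\}$ be new indeterminates. The Rees algebra is $\mathcal R(J_\Delta)=R[J_\Delta t]\subseteq R[t]$; the special fiber ring $\mathcal F(J_\Delta)$ is identified with the $\mathbb K$-algebra $\mathbb K[[\mathbf a]:\mathbf a\text{ a facet of }\Delta]\subseteq R$; $\mathcal S(J_\Delta)$ is the symmetric algebra. $\rho:R[\mathbf T_\Delta]\to\mathcal S(J_\Delta)$ and $\phi:R[\mathbf T_\Delta]\to\mathcal R(J_\Delta)$ are the $R$-algebra maps sending $T_{\mathbf a}$ to the generator $[\mathbf a]$ of $\mathcal S(J_\Delta)$ and to $[\mathbf a]t$ respectively, and $\psi:\mathbb K[\mathbf T_\Delta]\to\mathcal F(J_\Delta)$ is the $\mathbb K$-algebra map $T_{\mathbf a}\mapsto[\mathbf a]$. Put $\mathcal L=\ker\rho$, $\mathcal J=\ker\phi$, $\mathcal K=\ker\psi$. $J_\Delta$ is of fiber type if $\mathcal J=\mathcal L+\mathcal K\cdot R[\mathbf T_\Delta]$. The Plücker poset is the set of $m$-subsets of $[n]$ with $\mathbf a\le_p\mathbf b$ iff $a_i\le b_i$ for all $i$. The polynomials: (A) $[\mathbf a]\,T_{\mathbf b}-[\mathbf b]\,T_{\mathbf a}$, for $(m-1)$-dimensional faces $\mathbf a,\mathbf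 b$ contained in distinct cliques of $\Delta$. (B) $\sum_{j=1}^{m+1}(-1)^{i+j}x_{ic_j}T_{\mathbf c\setminus c_j}$, for $\mathbf c=\{c_1<\dots<c_{m+1}\}$ an $m$-dimensional face of $\Delta^{\mathrm{clique}}$ and $1\le i\le m$. (C) (Plücker relations) Let $\mathbf a,\mathbf b$ be $(m-1)$-dimensional faces of $\Delta$ that are incomparable in the Plücker poset, with $i_a\le i_b$. Let $\mathbf c=\{\min\{a_1,b_1\},\dots,\min\{a_m,b_m\}\}$ and $\mathbf d=\{\max\{a_1,b_1\},\dots,\max\{a_m,b_m\}\}$ (again faces of $\Delta$). The polynomial is $$T_{\mathbf a}T_{\mathbf b}-T_{\mathbf c}T_{\mathbf d}+\sum_{\mathbf e\le_p\mathbf c,\ \mathbf e\le_p\mathbf g\ne\mathbf d}\operatorname{sgn}(i_\bullet)\,T_{\mathbf e}T_{\mathbf g},$$ where the sum is over pairs of faces $\mathbf e=\{e_1<\dots<e_m\}$, $\mathbf g=\{g_1<\dots<g_m\}$ of $\Delta$ with $\mathbf e\le_p\mathbf g$, $\mathbf e\le_p\mathbf c$, $\mathbf g\neq\mathbf d$, such that the sequence $(e_1,\dots,e_m,g_1,\dots,g_m)$ arises from $(a_1,\dots,a_m,b_1,\dots,b_m)$ by a permutation, and $i_\bullet\in\mathfrak S_{2m}$ denotes that permutation.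
   Formalization: In type (C), the coefficients sgn(i_•) are replaced by integers that are shown to exist (unique in K, since the polynomials lie in ker ψ); with the signs ±1 as stated the polynomials need not lie in ker ψ, e.g. m=3, a=136, b=245. *)

(* Defs.v *)
From HB Require Import structures.
From mathcomp Require Import all_boot all_order all_algebra.
From mathcomp Require Import boolp.
From mathcomp Require Import mpoly.
From mathcomp Require monalg.

Set Implicit Arguments.
Unset Strict Implicit.
Unset Printing Implicit Defensive.

Import GRing.Theory.
Local Open Scope ring_scope.

Definition ideal_gen (A : comNzRingType) (G : A -> Prop) : A -> Prop :=
  fun f => exists s : seq (A * A),
    (forall p, p \in s -> G p.2) /\ f = \sum_(p <- s) p.1 * p.2.

Definition ideal_add (A : comNzRingType) (I J : A -> Prop) : A -> Prop :=
  fun f => exists g h, [/\ I g, J h & f = g + h].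

(* The polynomial ring K[V] on a finite set V of indeterminates. *)
Notation polyring K V := {mpoly K[#|{: V}|]}.

Definition var (K : nzRingType) (V : finType) (v : V) : polyring K V :=
  'X_(enum_rank v).

(* The K-algebra homomorphism K[V] -> K[W] sending each v to h v. *)
Definition rename (K : comNzRingType) (V W : finType) (h : V -> W)
    (f : polyring K V) : polyring K W :=
  mmap (@mpolyC _ K) (fun k => var K (h (enum_val k))) f.

Record monomial_order (N : nat) (le : rel 'X_{1..N}) : Prop := MonomialOrder {
  mord_total : total le;
  mord_anti : antisymmetric le;
  mord_trans : transitive le;
  mord_ge0 : forall mu, le 0%MM mu;
  mord_add : forall mu nu la, le mu nu -> le (mu + la)%MM (nu + la)%MM }.

Definition is_lead (K : nzRingType) (N : nat) (le : rel 'X_{1..N})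
    (f : {mpoly K[N]}) (mu : 'X_{1..N}) : Prop :=
  mu \in msupp f /\ (forall nu, nu \in msupp f -> le nu mu).

Definition initial_ideal (K : comNzRingType) (N : nat) (le : rel 'X_{1..N})
    (I : {mpoly K[N]} -> Prop) : {mpoly K[N]} -> Prop :=
  ideal_gen (fun h => exists f mu, [/\ I f, is_lead le f mu & h = 'X_[mu]]).

Definition groebner_basis (K : comNzRingType) (N : nat) (le : rel 'X_{1..N})
    (G : seq {mpoly K[N]}) (I : {mpoly K[N]} -> Prop) : Prop :=
  (forall g, g \in G -> I g) /\
  (forall h, initial_ideal le I h <-> initial_ideal le (fun g => g \in G) h).

(* The symmetric algebra Sym_A(J) of an ideal J is the quotient of the         *)
(* polynomial ring A[X_u : u in J] by the ideal generated by the elements      *)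
(* X_(u + v) - X_u - X_v and X_(a u) - a X_u; [sym_rel J] is this ideal.       *)
(* monalg provides polynomials in infinitely many indeterminates; it is not    *)
(* imported globally because its notations clash with those of mpoly.          *)
Module SymmetricAlgebra.
Import monalg.
Section SymmetricAlgebra.
Variables (A : comNzRingType) (J : A -> Prop).

Definition ideal_elt := {u : A | `[< J u >]}.

Definition sym_cover := {malg A[{cmonom ideal_elt}]}.
HB.instance Definition _ := GRing.ComAlgebra.on sym_cover.

Definition sym_var (u : ideal_elt) : sym_cover := mkmalgU (ucm u) 1.

Definition sym_rel : sym_cover -> Prop :=
  ideal_gen (fun f : sym_cover =>
    (exists u v w : ideal_elt,
       val w = val u + val v /\ f = sym_var w - sym_var u - sym_var v)
    \/ (exists (a : A) (u w : ideal_elt),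
       val w = a * val u /\ f = sym_var w - a *: sym_var u)).

End SymmetricAlgebra.
End SymmetricAlgebra.
Export SymmetricAlgebra.

(* Simplicial complexes on 'I_n, given by their sets of faces. The vertex      *)
(* k of the set {1, ..., n} is the ordinal of value k - 1.                     *)
Section Complexes.
Variables (m n : nat).
Implicit Types (Delta : {set {set 'I_n}}) (s t W : {set 'I_n}).

Definition simplicial_complex Delta : Prop :=
  forall s t, s \in Delta -> t \subset s -> t \in Delta.

Definition pure_complex Delta : Prop :=
  forall s, maxset (fun t => t \in Delta) s -> #|s| = m.

(* W is the vertex set of a clique: since Delta is closed under taking         *)
(* subsets, m vertices lie in a common face iff they form a face. A set with   *)
(* fewer than m elements would satisfy the second condition vacuously and is   *)
(* excluded.                                                                   *)
Definition clique Delta W : bool :=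
  (m <= #|W|)%N &&
  [forall s : {set 'I_n}, (s \subset W) && (#|s| == m) ==> (s \in Delta)].

Definition maximal_clique Delta W : bool := maxset (clique Delta) W.

Definition clique_complex Delta : {set {set 'I_n}} :=
  [set s : {set 'I_n} | [exists W : {set 'I_n}, maximal_clique Delta W && (s \subset W)]].

Definition interval (u v : 'I_n) : {set 'I_n} := [set k : 'I_n | (u <= k <= v)%N].

(* The maximal cliques are the intervals [u_i, v_i], where i runs over the     *)
(* r.+1 ordinals below r.+1.                                                   *)
Record unit_interval Delta (r : nat) (u v : 'I_r.+1 -> 'I_n) : Prop :=
  UnitInterval {
    ui_cliques : forall W,
      maximal_clique Delta W <-> exists i, W = interval (u i) (v i);
    ui_nontrivial : forall i, (u i < v i)%N;
    ui_first : u ord0 = 0%N :> nat;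
    ui_increasing : forall i j : 'I_r.+1, (i < j)%N -> (u i < u j)%N;
    ui_last : (v ord_max).+1 = n }.

Definition facet Delta := {a : {set 'I_n} | (a \in Delta) && (#|a| == m)}.

Variable Delta : {set {set 'I_n}}.
Implicit Types (a b e g : facet Delta).

Lemma card_facet a : #|val a| = m.
Proof. by case/andP: (valP a) => _ /eqP. Qed.

(* a_1 < ... < a_m (enum_val lists a set of ordinals in increasing order).     *)
Definition elt a (j : 'I_m) : 'I_n :=
  enum_val (cast_ord (esym (card_facet a)) j).

Definition le_plucker (s t : 'I_m -> 'I_n) : bool :=
  [forall j, (s j <= t j)%N].

Definition min_elt a b (j : 'I_m) : 'I_n :=
  if (elt a j <= elt b j)%N then elt a j else elt b j.

Definition max_elt a b (j : 'I_m) : 'I_n :=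
  if (elt a j <= elt b j)%N then elt b j else elt a j.

Definition in_distinct_cliques a b : bool :=
  [exists W1 : {set 'I_n}, exists W2 : {set 'I_n}, [&& maximal_clique Delta W1, maximal_clique Delta W2,
     W1 != W2, val a \subset W1 & val b \subset W2]].

Definition clique_index (r : nat) (u v : 'I_r.+1 -> 'I_n) a : 'I_r.+1 :=
  [arg min_(i < ord0 | val a \subset interval (u i) (v i)) (i : nat)].

End Complexes.

Section BlowUp.
Variables (K : fieldType) (m n : nat) (Delta : {set {set 'I_n}}).

Local Notation F := (facet m Delta).

Definition ringR := polyring K ('I_m * 'I_n)%type.
Definition ringT := polyring K F.
(* R[T_Delta], as a polynomial ring over K in the x_ij and the T_a.            *)
Definition ringRT := polyring K ('I_m * 'I_n + F)%type.

Definition xvar (i : 'I_m) (j : 'I_n) : ringR := var K (i, j).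

Definition minor (a : F) : ringR := \det (\matrix_(i, j) xvar i (elt a j)).

Definition det_facet_ideal : ringR -> Prop :=
  ideal_gen (fun f => exists a : F, f = minor a).

Definition of_R : ringR -> ringRT := rename inl.
Definition of_T : ringT -> ringRT := rename inr.

(* T_s, for s a facet; it is 0, and never used, for the other sets s.          *)
Definition Tvar (s : {set 'I_n}) : ringT :=
  if insub s is Some a then var K (a : F) else 0.

(* psi : K[T_Delta] -> F(J), T_a |-> [a], composed with the inclusion of the   *)
(* special fiber ring in R.                                                    *)
Definition psi (f : ringT) : ringR :=
  mmap (@mpolyC _ K) (fun k => minor (enum_val k)) f.

Definition kerK : ringT -> Prop := fun f => psi f = 0.

(* phi : R[T_Delta] -> R(J), T_a |-> [a] t, composed with the inclusion of the *)
(* Rees algebra in R[t].                                                       *)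
Definition phi (f : ringRT) : {poly ringR} :=
  mmap (fun c => (c%:MP)%:P)
    (fun k => match enum_val k with
              | inl ij => (xvar ij.1 ij.2)%:P
              | inr a => minor a *: 'X
              end) f.

Definition kerJ : ringRT -> Prop := fun f => phi f = 0.

Lemma minor_in_ideal (a : F) : `[< det_facet_ideal (minor a) >].
Proof.
apply: asboolT; exists [:: (1, minor a)]; split; last by rewrite big_seq1 mul1r.
by move=> p; rewrite inE => /eqP ->; exists a.
Qed.

(* rho : R[T_Delta] -> Sym(J), T_a |-> [a], lifted to the polynomial ring of   *)
(* which Sym(J) is the quotient by sym_rel.                                    *)
Definition rho_cover (f : ringRT) : sym_cover det_facet_ideal :=
  mmap (fun c => (c%:MP : ringR)%:A)
    (fun k => match enum_val k with
              | inl ij => (xvar ij.1 ij.2)%:A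
              | inr a => sym_var (exist _ (minor a) (minor_in_ideal a))
              end) f.

Definition kerL : ringRT -> Prop := fun f => sym_rel (rho_cover f).

Definition fiber_type : Prop :=
  forall f, kerJ f <->
    ideal_add kerL (ideal_gen (fun h => exists2 k, kerK k & h = of_T k)) f.

Definition typeA_poly (a b : F) : ringRT :=
  of_R (minor a) * of_T (Tvar (val b)) - of_R (minor b) * of_T (Tvar (val a)).

Definition typeA : seq ringRT :=
  [seq typeA_poly p.1 p.2 | p : F * F in [pred p | in_distinct_cliques p.1 p.2]].

(* i and j are counted from 0 instead of 1, which leaves (-1)^(i + j) unchanged. *)
Definition typeB_poly (i : 'I_m) (c : {set 'I_n}) : ringRT :=
  \sum_(j < #|c|) (-1) ^+ (i + j) *
    of_R (xvar i (enum_val j)) * of_T (Tvar (c :\ enum_val j)).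

Definition typeB : seq ringRT :=
  [seq typeB_poly p.1 p.2 | p : 'I_m * {set 'I_n} in
     [pred p | (p.2 \in clique_complex m Delta) && (#|p.2| == m.+1)]].

Definition plucker_pair (a b e g : F) : bool :=
  [&& le_plucker (elt e) (elt g), le_plucker (elt e) (min_elt a b),
      val g != [set max_elt a b j | j : 'I_m]
    & perm_eq (enum (val e) ++ enum (val g)) (enum (val a) ++ enum (val b))].

(* The relation that expresses [a][b] through the standard products [e][g].    *)
(* Its coefficients lam are unique in K, since these products are linearly     *)
(* independent, but they are not all 1 or -1, nor given by the sign of a       *)
(* permutation: with m = 3,                                                    *)
(*   [136][245] = [135][246] - [134][256] - [123][456],                        *)
(* where the products [125][346] and [124][356] have coefficient 0; for        *)
(* m = 5 coefficients of absolute value up to 4 occur.                         *)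
Definition typeC_poly (lam : F -> F -> F -> F -> int) (a b : F) : ringT :=
  Tvar (val a) * Tvar (val b)
  - Tvar [set min_elt a b j | j : 'I_m] * Tvar [set max_elt a b j | j : 'I_m]
  + \sum_(p : F * F | plucker_pair a b p.1 p.2)
      (lam a b p.1 p.2)%:~R * Tvar (val p.1) * Tvar (val p.2).

Definition typeC (lam : F -> F -> F -> F -> int)
    (r : nat) (u v : 'I_r.+1 -> 'I_n) : seq ringT :=
  [seq typeC_poly lam p.1 p.2 | p : F * F in
     [pred p | [&& ~~ le_plucker (elt p.1) (elt p.2),
                   ~~ le_plucker (elt p.2) (elt p.1)
                 & (clique_index u v p.1 <= clique_index u v p.2)%N]]].

End BlowUp.

(* Main.v *)
Require Import Defs.
From HB Require Import structures.
From mathcomp Require Import all_boot all_order all_algebra.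
From mathcomp Require Import mpoly.
From mathcomp Require Import boolp fingroup perm action ring zify.
From mathcomp Require finmap monalg.

Set Implicit Arguments.
Unset Strict Implicit.
Unset Printing Implicit Defensive.

(** The straightening law rewrites every product [a][b] as a combination of
    standard products [e][g], and the initial monomials x_(1,a_1) ... x_(m,a_m)
    of the minors turn all the relations (A), (B), (C) into binomials. With a
    monomial order that first compares the initial monomials of the images in
    R[t] and then prefers larger indices, the leading terms are T_a T_b for
    incomparable a and b, x_(i,k) T_a for a_(i-1) < k < a_i with k and a in a
    common clique, and x_(1,b_1) ... x_(m,b_m) T_a for b_i < a_i for all i with
    a and b in no common clique. A monomial divisible by none of these is
    determined by the initial monomial of its image: compare the smallest facets
    of two such monomials with the same image, then cancel them. Hence the
    irreducible monomials have linearly independent images, so the relations form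
    a Gröbner basis; (A) and (B) are linear in T and come from the symmetric
    algebra, which gives fiber type. *)

(** Images in R[t] are compared first because weights alone cannot select the leading terms: all
    monomials of [b] T_a have the weight of T_a, and among the terms of (B) the weight always
    favours the facet without c_1, whatever the row i. Comparing images selects the diagonal and
    leaves exactly two terms tied in each relation; the weight, a strictly concave increasing
    function of the sum of a facet, breaks the tie. For (C) this requires that no product in the
    straightening of [a][b] has a larger initial monomial than [a][b] itself.

    Straightening is carried out over the integers, since the Garnir argument divides by the order
    of a stabilizer, which can vanish in K. That the cliques are intervals enters twice: the rows
    produced by straightening are again facets, and a column between two columns of a facet lies in
    every clique of that facet. *)

Import Order.TTheory GRing.Theory Num.Theory.
Local Open Scope ring_scope.

(** * Gröbner bases *)

Section IdealGen.
Variables (A : comNzRingType) (G : A -> Prop).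

Lemma ideal_gen_mem f : G f -> ideal_gen G f.
Proof.
move=> Gf; exists [:: (1, f)]; split; last by rewrite big_seq1 mul1r.
by move=> p; rewrite inE => /eqP ->.
Qed.

Lemma ideal_gen0 : ideal_gen G 0.
Proof. by exists [::]; split=> //; rewrite big_nil. Qed.

Lemma ideal_genD f g : ideal_gen G f -> ideal_gen G g -> ideal_gen G (f + g).
Proof.
move=> [s [sG ->]] [t [tG ->]]; exists (s ++ t); split; last by rewrite big_cat.
by move=> p; rewrite mem_cat => /orP[/sG|/tG].
Qed.

Lemma ideal_genM a f : ideal_gen G f -> ideal_gen G (a * f).
Proof.
move=> [s [sG ->]]; exists [seq (a * p.1, p.2) | p <- s]; split.
  by move=> _ /mapP[p /sG Gp ->].
by rewrite big_map mulr_sumr; apply: eq_bigr => p _; rewrite mulrA.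
Qed.

Lemma ideal_genN f : ideal_gen G f -> ideal_gen G (- f).
Proof. by rewrite -mulN1r; apply: ideal_genM. Qed.

Lemma ideal_genB f g : ideal_gen G f -> ideal_gen G g -> ideal_gen G (f - g).
Proof. by move=> Gf /ideal_genN; apply: ideal_genD. Qed.

Lemma ideal_gen_min (I : A -> Prop) :
    I 0 -> (forall f g, I f -> I g -> I (f + g)) ->
    (forall a f, I f -> I (a * f)) -> (forall f, G f -> I f) ->
  forall f, ideal_gen G f -> I f.
Proof.
move=> I0 ID IM GI f [s [sG ->]]; rewrite big_seq.
by apply: (big_ind I) => // p /sG/GI; apply: IM.
Qed.

End IdealGen.

Lemma ideal_gen_sub (A : comNzRingType) (G H : A -> Prop) :
    (forall f, G f -> ideal_gen H f) ->
  forall f, ideal_gen G f -> ideal_gen H f.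
Proof.
by move=> GH; apply: ideal_gen_min => //;
  [apply: ideal_gen0 | apply: ideal_genD | apply: ideal_genM].
Qed.

Section Groebner.
Variables (K : fieldType) (N : nat) (le : rel 'X_{1..N}).
Variables (G : seq {mpoly K[N]}) (I : {mpoly K[N]} -> Prop).
Hypothesis le_order : monomial_order le.

Let le_refl mu : le mu mu.
Proof. by have := mord_total le_order mu mu; rewrite orbb. Qed.

Lemma is_leadP (f h : {mpoly K[N]}) (c : K) mu :
    c != 0 -> f = c *: 'X_[mu] + h ->
    (forall nu, nu \in msupp h -> le nu mu && (nu != mu)) ->
  is_lead le f mu.
Proof.
move=> c0 -> hlt.
have hmu : h@_mu = 0.
  by apply: memN_msupp_eq0; apply/negP => /hlt; rewrite eqxx andbF.
split; first by rewrite mcoeff_msupp mcoeffD hmu mcoeffZ mcoeffX eqxx mulr1 addr0.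
move=> nu /msuppD_le; rewrite mem_cat => /orP[|/hlt/andP[] //].
by move/msuppZ_le/mem_msuppXP <-.
Qed.

Definition reducible mu :=
  exists g nu, [/\ g \in G, is_lead le g nu & (nu <= mu)%MM].

(** [B] records where the remainder lives. Keeping it below the monomial that was reduced is what
    later prevents a leading monomial from being cancelled. *)
Definition has_remainder (B : 'X_{1..N} -> Prop) (f : {mpoly K[N]}) :=
  exists h, ideal_gen (fun g => g \in G) (f - h) /\
    forall mu, mu \in msupp h -> ~ reducible mu /\ B mu.

Lemma has_remainder_sum B (f : {mpoly K[N]}) :
    (forall mu, mu \in msupp f -> has_remainder B 'X_[mu]) ->
  has_remainder B f.
Proof.
move=> fB; rewrite (mpolyE f) big_seq; apply: big_ind.
- by exists 0; rewrite subr0; split; [apply: ideal_gen0 | move=> mu; rewrite msupp0].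
- move=> p q [h [ph hB]] [k [qk kB]]; exists (h + k); split.
    by rewrite opprD addrACA; apply: ideal_genD.
  by move=> mu /msuppD_le; rewrite mem_cat => /orP[/hB|/kB].
move=> mu /fB[h [muh hB]]; exists (f@_mu *: h); split.
  by rewrite -scalerBr -mul_mpolyC; apply: ideal_genM.
by move=> nu /msuppZ_le /hB.
Qed.

Hypothesis G_homog : forall g, g \in G ->
  exists d, forall mu, mu \in msupp g -> mdeg mu = d.

(** Reduction terminates because [G] is homogeneous: a step stays in the degree of [mu], where the
    set [below mu d] of smaller monomials is finite and shrinks. This takes the place of Dickson's
    lemma. *)
Lemma remainderP mu : has_remainder (fun nu => le nu mu) 'X_[mu].
Proof.
pose below mu d := [set nu : 'X_{1..N < d.+1} | le (val nu) mu && (val nu != mu)].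
move: {-2}(mdeg mu) (erefl (mdeg mu)) => d.
have [k] := ubnP #|below mu d|.
elim: k => // k IHk in mu * => lek mud.
have [[g [nu [gG [nug led] nule]]]|nred] := pselect (reducible mu); last first.
  exists 'X_[mu]; rewrite subrr; split; first exact: ideal_gen0.
  by move=> nu /mem_msuppXP <-.
have cg : g@_nu != 0 by rewrite -mcoeff_msupp.
have [e ge] := G_homog gG.
pose q := 'X_[mu] - ((g@_nu)^-1 *: 'X_[mu - nu]) * g.
have qlt sg : sg \in msupp q -> [/\ le sg mu, sg != mu & mdeg sg = d].
  move=> sgq; have sgmu : sg != mu.
    apply: contraTneq sgq => ->; rewrite mcoeff_msupp negbK /q mcoeffB mcoeffX eqxx.
    rewrite -scalerAl mcoeffZ mulrC [_ * g]mulrC -[X in _@_X](submK nule) mcoeffMX.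
    by rewrite mulfV // subrr.
  move: sgq => /msuppB_le; rewrite mem_cat => /orP[/mem_msuppXP emu|].
    by rewrite emu eqxx in sgmu.
  rewrite -scalerAl => /msuppZ_le; rewrite mulrC (perm_mem (msuppMX _ _)) => /mapP[ta tag esg].
  split=> //.
    rewrite esg [X in le X]addmC -[X in le _ X](submK nule) [X in le _ X]addmC.
    exact: (mord_add le_order) (led _ tag).
  by rewrite esg mdegD (ge _ tag) -(ge _ nug) -mdegD submK.
have [h [qh hB]] : has_remainder (fun nu => le nu mu) q.
  apply: has_remainder_sum => sg /qlt[lesg nesg dsg].
  have [] := IHk sg _ (esym dsg).
    rewrite ltnS in lek; apply: leq_trans lek; apply: proper_card.
    rewrite properE; apply/andP; split.
      apply/fintype.subsetP => ta; rewrite !inE => /andP[leta neta].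
      rewrite (mord_trans le_order leta lesg) /=.
      apply: contra neta => /eqP eta; apply/eqP; apply: (mord_anti le_order).
      by apply/andP; split; [exact: leta | exact: etrans (congr1 (le sg) eta) lesg].
    have dsg' : (mdeg sg < d.+1)%N by rewrite dsg.
    apply/fintype.subsetPn; exists (BMultinom dsg'); rewrite !inE /= ?lesg ?nesg //.
    by rewrite eqxx andbF.
  move=> h [sgh hB]; exists h; split=> // nu' /hB[? ?]; split=> //.
  exact: (mord_trans le_order) lesg.
exists h; split=> //.
have -> : 'X_[mu] - h = (q - h) + ((g@_nu)^-1 *: 'X_[mu - nu]) * g.
  by rewrite addrAC subrK.
by apply: ideal_genD => //; apply/ideal_genM/ideal_gen_mem.
Qed.

Hypothesis I0 : I 0.
Hypothesis ID : forall f g, I f -> I g -> I (f + g).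
Hypothesis IM : forall a f, I f -> I (a * f).
Hypothesis GI : forall g, g \in G -> I g.
Hypothesis I_irreducible : forall f, I f ->
  (forall mu, mu \in msupp f -> ~ reducible mu) -> f = 0.

Let ideal_genI f : ideal_gen (fun g => g \in G) f -> I f.
Proof. exact: ideal_gen_min. Qed.

Let IB f g : I f -> I g -> I (f - g).
Proof. by move=> If Ig; apply: ID => //; rewrite -mulN1r; apply: IM. Qed.

Lemma groebner_generates f : I f -> ideal_gen (fun g => g \in G) f.
Proof.
move=> If; have [h [fh hred]] : has_remainder (fun=> True) f.
  apply: has_remainder_sum => mu _; have [h [muh hB]] := remainderP mu.
  by exists h; split=> // nu /hB[].
suff h0 : h = 0 by rewrite h0 subr0 in fh.
apply: I_irreducible; last by move=> mu /hred[].
by rewrite -(subKr f h); apply/IB/ideal_genI.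
Qed.

(** If [mu] were irreducible, reduce only the other terms [f'] of [f]. Their remainder [h] avoids
    [mu], so the leading term of [f] plus [h] is a nonzero element of [I] supported on irreducible
    monomials, which is impossible. *)
Lemma lead_reducible f mu : I f -> is_lead le f mu -> reducible mu.
Proof.
move=> If [muf led]; have [//|nred] := pselect (reducible mu).
pose f' := f - f@_mu *: 'X_[mu].
have f'lt nu : nu \in msupp f' -> nu != mu /\ nu \in msupp f.
  rewrite !mcoeff_msupp mcoeffB mcoeffZ mcoeffX.
  by case: (eqVneq mu nu) => [->|_]; rewrite ?mulr1 ?subrr ?eqxx // mulr0 subr0.
have [h [fh hB]] : has_remainder (fun nu => nu != mu) f'.
  apply: has_remainder_sum => nu /f'lt[nenu nuf].
  have [h [nuh hB]] := remainderP nu; exists h; split=> // sg /hB[? lesg].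
  split=> //; apply: contra nenu => /eqP esg.
  by apply/eqP/(mord_anti le_order); rewrite led //= -esg.
have hmu : h@_mu = 0.
  by apply/memN_msupp_eq0/negP => /hB[_]; rewrite eqxx.
have : f@_mu *: 'X_[mu] + h = 0.
  apply: I_irreducible.
    have -> : f@_mu *: 'X_[mu] + h = f - (f' - h).
      by rewrite /f' -addrA -opprD subKr.
    exact/IB/ideal_genI.
  move=> nu /msuppD_le; rewrite mem_cat => /orP[/msuppZ_le/mem_msuppXP <- //|].
  by case/hB.
move/(congr1 (mcoeff mu)); rewrite mcoeffD mcoeffZ mcoeffX eqxx hmu mcoeff0.
by rewrite mulr1 addr0 => /eqP; rewrite (negbTE (_ : _ != 0)) // -mcoeff_msupp.
Qed.

Lemma groebner_basisP : groebner_basis le G I.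
Proof.
split=> // h; split; apply: ideal_gen_sub => {h} h [f [mu [fI leadf ->]]].
  have [g [nu [gG leadg nule]]] := lead_reducible fI leadf.
  rewrite -(submK nule) mpolyXD; apply: ideal_genM; apply: ideal_gen_mem.
  by exists g, nu.
by apply: ideal_gen_mem; exists f, mu; split=> //; apply: GI.
Qed.

End Groebner.

(** The order of ['X_{1..N}] compares degrees, then exponents lexicographically from the first
    variable on. *)
Lemma mnm_order N : monomial_order (fun mu nu : 'X_{1..N} => (mu <= nu)%O).
Proof.
split.
- exact: le_total.
- exact: le_anti.
- exact: le_trans.
- exact: le0m.
- by move=> mu nu la le; rewrite lemc_add2l.
Qed.

(** * Refining a monomial order by an additive function *)

Section RefinedOrder.
Variables (N : nat) (d : Order.disp_t) (T : orderType d) (le : rel 'X_{1..N}).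
Variables (add : T -> T -> T) (f : 'X_{1..N} -> T).

(** [T] will be the natural numbers, for weights, or the monomials of another polynomial ring, for
    images. *)
Definition refined_order mu nu := (f mu < f nu)%O || (f mu == f nu) && le mu nu.

Lemma refined_orderP :
    monomial_order le -> (forall x, {mono add^~ x : y z / (y < z)%O}) ->
    (forall mu nu, f (mu + nu)%MM = add (f mu) (f nu)) ->
    (forall mu, (f 0%MM <= f mu)%O) ->
  monomial_order refined_order.
Proof.
move=> leo add_mono fD f0; rewrite /refined_order; split.
- by move=> mu nu; case: (ltgtP (f mu) (f nu)) => //= _; apply: (mord_total leo).
- by move=> mu nu; case: (ltgtP (f mu) (f nu)) => //= _; apply: (mord_anti leo).
- move=> nu mu la; case: (ltgtP (f mu) (f nu)) => //= [lt _|->].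
    by case: (ltgtP (f nu) (f la)) => //= [/(lt_trans lt) -> //|<- _]; rewrite lt.
  by case: (ltgtP (f nu) (f la)) => //= _; apply: (mord_trans leo).
- by move=> mu; have := f0 mu; rewrite le_eqVlt orbC => /orP[->|->] //=; rewrite (mord_ge0 leo) orbT.
move=> mu nu la; rewrite !fD add_mono => /orP[-> //|/andP[/eqP-> /(mord_add leo)->]].
by rewrite eqxx orbT.
Qed.

End RefinedOrder.

(** * Increasing sequences *)

Section Increasing.
Variables (m n : nat).
Implicit Types (s t : 'I_m -> 'I_n).

Definition increasing s : bool :=
  [forall i : 'I_m, forall j : 'I_m, (i < j)%N ==> (s i < s j)%N].

Lemma increasingP s :
  reflect (forall i j : 'I_m, (i < j)%N -> (s i < s j)%N) (increasing s).
Proof.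
apply: (iffP forallP) => [s_incr i j ij|s_incr i].
  by have /forallP/(_ j)/implyP := s_incr i; apply.
by apply/forallP => j; apply/implyP; apply: s_incr.
Qed.

Lemma increasing_inj s : increasing s -> injective s.
Proof.
move=> /increasingP s_incr i j eq_s; apply/val_inj.
by case: (ltngtP (val i) (val j)) => // /s_incr; rewrite eq_s ltnn.
Qed.

Lemma increasing_le s (i j : 'I_m) :
  increasing s -> (i <= j)%N -> (s i <= s j)%N.
Proof.
move=> /increasingP s_incr; rewrite leq_eqVlt => /orP[/eqP ij|/s_incr/ltnW //].
by rewrite (val_inj ij).
Qed.

(** The counting function does not depend on the order of the entries, and it determines an
    increasing row. The Plücker order of sorted rows can thus be tested before sorting. *)
Definition count_le s (x : nat) : nat := (\sum_(j < m) (s j <= x))%N.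

(** The indices whose entry is at most [x] form an initial segment. *)
Lemma count_leE s x (j : 'I_m) : increasing s -> (j < count_le s x)%N = (s j <= x)%N.
Proof.
move=> s_incr; rewrite /count_le -big_mkcond sum1_card /=.
have card_below k : (k <= m)%N -> #|[pred i : 'I_m | (i < k)%N]| = k.
  move=> km; rewrite -sum1_card -[RHS]card_ord -sum1_card.
  by rewrite (big_ord_widen _ (fun=> 1%N) km).
have [sjx|sjx] := leqP (s j) x.
  rewrite -[X in (X <= _)%N](card_below _ (ltn_ord j)); apply/subset_leq_card/subsetP => i.
  by rewrite !inE ltnS => /(increasing_le s_incr)/leq_trans; apply.
apply/negbTE; rewrite -leqNgt -[X in (_ <= X)%N](card_below _ (ltnW (ltn_ord j))).
apply/subset_leq_card/subsetP => i; rewrite !inE => six; rewrite ltnNge.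
by apply/negP => /(increasing_le s_incr)/leq_trans/(_ six); rewrite leqNgt sjx.
Qed.

Lemma le_pluckerP s t :
  reflect (forall j, (s j <= t j)%N) (le_plucker s t).
Proof. exact: forallP. Qed.

Lemma le_plucker_count s t : increasing s -> increasing t ->
  le_plucker s t <-> (forall x, (count_le t x <= count_le s x)%N).
Proof.
move=> s_incr t_incr; split=> [/le_pluckerP st x|st].
  apply: leq_sum => j _; case tjx: (t j <= x)%N => //.
  by rewrite (leq_trans (st j) tjx).
apply/le_pluckerP => j; rewrite -(count_leE _ _ s_incr).
by apply: leq_trans (st _); rewrite count_leE.
Qed.

Lemma le_plucker_anti s t : le_plucker s t -> le_plucker t s -> s =1 t.
Proof.
move=> /le_pluckerP st /le_pluckerP ts j; apply/val_inj/eqP.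
by rewrite eqn_leq st ts.
Qed.

Definition sum_val s : nat := (\sum_(j < m) s j)%N.

Lemma sum_val_le s t : le_plucker s t -> (sum_val s <= sum_val t)%N.
Proof. by move=> /le_pluckerP st; apply: leq_sum. Qed.

Lemma sum_val_lt s t : le_plucker s t -> ~ s =1 t -> (sum_val s < sum_val t)%N.
Proof.
move=> st nst; rewrite ltn_neqAle sum_val_le // andbT; apply/eqP => sum_eq.
apply: nst => j; apply/val_inj/eqP; move: st => /le_pluckerP st.
rewrite eqn_leq st leqNgt; apply/negP => stj; move/eqP: sum_eq.
apply/negP; rewrite neq_ltn /sum_val (bigD1 j) //= [X in (_ < X)%N](bigD1 j) //=.
by rewrite -addSn leq_add // leq_sum.
Qed.

Lemma sum_val_max s : (sum_val s <= m * n)%N.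
Proof.
rewrite -[X in (X * _)%N]card_ord -sum_nat_const.
by apply: leq_sum => j _; apply/ltnW/ltn_ord.
Qed.

(** Equality of the multisets of entries, expressed through sums so that no permutation of the 2m
    entries has to be handled; indicator functions [F] give back the counts. *)
Definition same_content s t s' t' := forall F : 'I_n -> nat,
  (\sum_j F (s j) + \sum_j F (t j) = \sum_j F (s' j) + \sum_j F (t' j))%N.

End Increasing.

Lemma enum_val_increasing n (A : {set 'I_n}) (i j : 'I_#|A|) :
  (i < j)%N -> (enum_val i < enum_val j)%N.
Proof.
move=> ij; have n0 := enum_val i; rewrite !(enum_val_nth n0).
have sA : sorted (fun x y : 'I_n => x < y)%N (enum A).
  rewrite {1}/enum_mem -enumT; apply: sorted_filter; first exact: (fun x y z => @ltn_trans x y z).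
  by have := iota_ltn_sorted 0 n; rewrite -val_enum_ord sorted_map.
by apply: (sorted_ltn_nth _ _ sA) => //; rewrite ?inE -?cardE //; move=> x y z; apply: ltn_trans.
Qed.

Lemma increasing_rearrangement m n (s : 'I_m -> 'I_n) : injective s ->
  exists (t : 'I_m -> 'I_n) (p : 'S_m), increasing t /\ forall j, t j = s (p j).
Proof.
move=> s_inj; pose A := [set s j | j in 'I_m].
have cA : m = #|A| by rewrite card_imset // card_ord.
pose t j : 'I_n := enum_val (cast_ord cA j).
have tA j : exists k, t j == s k.
  by have /imsetP[k _ ->] : t j \in A by [exact: enum_valP]; exists k.
pose f j := xchoose (tA j).
have fE j : t j = s (f j) by apply/eqP/(xchooseP (tA j)).
have f_inj : injective f.
  move=> i j eq_f; have : t i = t j by rewrite !fE eq_f.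
  by move=> /enum_val_inj/cast_ord_inj.
exists t, (perm f_inj); split; last by move=> j; rewrite permE.
by apply/increasingP => i j ij; apply: enum_val_increasing.
Qed.

(** * Garnir relations *)

Section ColumnMinor.
Variables (R : comNzRingType) (m : nat) (C : Type) (X : 'I_m -> C -> R).

Definition column_minor (s : 'I_m -> C) : R := \det (\matrix_(i, j) X i (s j)).

Lemma eq_column_minor s t : s =1 t -> column_minor s = column_minor t.
Proof. by move=> st; congr (\det _); apply/matrixP => i j; rewrite !mxE st. Qed.

Lemma column_minorE s :
  column_minor s = \sum_(p : 'S_m) (-1) ^+ p * \prod_j X (p j) (s j).
Proof.
rewrite /column_minor -det_tr; apply: eq_bigr => p _; congr (_ * _).
by apply: eq_bigr => j _; rewrite !mxE.
Qed.

Lemma column_minor_perm s (p : 'S_m) :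
  column_minor (s \o p) = (-1) ^+ p * column_minor s.
Proof.
rewrite /column_minor mulrC -odd_permV -det_perm -det_mulmx -col_permE.
by congr (\det _); apply/matrixP => i j; rewrite !mxE.
Qed.

Lemma column_minor_noninj s : ~ injective s -> column_minor s = 0.
Proof.
have [//|nij] := pselect (exists i j, s i = s j /\ i != j).
  move=> [i [j [sij ij]]] _; rewrite /column_minor -det_tr.
  by apply: (determinant_alternate ij) => k; rewrite !mxE sij.
case=> i j sij; apply/eqP/negPn/negP => ij; apply: nij; by exists i, j.
Qed.

Section Garnir.
Variables (i : 'I_m) (a b : 'I_m -> C) (w : 'I_m.+1 -> C).

(** The m+1 columns [w] are permuted by [p]. Positions 0 to i of the permuted sequence fill the
    places 0 to i of the second minor, and positions i+1 to m fill the places i to m-1 of the first,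
    whence [lift ord0 j]. *)
Definition garnir_fst (p : 'S_m.+1) (j : 'I_m) : C :=
  if (j < i)%N then a j else w (p (lift ord0 j)).

Definition garnir_snd (p : 'S_m.+1) (j : 'I_m) : C :=
  if (j <= i)%N then w (p (widen_ord (leqnSn m) j)) else b j.

Definition garnir_term (p : 'S_m.+1) : R :=
  (-1) ^+ p * column_minor (garnir_fst p) * column_minor (garnir_snd p).

(* Expanding both minors, the sum over p becomes, for each choice of the other *)
(* two permutations, an (m+1)-minor with rows among the m rows of X.           *)
Lemma garnir_sum : \sum_p garnir_term p = 0.
Proof.
(* In [r] the default [i] is never reached: [k] is below [m] in the first branch and [k.-1] in the
   second. *)
pose dft (k : nat) : 'I_m := odflt i (insub k).
pose r (t t' : 'S_m) (k : 'I_m.+1) := if (k <= i)%N then t' (dft k) else t (dft k.-1).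
pose c (t t' : 'S_m) := (-1) ^+ t * (-1) ^+ t' *
  ((\prod_(j < m) if (j < i)%N then X (t j) (a j) else 1) *
   (\prod_(j < m) if (j <= i)%N then 1 else X (t' j) (b j))).
have expand (p : 'S_m.+1) : garnir_term p = \sum_t \sum_t'
    c t t' * ((-1) ^+ p * \prod_k X (r t t' k) (w (p k))).
  rewrite /garnir_term !column_minorE -mulrA mulr_suml mulr_sumr; apply: eq_bigr => t _ /=.
  rewrite mulr_sumr mulr_sumr; apply: eq_bigr => t' _ /=.
  have -> : \prod_k X (r t t' k) (w (p k)) =
      (\prod_(j < m) if (j <= i)%N then X (t' j) (w (p (widen_ord (leqnSn m) j))) else 1) *
      (\prod_(j < m) if (j < i)%N then 1 else X (t j) (w (p (lift ord0 j)))).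
    transitivity ((\prod_(k < m.+1) if (k <= i)%N then X (t' (dft k)) (w (p k)) else 1) *
        (\prod_(k < m.+1) if (k <= i)%N then 1 else X (t (dft k.-1)) (w (p k)))).
      rewrite -big_split; apply: eq_bigr => k _ /=; rewrite /r.
      by case: ifP; rewrite ?mulr1 ?mul1r.
    rewrite big_ord_recr [X in _ * X]big_ord_recl /= leqNgt ltn_ord /= mulr1 mul1r.
    by congr (_ * _); apply: eq_bigr => j _; rewrite /dft valK.
  have -> : \prod_j X (t j) (garnir_fst p j) =
      (\prod_(j < m) if (j < i)%N then X (t j) (a j) else 1) *
      (\prod_(j < m) if (j < i)%N then 1 else X (t j) (w (p (lift ord0 j)))).
    rewrite -big_split; apply: eq_bigr => j _ /=; rewrite /garnir_fst.
    by case: ifP; rewrite ?mulr1 ?mul1r.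
  have -> : \prod_j X (t' j) (garnir_snd p j) =
      (\prod_(j < m) if (j <= i)%N then X (t' j) (w (p (widen_ord (leqnSn m) j))) else 1) *
      (\prod_(j < m) if (j <= i)%N then 1 else X (t' j) (b j)).
    rewrite -big_split; apply: eq_bigr => j _ /=; rewrite /garnir_snd.
    by case: ifP; rewrite ?mulr1 ?mul1r.
  rewrite /c; move: (\prod_j _) (\prod_j _) (\prod_j _) (\prod_j _) => x y z u.
  move: ((-1) ^+ p) ((-1) ^+ t) ((-1) ^+ t') => e f g; ring.
rewrite (eq_bigr _ (fun p _ => expand p)) exchange_big big1 // => t _ /=.
rewrite exchange_big big1 // => t' _ /=; rewrite -mulr_sumr.
suff -> : \sum_(p : 'S_m.+1) (-1) ^+ p * (\prod_k X (r t t' k) (w (p k))) = 0.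
  by rewrite mulr0.
transitivity (\det (\matrix_(k, l) X (r t t' k) (w l))).
  by apply: eq_bigr => p _; congr (_ * _); apply: eq_bigr => k _; rewrite mxE.
have /injectivePn[k [l lk rkl]] : ~~ injectiveb (r t t').
  by apply/negP => /injectiveP/leq_card; rewrite !card_ord ltnn.
by apply: (determinant_alternate lk) => j; rewrite !mxE rkl.
Qed.

Let S := [set k : 'I_m.+1 | (i < k)%N].

(** [S] is the set of positions that feed the first minor. Such a transposition swaps two columns of
    one minor and leaves the other unchanged, so the sign of that minor cancels the sign of the
    transposition. *)
Lemma garnir_term_tperm x y p : x != y -> (x \in S) = (y \in S) ->
  garnir_term (tperm x y * p)%g = garnir_term p.
Proof.
move=> xy; rewrite !inE => xyS.
have sgn (x' y' : 'I_m) : x' != y' ->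
  (-1) ^+ (tperm x y * p)%g = (-1) ^+ p * (-1) ^+ (tperm x' y') :> R.
  move=> ne; rewrite odd_permM !odd_tperm xy ne /= mulrN1.
  by case: (odd_perm p); rewrite ?opprK.
have sgn2 (x' y' : 'I_m) : x' != y' -> (-1) ^+ (tperm x' y') = -1 :> R.
  by move=> ne; rewrite odd_tperm ne.
have [ix|xi] := ltnP i x; last first.
  have yi : (y <= i)%N by rewrite leqNgt -xyS -leqNgt.
  pose x' := Ordinal (leq_ltn_trans xi (ltn_ord i)).
  pose y' := Ordinal (leq_ltn_trans yi (ltn_ord i)).
  have xE : x = widen_ord (leqnSn m) x' by apply/val_inj.
  have yE : y = widen_ord (leqnSn m) y' by apply/val_inj.
  have ne : x' != y' by apply: contra xy => /eqP exy; rewrite xE yE exy.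
  rewrite /garnir_term (sgn _ _ ne).
  have -> : column_minor (garnir_fst (tperm x y * p)%g) = column_minor (garnir_fst p).
    apply: eq_column_minor => j; rewrite /garnir_fst permM; case: ltnP => // ij.
    rewrite tpermD // eq_sym; apply/eqP => /(congr1 val) /= /eqP;
      by rewrite gtn_eqF // ltnS (leq_trans _ ij).
  have -> : column_minor (garnir_snd (tperm x y * p)%g) =
      column_minor (garnir_snd p \o tperm x' y').
    apply: eq_column_minor => j; rewrite /garnir_snd permM /=.
    have -> : (tperm x' y' j <= i)%N = (j <= i)%N by case: tpermP => [->|->|] //=; rewrite xi yi.
    have [ji|ij] := leqP j i; last first.
      by rewrite tpermD //; apply/eqP => /(congr1 val) /= /eqP; rewrite ltn_eqF // (leq_ltn_trans _ ij).
    rewrite xE yE -inj_tperm //.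
    by move=> u v /(congr1 val) /= /val_inj.
  rewrite column_minor_perm (sgn2 _ _ ne).
  by rewrite !(mulrN1, mulN1r, mulrN, mulNr, opprK).
have iy : (i < y)%N by rewrite -xyS.
have lt_pred (z : 'I_m.+1) : (i < z)%N -> (z.-1 < m)%N.
  by move=> iz; rewrite -ltnS prednK ?ltn_ord // (leq_ltn_trans _ iz).
pose x' := Ordinal (lt_pred _ ix); pose y' := Ordinal (lt_pred _ iy).
have xE : x = lift ord0 x' by apply/val_inj; rewrite /= /bump /= add1n prednK // (leq_ltn_trans _ ix).
have yE : y = lift ord0 y' by apply/val_inj; rewrite /= /bump /= add1n prednK // (leq_ltn_trans _ iy).
have ne : x' != y' by apply: contra xy => /eqP exy; rewrite xE yE exy.
have ix' : (i <= x')%N by rewrite -ltnS prednK // (leq_ltn_trans _ ix).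
have iy' : (i <= y')%N by rewrite -ltnS prednK // (leq_ltn_trans _ iy).
rewrite /garnir_term (sgn _ _ ne).
have -> : column_minor (garnir_snd (tperm x y * p)%g) = column_minor (garnir_snd p).
  apply: eq_column_minor => j; rewrite /garnir_snd permM; case: leqP => // ji.
  rewrite tpermD //; apply/eqP => /(congr1 val) /= /eqP;
    by rewrite gtn_eqF // (leq_ltn_trans ji).
have -> : column_minor (garnir_fst (tperm x y * p)%g) =
    column_minor (garnir_fst p \o tperm x' y').
  apply: eq_column_minor => j; rewrite /garnir_fst permM /=.
  have -> : (tperm x' y' j < i)%N = (j < i)%N.
    by case: tpermP => [->|->|] //; rewrite [LHS]ltnNge [RHS]ltnNge ix' iy'.
  have [ji|ij] := ltnP j i.
    by rewrite tpermD //; apply/eqP => /(congr1 val) /= /eqP; rewrite gtn_eqF // (leq_trans ji).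
  rewrite xE yE -inj_tperm //; exact: lift_inj.
rewrite column_minor_perm (sgn2 _ _ ne).
by rewrite !(mulrN1, mulN1r, mulrN, mulNr, opprK).
Qed.

(** A permutation that stabilizes [S] is a product of transpositions inside [S] or inside its
    complement. Splitting off the transposition of [x] and [h x] makes [h x] a fixed point, so the
    number of moved points decreases. *)
Lemma garnir_term_stab (h p : 'S_m.+1) : (forall x, (h x \in S) = (x \in S)) ->
  garnir_term (h * p)%g = garnir_term p.
Proof.
have [k] := ubnP #|[set x | h x != x]|.
elim: k => // k IHk in h p *; rewrite ltnS => hk hS.
have [h0|[x]] := set_0Vmem [set x | h x != x].
  suff -> : h = 1%g by rewrite mul1g.
  by apply/permP => x; rewrite perm1; apply/eqP/negPn/negP => hx; have := in_set0 x; rewrite -h0 inE hx.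
rewrite inE => hx; pose y := h x; pose h' := (tperm x y * h)%g.
have hE : h = (tperm x y * h')%g by rewrite /h' mulgA tperm2 mul1g.
have h'E z : h' z = h (tperm x y z) by rewrite permM.
rewrite hE -mulgA garnir_term_tperm ?hS // 1?eq_sym //; apply: IHk.
  apply: leq_trans hk; apply: proper_card; rewrite properE; apply/andP; split.
    apply/fintype.subsetP => z; rewrite !inE h'E; case: tpermP => [-> _ //|->|//].
    by rewrite -/y eqxx.
  apply/fintype.subsetPn; exists y; rewrite !inE ?h'E ?tpermR ?eqxx //.
  by apply: contra hx => /eqP/perm_inj hyx; apply/eqP.
by move=> z; rewrite h'E hS; case: tpermP => [->|->|//]; rewrite hS.
Qed.

(** The terms are constant on the right cosets of the stabilizer [H] of [S], so [garnir_sum] is #|H|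
    times a sum over representatives, and torsion-freeness removes this factor. The coset [H] yields
    the isolated term. A representative outside [H] does not map [S] into itself, which gives the
    index [k]. *)
Lemma garnir_relation : (forall k (x : R), x *+ k.+1 = 0 -> x = 0) ->
  exists2 s : seq 'S_m.+1, garnir_term 1%g = - \sum_(p <- s) garnir_term p
    & forall p, p \in s -> exists2 k : 'I_m.+1, (i < k)%N & (p k <= i)%N.
Proof.
move=> torsion_free.
pose H := 'N(S | 'P)%g.
have HS h : h \in H -> forall x, (h x \in S) = (x \in S).
  by move=> hH x; rewrite -(astabs_act x hH).
have repr_const (p q : 'S_m.+1) : q \in (H :* p)%g -> garnir_term q = garnir_term p.
  by case/rcosetP => h hH ->; apply: garnir_term_stab; apply: HS.
have : (\sum_(A in rcosets H [set: 'S_m.+1]) garnir_term (repr A)) *+ #|H| = 0.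
  rewrite -[RHS]garnir_sum -sumrMnl; symmetry.
  rewrite (eq_bigl (mem [set: 'S_m.+1])) => [|p]; last by rewrite !inE.
  rewrite (set_partition_big _ (rcosets_partition (subsetT H))); apply: eq_bigr => A.
  move=> /rcosetsP[p _ ->]; rewrite -(card_rcoset H p) -sumr_const; apply: eq_bigr => q qA.
  by rewrite (repr_const _ _ qA) (repr_const _ _ (mem_repr_rcoset _ _)).
rewrite -(prednK (cardG_gt0 _)) => /torsion_free.
rewrite (bigD1 (H : {set _})) /=; last by apply/rcosetsP; exists 1%g; rewrite ?inE ?rcoset1.
rewrite repr_group.
move=> /eqP; rewrite addr_eq0 => /eqP ->.
pose s := [seq repr A | A in [pred A | (A \in rcosets H [set: 'S_m.+1]) && (A != H)]].
exists s; first by rewrite big_image.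
move=> _ /imageP[A /andP[/rcosetsP[q _ ->] nH] ->].
have : repr (H :* q)%g \notin H.
  by apply: contra nH => rH; rewrite -(rcoset_repr H q) (rcoset_id rH).
move: (repr _) => p pH; have : ~~ (S \subset 'P%act^~ p @^-1: S).
  by apply: contra pH => Sp; rewrite /H /= /astabs in_setI inE inE.
move=> /fintype.subsetPn[k]; rewrite !inE => ik; rewrite -leqNgt => pk.
by exists k.
Qed.

End Garnir.
End ColumnMinor.

(** * Straightening *)

Section GarnirContent.
Variables (m n : nat) (i : 'I_m) (a b : 'I_m -> 'I_n).
Hypotheses (a_incr : increasing a) (b_incr : increasing b).
Hypothesis (ba : (b i < a i)%N).

(** At a violation b_i < a_i these columns are b_0 < ... < b_i < a_i < ... < a_(m-1), with a_(k-1)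
    at each position k > i; the defaults are never reached. *)
Definition garnir_columns (k : 'I_m.+1) : 'I_n :=
  if (k <= i)%N then b (odflt i (insub (k : nat))) else a (odflt i (insub k.-1)).

Local Notation w := garnir_columns.
Local Notation fst_row := (garnir_fst i a w).
Local Notation snd_row := (garnir_snd i b w).

Lemma garnir_fst1 j : fst_row 1%g j = a j.
Proof.
rewrite /garnir_fst perm1 /garnir_columns /= /bump /= add1n.
by case: ltnP => // ij; rewrite /= valK.
Qed.

Lemma garnir_snd1 j : snd_row 1%g j = b j.
Proof.
by rewrite /garnir_snd perm1 /garnir_columns /=; case: leqP => // ji; rewrite valK.
Qed.

(** Each [p] distributes the same entries of [w] over the free places, so the content is that of the
    identity permutation, which gives back [a] and [b]. *)
Lemma garnir_content p : same_content (fst_row p) (snd_row p) a b.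
Proof.
move=> F; pose rest := (\sum_(j < m) (if (j < i)%N then F (a j) else 0) +
                        \sum_(j < m) (if (j <= i)%N then 0 else F (b j)))%N.
have content (q : 'S_m.+1) :
  (\sum_j F (fst_row q j) + \sum_j F (snd_row q j) = rest + \sum_k F (w (q k)))%N.
  have -> : (\sum_k F (w (q k)) =
      \sum_(j < m) (if (j <= i)%N then F (w (q (widen_ord (leqnSn m) j))) else 0) +
      \sum_(j < m) (if (j < i)%N then 0 else F (w (q (lift ord0 j)))))%N.
    transitivity (\sum_(k < m.+1) (if (k <= i)%N then F (w (q k)) else 0) +
        \sum_(k < m.+1) (if (k <= i)%N then 0 else F (w (q k))))%N.
      by rewrite -big_split; apply: eq_bigr => k _ /=; case: ifP; rewrite ?addn0.
    by rewrite big_ord_recr [X in (_ + X)%N]big_ord_recl /= leqNgt ltn_ord /= addn0.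
  have -> : (\sum_j F (fst_row q j) = \sum_(j < m) (if (j < i)%N then F (a j) else 0) +
      \sum_(j < m) (if (j < i)%N then 0 else F (w (q (lift ord0 j)))))%N.
    rewrite -big_split; apply: eq_bigr => j _ /=; rewrite /garnir_fst.
    by case: ifP; rewrite ?addn0.
  have -> : (\sum_j F (snd_row q j) =
      \sum_(j < m) (if (j <= i)%N then F (w (q (widen_ord (leqnSn m) j))) else 0) +
      \sum_(j < m) (if (j <= i)%N then 0 else F (b j)))%N.
    rewrite -big_split; apply: eq_bigr => j _ /=; rewrite /garnir_snd.
    by case: ifP; rewrite ?addn0.
  rewrite /rest; lia.
rewrite content (reindex_perm p^-1%g) /=; under eq_bigr do rewrite permKV.
have <- : (\sum_j F (fst_row 1%g j) + \sum_j F (snd_row 1%g j) =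
  \sum_j F (a j) + \sum_j F (b j))%N.
  by congr addn; apply: eq_bigr => j _; rewrite ?garnir_fst1 ?garnir_snd1.
by rewrite content; congr addn; apply: eq_bigr => k _; rewrite perm1.
Qed.

(** For x < a_i only the places before [i] count for [a], and those are kept. For x at least a_i,
    the places 0 to i all count for [b], so the second row cannot gain, and by equality of contents
    the first row cannot lose. *)
Lemma garnir_fst_count p x : (count_le a x <= count_le (fst_row p) x)%N.
Proof.
have [aix|xai] := leqP (a i) x; last first.
  apply: leq_sum => j _; rewrite /garnir_fst; case: ltnP => // ij.
  by rewrite [(a j <= x)%N]leqNgt (leq_trans xai) // increasing_le.
have := garnir_content p (fun y => (y <= x)%N : nat).
rewrite -/(count_le _ x) -/(count_le _ x) -/(count_le a x) -/(count_le b x).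
suff : (count_le (snd_row p) x <= count_le b x)%N by lia.
apply: leq_sum => j _; rewrite /garnir_snd; case: (leqP j i) => // ji.
have -> : (b j <= x)%N; last exact: leq_b1.
by rewrite (leq_trans (increasing_le b_incr ji)) // ltnW // (leq_trans ba).
Qed.

(** Position [k] puts some b_l with l at most i, hence an entry at most b_i, in place of an entry of
    [a] beyond b_i. *)
Lemma garnir_fst_count_lt (p : 'S_m.+1) (k : 'I_m.+1) : (i < k)%N -> (p k <= i)%N ->
  (count_le a (b i) < count_le (fst_row p) (b i))%N.
Proof.
move=> ik pk; have km : (k.-1 < m)%N by have := ltn_ord k; lia.
pose j := Ordinal km.
have kE : k = lift ord0 j by apply/val_inj; rewrite /= /bump /=; lia.
rewrite /count_le (bigD1 j) //= [X in (_ < X)%N](bigD1 j) //= -addSn; apply: leq_add.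
  have ij : (i <= j)%N by rewrite /=; lia.
  have ji : (j < i)%N = false by rewrite ltnNge ij.
  rewrite [(a j <= _)%N]leqNgt (leq_trans ba) ?increasing_le //.
  rewrite /garnir_fst ji -kE /garnir_columns pk.
  rewrite lt0b; apply: increasing_le => //; case: insubP => [l _ -> //|/=].
  by rewrite (leq_ltn_trans pk).
apply: leq_sum => l _; rewrite /garnir_fst; case: ltnP => // il.
by rewrite [(a l <= _)%N]leqNgt (leq_trans ba) ?increasing_le.
Qed.

End GarnirContent.

Lemma count_le_rearranged m n (s t : 'I_m -> 'I_n) (p : 'S_m) x :
  (forall j, t j = s (p j)) -> count_le t x = count_le s x.
Proof.
move=> ts; rewrite /count_le [RHS](reindex_perm p); apply: eq_bigr => j _.
by rewrite ts.
Qed.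

(* Locked, as unifying two distinct minors up to unfolding does not terminate  *)
(* in reasonable time.                                                         *)
HB.lock Definition generic_minor (R : comNzRingType) (m n : nat) (s : 'I_m -> 'I_n) :
    {mpoly R[#|{: 'I_m * 'I_n}|]} :=
  column_minor (fun i j => 'X_(enum_rank (i, j))) s.

Section Straightening.
Variables (m n : nat).
Local Notation row := {ffun 'I_m -> 'I_n}.
Local Notation D := (@generic_minor int m n).

Definition minor_span (P : row * row -> Prop) (q : {mpoly int[#|{: 'I_m * 'I_n}|]}) :=
  exists lam : row * row -> int,
    q = \sum_p lam p *: (D p.1 * D p.2) /\ (forall p, lam p != 0 -> P p).

Lemma minor_span0 P : minor_span P 0.
Proof.
exists (fun=> 0); split; last by move=> p; rewrite eqxx.
by rewrite big1 // => p _; rewrite scale0r.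
Qed.

Lemma minor_spanD P x y : minor_span P x -> minor_span P y -> minor_span P (x + y).
Proof.
move=> [lam [-> lamP]] [mu [-> muP]]; exists (fun p => lam p + mu p); split.
  by rewrite -big_split; apply: eq_bigr => p _; rewrite scalerDl.
move=> p; case: (eqVneq (lam p) 0) => [->|/lamP //]; rewrite add0r; exact: muP.
Qed.

Lemma minor_spanZ P c x : minor_span P x -> minor_span P (c *: x).
Proof.
move=> [lam [-> lamP]]; exists (fun p => c * lam p); split.
  by rewrite scaler_sumr; apply: eq_bigr => p _; rewrite scalerA.
by move=> p; rewrite mulf_eq0 negb_or => /andP[_ /lamP].
Qed.

Lemma minor_span_mem (P : row * row -> Prop) p : P p -> minor_span P (D p.1 * D p.2).
Proof.
move=> Pp; exists (fun q => (q == p)%:R); split.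
  rewrite (bigD1 p) //= eqxx scale1r big1 ?addr0 // => q /negbTE->.
  by rewrite scale0r.
by move=> q; have [->|] := eqVneq q p; rewrite ?eqxx.
Qed.

Lemma minor_span_weaken (P Q : row * row -> Prop) x :
  (forall p, P p -> Q p) -> minor_span P x -> minor_span Q x.
Proof. by move=> PQ [lam [-> lamP]]; exists lam; split=> // p /lamP/PQ. Qed.

Definition straight_pair (a b : 'I_m -> 'I_n) (p : row * row) : Prop :=
  [/\ increasing p.1, increasing p.2, le_plucker p.1 p.2, le_plucker p.1 a
    & same_content p.1 p.2 a b].

Lemma int_mpoly_torsion_free N k (x : {mpoly int[N]}) : x *+ k.+1 = 0 -> x = 0.
Proof.
move=> xk; apply/mpolyP => mu; move/(congr1 (mcoeff mu)): xk.
by rewrite mcoeffMn !mcoeff0 => /eqP; rewrite mulrn_eq0 => /orP[//|/eqP].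
Qed.

(** Induction on the sum of the first row. At a violation b_i < a_i the Garnir relation replaces
    [a][b] by products whose first row, once sorted, is strictly below [a] in the Plücker order;
    this also maintains the bound by [a]. *)
Lemma straightening (a b : 'I_m -> 'I_n) : increasing a -> increasing b ->
  minor_span (straight_pair a b) (D a * D b).
Proof.
have [k] := ubnP (sum_val a); elim: k => // k IHk in a b *.
rewrite ltnS => ak a_incr b_incr.
have eqD (s : 'I_m -> 'I_n) : D s = D [ffun j => s j].
  by rewrite generic_minor.unlock; apply: eq_column_minor => j; rewrite ffunE.
have [ab|] := boolP (le_plucker a b).
  rewrite (eqD a) (eqD b); apply: (@minor_span_mem _ (_, _)).
  have eqf (s : 'I_m -> 'I_n) : [ffun j => s j] =1 s by move=> j; rewrite ffunE.
  have eqi (s : 'I_m -> 'I_n) : increasing s -> increasing [ffun j => s j].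
    by move/increasingP => si; apply/increasingP => i j; rewrite !ffunE; apply: si.
  split; rewrite /= ?eqi //.
  - by apply/le_pluckerP => j; rewrite !ffunE; apply/le_pluckerP.
  - by apply/le_pluckerP => j; rewrite !ffunE.
  - by move=> F; congr addn; apply: eq_bigr => j _; rewrite ffunE.
rewrite negb_forall => /existsP[i]; rewrite -ltnNge => ba.
have [s] := garnir_relation (fun i j => 'X_(enum_rank (i, j)) : {mpoly int[_]}) i a b
  (garnir_columns i a b) (@int_mpoly_torsion_free _).
rewrite {1}/garnir_term odd_perm1 mul1r.
rewrite (eq_column_minor _ (garnir_fst1 i a b)) (eq_column_minor _ (garnir_snd1 i a b)).
move=> DaDb; rewrite {1 2}generic_minor.unlock DaDb => {DaDb} s_lt; rewrite -scaleN1r; apply: minor_spanZ.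
rewrite big_seq; apply: big_ind; [exact: minor_span0|exact: minor_spanD|].
move=> p /s_lt[l il pl]; rewrite /garnir_term -mulrA mulr_sign -scaler_sign.
apply: minor_spanZ.
set A := garnir_fst _ _ _ _; set B := garnir_snd _ _ _ _.
have AB : same_content A B a b by apply: garnir_content.
(* Sorting a row costs a sign, and a repeated column makes the minor vanish. *)
have [/increasing_rearrangement[A' [pA [A'_incr A'E]]]|nA] := pselect (injective A); last first.
  by rewrite (column_minor_noninj _ nA) mul0r; apply: minor_span0.
have [/increasing_rearrangement[B' [pB [B'_incr B'E]]]|nB] := pselect (injective B); last first.
  by rewrite (column_minor_noninj _ nB) mulr0; apply: minor_span0.
have sortD (s1 s2 : 'I_m -> 'I_n) (q : 'S_m) : (forall j, s2 j = s1 (q j)) ->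
    column_minor (fun i j => 'X_(enum_rank (i, j)) : {mpoly int[_]}) s1 = (-1) ^+ q *: D s2.
  move=> s12; rewrite generic_minor.unlock (eq_column_minor _ (s12 : s2 =1 s1 \o q)).
  by rewrite column_minor_perm scaler_sign mulr_sign; case: (odd_perm q); rewrite ?opprK.
rewrite (sortD _ _ _ A'E) (sortD _ _ _ B'E) -scalerAl -scalerAr.
do 2![apply: minor_spanZ].
have A'a : le_plucker A' a.
  apply/le_plucker_count => // x; rewrite (count_le_rearranged _ A'E).
  exact: garnir_fst_count.
have A'ne : ~ A' =1 a.
  move=> eqA; have := garnir_fst_count_lt a_incr b_incr ba il pl.
  rewrite -(count_le_rearranged _ A'E); apply/negP; rewrite -leqNgt.
  by apply: leq_sum => j _; rewrite eqA.
have A'B' : same_content A' B' a b.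
  move=> F; rewrite -AB; congr addn; [rewrite [RHS](reindex_perm pA)|rewrite [RHS](reindex_perm pB)];
    by apply: eq_bigr => j _; rewrite ?A'E ?B'E.
apply: minor_span_weaken (IHk A' B' _ A'_incr B'_incr).
  move=> q [q1 q2 q12 qA' qc]; split=> //; last by move=> F; rewrite qc A'B'.
  by apply/le_pluckerP => j; apply: leq_trans (le_pluckerP _ _ qA' j) (le_pluckerP _ _ A'a j).
exact: leq_trans (sum_val_lt A'a A'ne) ak.
Qed.

End Straightening.

(** * Leading monomials of minors *)

Lemma index_allpairs (S T : eqType) (s : seq S) (t : seq T) x y :
    x \in s -> y \in t ->
  index (x, y) [seq (x1, x2) | x1 <- s, x2 <- t] = (index x s * size t + index y t)%N.
Proof.
move=> + yt; elim: s => //= x' s IHs; rewrite inE index_cat.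
have [-> _|ne /= xs] := eqVneq x x'.
  rewrite map_f // mul0n add0n index_map // => y1 y2 [] //.
rewrite ifF ?size_map ?(IHs xs) ?mulSn ?addnA //.
by apply/negP => /mapP[z _ [exx]]; rewrite exx eqxx in ne.
Qed.

(** The variables x_(i,j) are numbered row by row, so that the lexicographic comparison reads the
    first row first. This makes the order a diagonal one. *)
Lemma enum_rank_pair (S T : finType) (x : S) (y : T) :
  enum_rank (x, y) = (enum_rank x * #|T| + enum_rank y)%N :> nat.
Proof.
have idx (U : finType) (z : U) : enum_rank z = index z (enum U) :> nat.
  by rewrite -[z in RHS]enum_rankK (enum_val_nth z) index_uniq ?enum_uniq -?cardE ?ltn_ord.
by rewrite !idx [X in index _ X]enumT unlock index_allpairs ?mem_enum // -cardE.
Qed.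

Lemma exists_maximum d (T : eqType) (O : orderType d) (r : seq T) (f : T -> O) x0 :
  x0 \in r -> exists2 x, x \in r & forall y, y \in r -> (f y <= f x)%O.
Proof.
elim: r x0 => // a r IHr x0 _; case: r IHr => [_|b r IHr].
  by exists a; rewrite ?mem_head // => y; rewrite inE => /eqP ->.
have [x xr xmax] := IHr b (mem_head _ _).
have [fax|fxa] := leP (f a) (f x).
  by exists x => [|y]; rewrite inE ?xr ?orbT // => /orP[/eqP -> //|/xmax].
exists a; rewrite ?mem_head // => y; rewrite inE => /orP[/eqP -> //|/xmax fyx].
exact: le_trans fyx (ltW fxa).
Qed.

Lemma is_lead_mlead (R : nzRingType) N (f : {mpoly R[N]}) mu :
  is_lead (fun x y => x <= y)%O f mu -> mlead f = mu.
Proof.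
move=> [muf mumax]; apply/le_anti; rewrite (msupp_le_mlead muf) andbT.
apply/mumax/mlead_supp; apply/eqP => f0; by rewrite f0 msupp0 in muf.
Qed.

(** * Families of polynomials with distinct leading monomials *)

Section TriangularFamily.
Variables (K : idomainType) (N : nat) (T : eqType) (r : seq T).
Variables (c : T -> K) (F : T -> {mpoly K[N]}).
Hypothesis r_uniq : uniq r.
Hypothesis F_neq0 : forall x, x \in r -> c x != 0 -> F x != 0.
Hypothesis F_inj : forall x y, x \in r -> y \in r -> c x != 0 -> c y != 0 ->
  mlead (F x) = mlead (F y) -> x = y.

Let Q := \sum_(x <- r) c x *: F x.

(** The largest leading monomial that occurs with a nonzero coefficient belongs to a single member
    of the family, so it cannot cancel. *)
Lemma triangular_lead x0 : x0 \in r -> c x0 != 0 ->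
  exists x, [/\ x \in r, c x != 0, mlead Q = mlead (F x),
     Q@_(mlead Q) = c x * (F x)@_(mlead (F x))
   & forall y, y \in r -> c y != 0 -> (mlead (F y) <= mlead Q)%O].
Proof.
move=> x0r cx0; have x0r' : x0 \in [seq x <- r | c x != 0] by rewrite mem_filter cx0.
have [x] := exists_maximum (fun x => mlead (F x)) x0r'.
rewrite mem_filter => /andP[cx xr] xmax.
have Qx : Q@_(mlead (F x)) = c x * (F x)@_(mlead (F x)).
  rewrite /Q raddf_sum (bigD1_seq x) //= mcoeffZ big_seq_cond big1 ?addr0 // => y /andP[yr yx].
  rewrite mcoeffZ; have [->|cy] := eqVneq (c y) 0; first by rewrite mul0r.
  rewrite (memN_msupp_eq0 (p := F y)) ?mulr0 //; apply/negP => /msupp_le_mlead lexy.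
  have leyx : (mlead (F y) <= mlead (F x))%O by apply: xmax; rewrite mem_filter cy.
  by move/eqP: yx; apply; apply: F_inj => //; apply/le_anti; rewrite leyx.
have Qlead : mlead Q = mlead (F x).
  apply/is_lead_mlead; split; first by rewrite mcoeff_msupp Qx mulf_neq0 // mleadc_eq0 F_neq0.
  move=> nu; rewrite mcoeff_msupp /Q raddf_sum => nuQ.
  have [y yr] : exists2 y, y \in r & (c y *: F y)@_nu != 0.
    apply/hasP; apply: contraNT nuQ; rewrite -all_predC => /allP r0.
    by rewrite big_seq big1 // => y /r0 /= /negPn/eqP.
  rewrite mcoeffZ mulf_eq0 negb_or => /andP[cy]; rewrite -mcoeff_msupp => /msupp_le_mlead.
  by move/le_trans; apply; apply: xmax; rewrite mem_filter cy.
exists x; split=> //; first by rewrite Qlead Qx.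
by move=> y yr cy; rewrite Qlead; apply: xmax; rewrite mem_filter cy.
Qed.

Lemma triangular_free : Q = 0 -> forall x, x \in r -> c x = 0.
Proof.
move=> Q0 x xr; apply/eqP/negPn/negP => cx.
have [y [yr cy _ Qy _]] := triangular_lead xr cx.
move: Qy; rewrite Q0 mcoeff0 => /esym/eqP; rewrite mulf_eq0 (negbTE cy) mleadc_eq0 /=.
by apply/negP/F_neq0.
Qed.

End TriangularFamily.

Section Diagonal.
Variables (m n : nat).
Local Notation NX := #|{: 'I_m * 'I_n}|.
Implicit Types (s t : 'I_m -> 'I_n).

Definition diag_mnm s : 'X_{1..NX} := (\sum_i U_(enum_rank (i, s i)))%MM.

Lemma mnm1_pair (i i' : 'I_m) (j j' : 'I_n) :
  (U_(enum_rank (i, j))%MM : 'X_{1..NX}) (enum_rank (i', j')) = (i == i') && (j == j') :> nat.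
Proof. by rewrite mnm1E (inj_eq enum_rank_inj) xpair_eqE. Qed.

Lemma diag_mnmE s i j : diag_mnm s (enum_rank (i, j)) = (s i == j) :> nat.
Proof.
rewrite mnm_sumE (bigD1 i) //= mnm1_pair eqxx /= big1 ?addn0 // => i' /negbTE ii'.
by rewrite mnm1_pair ii'.
Qed.

Lemma mdeg_diag_mnm s : mdeg (diag_mnm s) = m.
Proof.
rewrite mdeg_sum (eq_bigr (fun=> 1%N)) => [|i _]; last by rewrite mdeg1.
by rewrite sum1_card card_ord.
Qed.

Lemma mnm_pairP (mu nu : 'X_{1..NX}) :
  (forall i j, mu (enum_rank (i, j)) = nu (enum_rank (i, j))) -> mu = nu.
Proof. by move=> H; apply/mnmP => k; rewrite -[k]enum_valK; case: (enum_val k). Qed.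

Lemma lt_mnm_pair (mu nu : 'X_{1..NX}) (i : 'I_m) (j : 'I_n) : mdeg mu = mdeg nu ->
    (forall (i' : 'I_m) (j' : 'I_n), (i' < i)%N || (i' == i) && (j' < j)%N ->
       mu (enum_rank (i', j')) = nu (enum_rank (i', j'))) ->
    (mu (enum_rank (i, j)) < nu (enum_rank (i, j)))%N ->
  (mu < nu)%O.
Proof.
move=> deg eq_before lt_at; apply/ltmcP => //; exists (enum_rank (i, j)) => // k.
rewrite -[k]enum_valK; case: (enum_val k) => i' j'; rewrite !enum_rank_pair.
rewrite !enum_rank_ord /= card_ord => lt_rank; apply: eq_before.
have j'n := ltn_ord j'; have jn := ltn_ord j; rewrite -val_eqE /=; nia.
Qed.

Lemma lt_diag_mnm s t (i : 'I_m) : (forall i' : 'I_m, (i' < i)%N -> s i' = t i') ->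
  (s i < t i)%N -> (diag_mnm t < diag_mnm s)%O.
Proof.
move=> st lt_st; apply: (@lt_mnm_pair _ _ i (s i)); rewrite ?mdeg_diag_mnm //; last first.
  by rewrite !diag_mnmE eqxx -val_eqE /= gtn_eqF.
move=> i' j' /orP[/st eq_st|/andP[/eqP -> lt_j']]; rewrite !diag_mnmE ?eq_st //.
by rewrite -!val_eqE /= !gtn_eqF // (ltn_trans lt_j').
Qed.

(** Row [i] of the product records the two-element multiset of s_i and t_i, and the Plücker order
    tells which of the two is s_i. *)
Lemma diag_mnm_pair_inj s t s' t' :
    le_plucker s t -> le_plucker s' t' ->
    (diag_mnm s + diag_mnm t = diag_mnm s' + diag_mnm t')%MM ->
  s =1 s' /\ t =1 t'.
Proof.
move=> /le_pluckerP st /le_pluckerP st' eqd.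
have eqij i j : ((s i == j) + (t i == j) = (s' i == j) + (t' i == j))%N.
  by have := congr1 (fun mu : 'X_{1.._} => mu (enum_rank (i, j))) eqd; rewrite !mnmDE !diag_mnmE.
suff H i : s i = s' i /\ t i = t' i by split=> i; case: (H i).
have Es := eqij i (s i); have Et := eqij i (t i); have Es' := eqij i (s' i).
have lt := st i; have lt' := st' i; rewrite leq_eqVlt in lt; rewrite leq_eqVlt in lt'.
have [lt_ss'|lt_ss'|/val_inj ss'] := ltngtP (s i) (s' i).
- move: Es; rewrite eqxx -!val_eqE /= [(s' i == _ :> nat)]gtn_eqF // [(t' i == _ :> nat)]gtn_eqF //.
  by case/orP: lt' => [/eqP <- //|]; apply: ltn_trans lt_ss'.
- move: Es'; rewrite eqxx -!val_eqE /= [(s i == _ :> nat)]gtn_eqF // [(t i == _ :> nat)]gtn_eqF //.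
  by case/orP: lt => [/eqP <- //|]; apply: ltn_trans lt_ss'.
by move: Et; rewrite eqxx ss' => /addnI/esym/eqP; rewrite eqb1 => /eqP ->.
Qed.

End Diagonal.

Section MinorLead.
Variables (R : comNzRingType) (m n : nat).
Implicit Types (s t : 'I_m -> 'I_n).

Lemma eq_generic_minor s t : s =1 t -> generic_minor R s = generic_minor R t.
Proof. by rewrite generic_minor.unlock; apply: eq_column_minor. Qed.

Lemma generic_minorE s : generic_minor R s =
  \sum_(p : 'S_m) (-1) ^+ p *: 'X_[diag_mnm (s \o p)].
Proof.
rewrite generic_minor.unlock column_minorE (reindex_inj invg_inj); apply: eq_bigr => p _.
rewrite odd_permV mulr_sign scaler_sign; congr (if _ then - _ else _).
all: rewrite mprodXE; congr 'X_[_]; rewrite [LHS](reindex_perm p); apply: eq_bigr => i _.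
all: by rewrite permK.
Qed.

(** At the least [i] moved by [p] one has p(i) > i, as smaller values are already taken. Row [i]
    then uses a later column, and the rows before it agree. *)
Lemma lt_diag_mnm_perm s (p : 'S_m) : increasing s -> p != 1%g ->
  (diag_mnm (s \o p) < diag_mnm s)%O.
Proof.
move=> /increasingP s_incr p1.
have [i0 pi0] : exists i, p i != i.
  apply/existsP; apply: contraNT p1 => /existsPn p1; apply/eqP/permP => i.
  by rewrite perm1; apply/eqP/negPn/p1.
have [i pi imin] := @arg_minnP _ i0 (fun i => p i != i) (fun i => val i) pi0.
have fixed (i' : 'I_m) : (i' < i)%N -> p i' = i'.
  by move=> i'i; apply/eqP/negPn/negP => /imin; rewrite /= leqNgt i'i.
apply: (@lt_diag_mnm _ _ _ _ i) => [i' /fixed /= -> //|/=]; apply: s_incr.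
case: (ltngtP i (p i)) => // [/fixed/perm_inj pii|/val_inj pii].
  by rewrite pii eqxx in pi.
by rewrite -pii eqxx in pi.
Qed.

Lemma generic_minor_lead s : increasing s ->
  is_lead (fun x y => x <= y)%O (generic_minor R s) (diag_mnm s) /\
  (generic_minor R s)@_(diag_mnm s) = 1.
Proof.
move=> s_incr; have eq1 : diag_mnm (s \o (1%g : 'S_m)) = diag_mnm s.
  by apply: eq_bigr => i _; rewrite /= perm1.
have coef1 : (generic_minor R s)@_(diag_mnm s) = 1.
  rewrite generic_minorE raddf_sum (bigD1 1%g) //= odd_perm1 scale1r mcoeffX eq1 eqxx.
  rewrite big1 ?addr0 // => p /(lt_diag_mnm_perm s_incr) lt_p.
  by rewrite mcoeffZ mcoeffX lt_eqF // mulr0.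
split=> //; split; first by rewrite mcoeff_msupp coef1 oner_eq0.
move=> nu; rewrite generic_minorE => /msupp_sum_le /flattenP[_ /mapP[p _ ->]].
move=> /msuppZ_le/mem_msuppXP <-; have [->|/(lt_diag_mnm_perm s_incr)/ltW //] := eqVneq p 1%g.
by rewrite eq1.
Qed.

Lemma mlead_generic_minor s : increasing s -> mlead (generic_minor R s) = diag_mnm s.
Proof. by case/generic_minor_lead => /is_lead_mlead. Qed.

Lemma mleadc_generic_minor s : increasing s ->
  (generic_minor R s)@_(mlead (generic_minor R s)) = 1.
Proof. by move=> s_incr; rewrite mlead_generic_minor //; case: (generic_minor_lead s_incr). Qed.

Lemma generic_minor_neq0 s : increasing s -> generic_minor R s != 0.
Proof. by move=> s_incr; rewrite -mleadc_eq0 mleadc_generic_minor // oner_eq0. Qed.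

End MinorLead.

Lemma map_generic_minor (R S : comNzRingType) (f : {rmorphism R -> S}) m n
    (s : 'I_m -> 'I_n) : map_mpoly f (generic_minor R s) = generic_minor S s.
Proof.
rewrite generic_minor.unlock /column_minor -det_map_mx; congr (\det _); apply/matrixP => i j.
by rewrite !mxE; apply: map_mpolyX.
Qed.

Lemma mlead_monicM (K : idomainType) N (p q : {mpoly K[N]}) :
    p@_(mlead p) = 1 -> q@_(mlead q) = 1 ->
  [/\ p * q != 0, mlead (p * q) = (mlead p + mlead q)%MM
    & (p * q)@_(mlead (p * q)) = 1].
Proof.
move=> p1 q1; have [p0 q0] : p != 0 /\ q != 0 by rewrite -!mleadc_eq0 p1 q1 oner_eq0.
by rewrite mulf_neq0 // mleadM // mleadcM p1 q1 mulr1.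
Qed.

Lemma map_minor_relation (R S : comNzRingType) (f : {rmorphism R -> S}) m n
    (a b : 'I_m -> 'I_n) (T : finType) (lam : T -> R) (c d : T -> 'I_m -> 'I_n) :
    generic_minor R a * generic_minor R b =
      \sum_p lam p *: (generic_minor R (c p) * generic_minor R (d p)) ->
  generic_minor S a * generic_minor S b =
    \sum_p f (lam p) *: (generic_minor S (c p) * generic_minor S (d p)).
Proof.
move=> /(congr1 (map_mpoly f)); rewrite rmorphM /= !map_generic_minor => ->.
rewrite raddf_sum; apply: eq_bigr => p _.
by rewrite [LHS]map_mpolyZ rmorphM /= !map_generic_minor.
Qed.

(** * Straightening over a field *)

Section StraighteningField.
Variables (K : fieldType) (m n : nat) (a b : 'I_m -> 'I_n).
Hypotheses (a_incr : increasing a) (b_incr : increasing b).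
Local Notation row := {ffun 'I_m -> 'I_n}.
Local Notation D := (@generic_minor K m n).

(** Obtained from the integers by base change: over a field of positive characteristic the factor
    #|H| of the Garnir sum could vanish. *)
Lemma straightening_field : exists lam : row * row -> int,
  D a * D b = \sum_p (lam p)%:~R *: (D p.1 * D p.2) /\
  forall p, (lam p)%:~R != 0 :> K -> straight_pair a b p.
Proof.
have [lam [lamE lamP]] := straightening a_incr b_incr; exists lam; split; last first.
  by move=> p lam0; apply: lamP; apply: contraNneq lam0 => ->.
exact: (map_minor_relation (intmul (1 : K)) lamE).
Qed.

Lemma pair_lead (p : row * row) : increasing p.1 -> increasing p.2 ->
  [/\ D p.1 * D p.2 != 0, mlead (D p.1 * D p.2) = (diag_mnm p.1 + diag_mnm p.2)%MM
    & (D p.1 * D p.2)@_(mlead (D p.1 * D p.2)) = 1].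
Proof.
move=> p1 p2; have := mlead_monicM (mleadc_generic_minor K p1) (mleadc_generic_minor K p2).
by rewrite !mlead_generic_minor.
Qed.

Lemma straight_pair_inj a' b' a'' b'' (p q : row * row) :
    straight_pair a' b' p -> straight_pair a'' b'' q ->
  mlead (D p.1 * D p.2) = mlead (D q.1 * D q.2) -> p = q.
Proof.
case=> p1 p2 p12 _ _ [q1 q2 q12 _ _].
have [_ -> _] := pair_lead p1 p2; have [_ -> _] := pair_lead q1 q2.
case/diag_mnm_pair_inj => // e1 e2; case: p q e1 e2 {p1 p2 q1 q2 p12 q12} => p1 p2 [q1 q2] /=.
by move=> /ffunP -> /ffunP ->.
Qed.

End StraighteningField.

Section PluckerRelation.
Variables (K : fieldType) (m n : nat) (a b : 'I_m -> 'I_n).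
Hypotheses (a_incr : increasing a) (b_incr : increasing b).
Local Notation row := {ffun 'I_m -> 'I_n}.
Local Notation D := (@generic_minor K m n).

Definition row_min : row := [ffun j => if (a j <= b j)%N then a j else b j].
Definition row_max : row := [ffun j => if (a j <= b j)%N then b j else a j].

(* Straightening b a instead of a b bounds the first factor by b; as standard  *)
(* products are linearly independent, both bounds hold at once.                *)
Lemma plucker_relation : exists lam : row * row -> int,
  [/\ D a * D b = \sum_p (lam p)%:~R *: (D p.1 * D p.2),
      forall p, lam p != 0 ->
        [/\ straight_pair a b p, le_plucker p.1 b
          & ((diag_mnm p.1 + diag_mnm p.2)%MM <= (diag_mnm a + diag_mnm b)%MM)%O]
    & (lam (row_min, row_max))%:~R = 1 :> K].
Proof.
have [lam [lamE lamP]] := straightening_field K a_incr b_incr.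
have [mu [muE muP]] := straightening_field K b_incr a_incr.
have pair_uniq : uniq (index_enum {: row * row}) by apply: index_enum_uniq.
have lam_mu p : (lam p)%:~R = (mu p)%:~R :> K.
  apply/eqP; rewrite -subr_eq0; apply/eqP.
  pose F (q : row * row) := D q.1 * D q.2.
  apply: (triangular_free (c := fun q => (lam q)%:~R - (mu q)%:~R) (F := F) pair_uniq);
    last exact: mem_index_enum.
  - move=> q _; have [lam0|/lamP[q1 q2 _ _ _] _] := eqVneq ((lam q)%:~R : K) 0; last first.
      by case: (pair_lead K q1 q2).
    by rewrite lam0 sub0r oppr_eq0 => /muP[q1 q2 _ _ _]; case: (pair_lead K q1 q2).
  - have straight q : (lam q)%:~R - (mu q)%:~R != 0 :> K ->
        exists a' b', straight_pair (m:=m) (n:=n) a' b' q.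
      have [->|/lamP] := eqVneq ((lam q)%:~R : K) 0; last by exists a, b.
      by rewrite sub0r oppr_eq0 => /muP; exists b, a.
    by move=> x y _ _ /straight[? [? xP]] /straight[? [? yP]]; apply: straight_pair_inj xP yP.
  - under eq_bigr do rewrite scalerBl.
    by rewrite sumrB -lamE mulrC -muE subrr.
(* Integers that vanish in [K] are replaced by 0, so that every nonzero [lam' p] belongs to a
   straight pair. *)
pose lam' p := if (lam p)%:~R == 0 :> K then 0 else lam p.
have lam'E p : (lam' p)%:~R = (lam p)%:~R :> K by rewrite /lam'; have [->|] := eqVneq ((lam p)%:~R : K) 0.
have lam'0 p : lam' p != 0 -> (lam p)%:~R != 0 :> K.
  by rewrite /lam'; have [_|//] := eqVneq ((lam p)%:~R : K) 0; rewrite eqxx.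
have lead_ab : mlead (D a * D b) = (diag_mnm a + diag_mnm b)%MM.
  by rewrite mleadM ?generic_minor_neq0 // !mlead_generic_minor.
have leadc_ab : (D a * D b)@_(mlead (D a * D b)) = 1.
  by rewrite lead_ab -!(mlead_generic_minor K) // mleadcM !mleadc_generic_minor // mulr1.
have min_max : (diag_mnm row_min + diag_mnm row_max = diag_mnm a + diag_mnm b)%MM.
  apply: mnm_pairP => i j; rewrite !mnmDE !diag_mnmE !ffunE.
  by case: ifP => // _; rewrite addnC.
have [p0 lamp0] : exists p, (lam p)%:~R != 0 :> K.
  apply/existsP; apply: contraT => /existsPn lam0.
  have /eqP := lamE; rewrite big1 => [|p _]; last by rewrite (eqP (negPn (lam0 p))) scale0r.
  by rewrite mulf_eq0 !(negbTE (generic_minor_neq0 _ _)).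
pose F (q : row * row) := D q.1 * D q.2.
(* The largest initial monomial of the expansion is that of [a][b], which is also that of the
   min-max product. Hence this product occurs, with coefficient 1, and all others are bounded by the
   initial monomial of [a][b]. *)
have [||p [_ lamp leadp leadcp ltp]] :=
  triangular_lead (c := fun q => (lam q)%:~R) (F := F) pair_uniq _ _ (mem_index_enum p0) lamp0.
- by move=> q _ /lamP[q1 q2 _ _ _]; case: (pair_lead K q1 q2).
- by move=> x y _ _ /lamP xP /lamP yP; apply: straight_pair_inj xP yP.
rewrite -lamE in leadp leadcp ltp.
exists lam'; split.
- by under eq_bigr do rewrite lam'E.
- move=> q /lam'0 lamq; have qP := lamP _ lamq; have [q1 q2 _ _ _] := qP; split=> //.
    by rewrite lam_mu in lamq; case: (muP _ lamq).
  have [_ <- _] := pair_lead K q1 q2; rewrite -lead_ab; apply: ltp lamq; exact: mem_index_enum.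
rewrite lam'E; have [p1 p2 p12 _ _] := lamP _ lamp.
have [_ Fp Fp1] := pair_lead K p1 p2.
move: leadcp; rewrite leadc_ab /F Fp1 mulr1 => {}leadcp; rewrite [RHS]leadcp; congr ((lam _)%:~R); symmetry.
move: leadp; rewrite lead_ab /F Fp -min_max => /diag_mnm_pair_inj[||e1 e2] //.
  by apply/le_pluckerP => j; rewrite !ffunE; case: (leqP (a j) (b j)) => // /ltnW.
by case: p p1 p2 p12 e1 e2 {lamp leadcp Fp Fp1} => p1 p2 _ _ _ /= /ffunP -> /ffunP ->.
Qed.

End PluckerRelation.

(** * Facets and normal forms *)

Section Facets.
Variables (m n : nat) (Delta : {set {set 'I_n}}).
Local Notation F := (facet m Delta).
Implicit Types (a b : F).

Lemma elt_increasing a : increasing (elt a).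
Proof. by apply/increasingP => i j ij; apply: enum_val_increasing. Qed.

Lemma mem_facet a k : k \in val a -> exists j, elt a j = k.
Proof.
move=> ka; exists (cast_ord (card_facet a) (enum_rank_in ka k)).
by rewrite /elt cast_ordK enum_rankK_in.
Qed.

Lemma elt_mem a j : elt a j \in val a.
Proof. exact: enum_valP. Qed.

Lemma facet_set a : val a = [set elt a j | j : 'I_m].
Proof.
apply/setP => k; apply/idP/imsetP => [/mem_facet[j <-]|[j _ ->]]; last exact: elt_mem.
by exists j.
Qed.

Lemma facet_sum (f : 'I_n -> nat) a : (\sum_j f (elt a j) = \sum_(k in val a) f k)%N.
Proof.
rewrite facet_set big_imset /=; first by apply: eq_bigl => j; rewrite inE.
by move=> i j _ _ /(increasing_inj (elt_increasing a)).
Qed.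

Lemma increasing_image_inj (s t : 'I_m -> 'I_n) : increasing s -> increasing t ->
  [set s j | j : 'I_m] = [set t j | j : 'I_m] -> s =1 t.
Proof.
move=> s_incr t_incr st.
have count_image (f : 'I_m -> 'I_n) x : increasing f ->
    count_le f x = (\sum_(k in [set f j | j : 'I_m]) (k <= x)%N)%N.
  move=> f_incr; rewrite big_imset /=; first by apply: eq_bigl => j; rewrite inE.
  by move=> i j _ _ /(increasing_inj f_incr).
by apply: le_plucker_anti; apply/le_plucker_count => // x; rewrite !count_image // st.
Qed.

Lemma elt_inj a b : elt a =1 elt b -> a = b.
Proof.
move=> ab; apply/val_inj; rewrite /= facet_set [RHS]facet_set.
by apply: eq_imset.
Qed.

Lemma facet_of_increasing (s : 'I_m -> 'I_n) : increasing s ->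
  [set s j | j : 'I_m] \in Delta ->
  exists2 a : F, elt a =1 s & val a = [set s j | j : 'I_m].
Proof.
move=> s_incr sD; have cs : #|[set s j | j : 'I_m]| == m.
  by rewrite card_imset ?card_ord //; apply: increasing_inj.
have sP : ([set s j | j : 'I_m] \in Delta) && (#|[set s j | j : 'I_m]| == m) by rewrite sD.
exists (exist (fun x => (x \in Delta) && (#|x| == m)) _ sP) => //; apply: increasing_image_inj => //; first exact: elt_increasing.
by rewrite -facet_set.
Qed.

Lemma facet_subset_interval (u v : 'I_n) a :
  reflect (forall j, (u <= elt a j)%N && (elt a j <= v)%N) (val a \subset Defs.interval u v).
Proof.
apply: (iffP fintype.subsetP) => [sub j|sub k /mem_facet[j <-]].
  by have := sub _ (elt_mem a j); rewrite inE.
by rewrite inE.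
Qed.

(** A facet is itself a clique, its only [m]-subset being the facet. *)
Lemma facet_sub_clique a : exists2 W, maximal_clique m Delta W & val a \subset W.
Proof.
have cl : clique m Delta (val a).
  rewrite /clique card_facet leqnn; apply/forallP => s; apply/implyP => /andP[sa /eqP cs].
  have -> : s = val a by apply/eqP; rewrite eqEcard sa cs card_facet /=.
  by case/andP: (valP a).
by have [W Wmax aW] := maxset_exists cl; exists W.
Qed.

Lemma clique_facet W (s : 'I_m -> 'I_n) : maximal_clique m Delta W -> increasing s ->
  (forall j, s j \in W) -> exists2 a : F, elt a =1 s & val a = [set s j | j : 'I_m].
Proof.
move=> /maxsetp/andP[_ /forallP Wcl] s_incr sW; apply: facet_of_increasing => //.
have /implyP := Wcl [set s j | j : 'I_m]; apply; apply/andP; split.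
  by apply/fintype.subsetP => k /imsetP[j _ ->].
by rewrite card_imset ?card_ord //; apply: increasing_inj.
Qed.

End Facets.

(** * Normal forms are determined by their images *)

Section NormalForms.
Variables (m n : nat) (Delta : {set {set 'I_n}}) (r : nat) (u v : 'I_r.+1 -> 'I_n).
Hypotheses (hunit : unit_interval m Delta u v).
Local Notation F := (facet m Delta).
Implicit Types (a b : F) (al be : 'I_m -> 'I_n -> nat) (ta up : F -> nat).

Lemma clique_convex W (x y z : 'I_n) : maximal_clique m Delta W ->
  x \in W -> z \in W -> (x <= y <= z)%N -> y \in W.
Proof.
move=> /(ui_cliques hunit)[i ->]; rewrite !inE => /andP[ux _] /andP[_ zv] /andP[xy yz].
by rewrite (leq_trans ux xy) (leq_trans yz zv).
Qed.

(** [al] holds the exponents of the x_(i,k) of a monomial that T_a divides. The condition says that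
    it is divisible by no leading monomial x_(i,k) T_a of (B). *)
Definition no_linear_exchange al a := forall i k W, maximal_clique m Delta W ->
  k \in W -> val a \subset W -> (k < elt a i)%N ->
  (forall i' : 'I_m, (i' < i)%N -> (elt a i' < k)%N) -> al i k = 0%N.

(** The same for the leading monomials of (A), the product of all x_(i,b_i) with T_a. *)
Definition no_minor_exchange al a := forall b, in_distinct_cliques b a ->
  (forall i, (elt b i < elt a i)%N) -> ~ (forall i, (0 < al i (elt b i))%N).

(** A first difference with b_p < a_p would produce a leading monomial of (B) or (A). If p > 0, then
    b_p lies between a_(p-1) and a_p, hence in a clique of [a], and (B) applies. If p = 0, then (B)
    excludes a common clique of b_0 and [a]; this forces b_i < a_i for all i, and (A) applies. *)
Lemma no_first_difference al a b (p : 'I_m) :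
    (forall i, (elt b i < elt a i)%N -> (0 < al i (elt b i))%N) ->
    no_linear_exchange al a -> no_minor_exchange al a ->
    (forall i : 'I_m, (i < p)%N -> elt a i = elt b i) ->
  ~ (elt b p < elt a p)%N.
Proof.
move=> al_pos lin min eq_before lt_p.
have a_incr := elt_increasing a; have b_incr := elt_increasing b.
(* A column b_i strictly between two consecutive columns of [a] is in a clique of [a], by
   convexity. *)
have step (i' i : 'I_m) : i'.+1 = i :> nat -> (elt a i' < elt b i)%N -> ~ (elt b i < elt a i)%N.
  move=> ii' lt1 lt2; have [W Wmax aW] := facet_sub_clique a.
  have := al_pos _ lt2; rewrite (lin i (elt b i) W) //.
    apply: (clique_convex Wmax (fintype.subsetP aW _ (elt_mem a i')) (fintype.subsetP aW _ (elt_mem a i))).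
    by apply/andP; split; apply: ltnW.
  by move=> i''; rewrite -ii' ltnS => /(increasing_le a_incr)/leq_ltn_trans; apply.
have p0 : p = 0 :> nat.
  case p1: (val p) => [//|q]; have qm : (q < m)%N by have := ltn_ord p; rewrite /= in p1; lia.
  case: (step (Ordinal qm) p) => //; rewrite eq_before; last by rewrite /= in p1 *; lia.
  by apply: (increasingP _ b_incr); rewrite /= in p1 *; lia.
have no_common W : maximal_clique m Delta W -> elt b p \in W -> ~ (val a \subset W).
  move=> Wmax bW aW; have := al_pos _ lt_p.
  by rewrite (lin p (elt b p) W) // => i'; rewrite p0.
have all_lt i : (elt b i < elt a i)%N.
  rewrite ltnNge; apply/negP => le_i.
  (* Let q be the last index with a_q at most b_q. If q+1 < m, then b_(q+1) lies between a_q and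
     a_(q+1), against [step]. Otherwise [a] lies between the first and the last column of [b], hence
     in a clique of [b], against [no_common]. *)
  have [q /= le_q qmax] := @arg_maxnP _ i (fun i => (elt a i <= elt b i)%N) (fun i => val i) le_i.
  have [qm|qm] := ltnP q.+1 m.
    apply: (step q (Ordinal qm)) => //.
      by apply: leq_ltn_trans le_q _; apply: (increasingP _ b_incr).
    by rewrite ltnNge; apply/negP => /qmax /=; rewrite ltnn.
  have [W Wmax bW] := facet_sub_clique b.
  apply: (no_common W) => //; first exact: (fintype.subsetP bW _ (elt_mem b p)).
  apply/fintype.subsetP => k /mem_facet[j <-].
  apply: (clique_convex Wmax (fintype.subsetP bW _ (elt_mem b p)) (fintype.subsetP bW _ (elt_mem b q))).
  rewrite (leq_trans (ltnW lt_p)) ?increasing_le ?p0 //=.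
  by apply: leq_trans le_q; apply: increasing_le => //; have := ltn_ord j; lia.
apply: (min b _ all_lt) => [|i]; last exact: al_pos.
have [Wa Wamax aWa] := facet_sub_clique a; have [Wb Wbmax bWb] := facet_sub_clique b.
apply/existsP; exists Wb; apply/existsP; exists Wa; rewrite Wamax Wbmax aWa bWb !andbT /=.
apply/eqP => eW; apply: (no_common Wa) => //; rewrite -eW.
exact: (fintype.subsetP bWb _ (elt_mem b p)).
Qed.

Record normal_form al ta : Prop := NormalForm {
  normal_chain : forall a b, (0 < ta a)%N -> (0 < ta b)%N ->
    le_plucker (elt a) (elt b) || le_plucker (elt b) (elt a);
  normal_linear : forall a, (0 < ta a)%N -> no_linear_exchange al a;
  normal_minor : forall a, (0 < ta a)%N -> no_minor_exchange al a }.

Lemma normal_sub al ta ta' : (forall a, (0 < ta' a)%N -> (0 < ta a)%N) ->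
  normal_form al ta -> normal_form al ta'.
Proof.
move=> sub [chain lin min]; split=> [a b /sub + /sub|a /sub|a /sub];
  [exact: chain|exact: lin|exact: min].
Qed.

(** In a chain, a facet of least sum is the minimum. *)
Lemma chain_minimum al ta : normal_form al ta -> (0 < \sum_a ta a)%N ->
  exists2 a, (0 < ta a)%N & forall b, (0 < ta b)%N -> le_plucker (elt a) (elt b).
Proof.
move=> nrm; rewrite lt0n sum_nat_eq0 negb_forall => /existsP[a0 /=]; rewrite -lt0n => ta0.
have [a ta_a amin] := @arg_minnP _ a0 (fun a => (0 < ta a)%N) (fun a => sum_val (elt a)) ta0.
exists a => // b tb; have /orP[//|ba] := normal_chain nrm ta_a tb.
have [/(_ =P _) <-|/eqP nba] := boolP (b == a); first by apply/le_pluckerP.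
have := amin _ tb; rewrite leqNgt sum_val_lt //; by move=> /elt_inj.
Qed.

(** Let a and b be the smallest facets of [ta] and [up]. Where b_i < a_i, no facet of [ta] has b_i
    as its i-th entry, so equal images force x_(i,b_i) to divide the first monomial. This is the
    hypothesis of [no_first_difference], which is applied in both directions to get a = b. *)
Lemma normal_unique al be ta up : normal_form al ta -> normal_form be up ->
    (forall i k, al i k + \sum_(a | elt a i == k) ta a =
                 be i k + \sum_(a | elt a i == k) up a)%N ->
    (\sum_a ta a = \sum_a up a)%N ->
  ta =1 up.
Proof.
move: {-1}(\sum_a ta a)%N (erefl (\sum_a ta a)%N) => N.
elim: N => [|N IHN] in ta up * => sta nta nup rows sup.
  have zero (t : F -> nat) x : (\sum_a t a = 0)%N -> t x = 0%N.
    by rewrite (bigD1 x) //= => /eqP; rewrite addn_eq0 => /andP[/eqP].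
  by move=> a; rewrite !zero // -sup.
have [a ta_a amin] : exists2 a, (0 < ta a)%N & forall b, (0 < ta b)%N -> le_plucker (elt a) (elt b).
  by apply: (chain_minimum nta); rewrite sta.
have [b up_b bmin] : exists2 a, (0 < up a)%N & forall b, (0 < up b)%N -> le_plucker (elt a) (elt b).
  by apply: (chain_minimum nup); rewrite -sup.
have exchange (al1 be1 : 'I_m -> 'I_n -> nat) (ta1 up1 : F -> nat) (a1 b1 : F) :
    (0 < up1 b1)%N -> (forall b, (0 < ta1 b)%N -> le_plucker (elt a1) (elt b)) ->
    (forall i k, al1 i k + \sum_(a | elt a i == k) ta1 a =
                 be1 i k + \sum_(a | elt a i == k) up1 a)%N ->
    forall i, (elt b1 i < elt a1 i)%N -> (0 < al1 i (elt b1 i))%N.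
  move=> up_b1 min1 rows1 i lt1; have := rows1 i (elt b1 i).
  rewrite [X in (_ + X)%N]big1 => [|x /eqP ex].
    by rewrite addn0 (bigD1 b1) //= => ->; rewrite addnCA addn_gt0 up_b1.
  apply/eqP; rewrite -leqn0 leqNgt; apply/negP => /min1/le_pluckerP/(_ i).
  by rewrite ex leqNgt lt1.
have eab : a = b.
  apply/elt_inj => i; apply/eqP; apply: contraT => ne_i.
  have [p /= ne_p pmin] := @arg_minnP _ i (fun i => elt a i != elt b i) (fun i => val i) ne_i.
  have eq_before (j : 'I_m) : (j < p)%N -> elt a j = elt b j.
    by move=> jp; apply/eqP; apply: contraTT jp => /pmin; rewrite -leqNgt.
  have [lt_p|lt_p|/val_inj e_p] := ltngtP (elt a p) (elt b p); last by rewrite e_p eqxx in ne_p.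
    exfalso; apply: (@no_first_difference be b a p) lt_p => //.
    - by apply: (exchange be al up ta b a) => // j k; rewrite rows.
    - exact: normal_linear nup _ up_b.
    - exact: normal_minor nup _ up_b.
    - by move=> j /eq_before ->.
  exfalso; apply: (@no_first_difference al a b p) lt_p => //.
  - exact: (exchange al be ta up a b).
  - exact: normal_linear nta _ ta_a.
  - exact: normal_minor nta _ ta_a.
subst b; pose dec (t : F -> nat) x := (t x - (x == a))%N.
have decE (t : F -> nat) x : (0 < t a)%N -> t x = (dec t x + (x == a))%N.
  by move=> t_a; rewrite /dec subnK //; case: eqP => [->|].
have dec_sub (t : F -> nat) x : (0 < dec t x)%N -> (0 < t x)%N.
  by move/leq_trans; apply; apply: leq_subr.
have sum_dec (t : F -> nat) (P : pred F) : (0 < t a)%N ->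
    (\sum_(x | P x) t x = \sum_(x | P x) dec t x + P a)%N.
  move=> t_a; rewrite (eq_bigr _ (fun x _ => decE t x t_a)) big_split /=; congr addn.
  rewrite big_mkcond (bigD1 a) //= eqxx big1 => [|x /negbTE ->]; last by case: ifP.
  by rewrite addn0; case: (P a).
move=> x; rewrite (decE ta x) // (decE up x) //; congr addn; apply: IHN.
- by move: sta; rewrite (sum_dec ta xpredT) //=; lia.
- exact: normal_sub (dec_sub ta) nta.
- exact: normal_sub (dec_sub up) nup.
- by move=> i k; have := rows i k; rewrite (sum_dec ta) // (sum_dec up) //; lia.
by move: sup; rewrite (sum_dec up xpredT) //=; lia.
Qed.

End NormalForms.

(** * Weight orders *)

Section SupportPredicate.
Variables (R : nzRingType) (N : nat) (P : 'X_{1..N} -> Prop).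
Implicit Types (f g : {mpoly R[N]}).

Definition supp_all f := forall mu, mu \in msupp f -> P mu.

Lemma supp_all0 : supp_all 0.
Proof. by move=> mu; rewrite msupp0. Qed.

Lemma supp_allD f g : supp_all f -> supp_all g -> supp_all (f + g).
Proof. by move=> fP gP mu /msuppD_le; rewrite mem_cat => /orP[/fP|/gP]. Qed.

Lemma supp_allN f : supp_all f -> supp_all (- f).
Proof. by move=> fP mu; rewrite (perm_mem (msuppN f)); apply: fP. Qed.

Lemma supp_allB f g : supp_all f -> supp_all g -> supp_all (f - g).
Proof. by move=> fP /supp_allN; apply: supp_allD. Qed.

Lemma supp_allZ c f : supp_all f -> supp_all (c *: f).
Proof. by move=> fP mu /msuppZ_le/fP. Qed.

Lemma supp_allX mu : P mu -> supp_all 'X_[mu].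
Proof. by move=> Pmu nu /mem_msuppXP <-. Qed.

Lemma supp_all_sum (I : Type) (r : seq I) (Q : pred I) (F : I -> {mpoly R[N]}) :
  (forall i, Q i -> supp_all (F i)) -> supp_all (\sum_(i <- r | Q i) F i).
Proof. by move=> FP; apply: big_ind => //; [exact: supp_all0|exact: supp_allD]. Qed.

End SupportPredicate.

(** * Substitution homomorphisms *)

Section Substitution.
Variables (K S : comNzRingType) (V : finType).

(** [rename], [psi], [phi] and [rho_cover] are convertible to instances of this map, which carries
    the ring morphism structure for all of them. *)
Definition subst_var (f : K -> S) (h : V -> S) : polyring K V -> S :=
  mmap f (fun k => h (enum_val k)).

Variables (f : {rmorphism K -> S}) (h : V -> S).

HB.instance Definition _ := GRing.isAdditive.Build (polyring K V) S (subst_var f h)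
  (mmap_is_additive (fun k => h (enum_val k)) f).
HB.instance Definition _ := GRing.isMultiplicative.Build (polyring K V) S (subst_var f h)
  (mmap_is_multiplicative (fun k => h (enum_val k)) f).

Lemma subst_var_var x : subst_var f h (var K x) = h x.
Proof. by rewrite [LHS]mmapX mmap1U enum_rankK. Qed.

Lemma subst_varC c : subst_var f h c%:MP = f c.
Proof. exact: mmapC. Qed.

Lemma subst_varZ c p : subst_var f h (c *: p) = f c * subst_var f h p.
Proof. exact: mmapZ. Qed.

Lemma subst_varX mu : subst_var f h 'X_[mu] = \prod_x h x ^+ mu (enum_rank x).
Proof.
rewrite [LHS]mmapX /mmap1 (reindex enum_rank) /=; last exact: onW_bij _ (@enum_rank_bij _).
by apply: eq_bigr => x _; rewrite enum_rankK.
Qed.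

Lemma subst_var_unique (g : {rmorphism polyring K V -> S}) :
  (forall c, g c%:MP = f c) -> (forall x, g (var K x) = h x) ->
  g =1 subst_var f h.
Proof.
move=> gC gX p; rewrite [p]mpolyE !rmorph_sum; apply: eq_bigr => mu _.
rewrite -mul_mpolyC !rmorphM /= gC subst_varC; congr (_ * _).
rewrite subst_varX mpolyXE_id rmorph_prod (reindex enum_rank) /=; last exact: onW_bij _ (@enum_rank_bij _).
by apply: eq_bigr => x _; rewrite rmorphXn; congr (_ ^+ _); apply: gX.
Qed.

End Substitution.

Section Weights.
Variables (V : finType).
Implicit Types (mu nu : 'X_{1..#|{: V}|}).

Definition mnm_image M (w : V -> 'X_{1..M}) mu : 'X_{1..M} :=
  (\sum_x w x *+ mu (enum_rank x))%MM.

Definition mnm_weight (w : V -> nat) mu : nat := (\sum_x w x * mu (enum_rank x))%N.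

Lemma mnm_imageD M (w : V -> 'X_{1..M}) mu nu :
  mnm_image w (mu + nu)%MM = (mnm_image w mu + mnm_image w nu)%MM.
Proof.
apply/mnmP => k; rewrite mnmDE !mnm_sumE -big_split; apply: eq_bigr => x _ /=.
by rewrite !mulmnE mnmDE mulnDr.
Qed.

Lemma mnm_image0 M (w : V -> 'X_{1..M}) : mnm_image w 0%MM = 0%MM.
Proof. by rewrite /mnm_image big1 // => x _; rewrite mnm0E mulm0n. Qed.

Lemma mnm_imageU M (w : V -> 'X_{1..M}) x : mnm_image w U_(enum_rank x)%MM = w x.
Proof.
rewrite /mnm_image (bigD1 x) //= mnm1E eqxx mulm1n big1 ?addm0 // => y yx.
by rewrite mnm1E (inj_eq enum_rank_inj) eq_sym (negbTE yx) mulm0n.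
Qed.

Lemma mnm_image_sum M (w : V -> 'X_{1..M}) (I : Type) (r : seq I) (Q : pred I) G :
  mnm_image w (\sum_(i <- r | Q i) G i)%MM = (\sum_(i <- r | Q i) mnm_image w (G i))%MM.
Proof. exact: (big_morph _ (mnm_imageD w) (mnm_image0 w)). Qed.

Lemma mnm_weightD w mu nu : mnm_weight w (mu + nu)%MM = (mnm_weight w mu + mnm_weight w nu)%N.
Proof.
by rewrite /mnm_weight -big_split; apply: eq_bigr => x _ /=; rewrite mnmDE mulnDr.
Qed.

Lemma mnm_weight0 w : mnm_weight w 0%MM = 0%N.
Proof. by rewrite /mnm_weight big1 // => x _; rewrite mnm0E muln0. Qed.

Lemma mnm_weightU w x : mnm_weight w U_(enum_rank x)%MM = w x.
Proof.
rewrite /mnm_weight (bigD1 x) //= mnm1E eqxx muln1 big1 ?addn0 // => y yx.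
by rewrite mnm1E (inj_eq enum_rank_inj) eq_sym (negbTE yx) muln0.
Qed.

Lemma mnm_weight_sum w (I : Type) (r : seq I) (Q : pred I) G :
  mnm_weight w (\sum_(i <- r | Q i) G i)%MM = (\sum_(i <- r | Q i) mnm_weight w (G i))%N.
Proof. exact: (big_morph _ (mnm_weightD w) (mnm_weight0 w)). Qed.

Definition weight_order (w : V -> nat) : rel 'X_{1..#|{: V}|} :=
  refined_order (fun mu nu => mu <= nu)%O (mnm_weight w).

Lemma weight_orderP w : monomial_order (weight_order w).
Proof.
apply: (refined_orderP (add := addn)) => [|x y z|mu nu|mu].
- exact: mnm_order.
- exact: (ltn_add2r x y z).
- exact: mnm_weightD.
- by rewrite mnm_weight0.
Qed.

Definition image_order M (wi : V -> 'X_{1..M}) (w : V -> nat) : rel 'X_{1..#|{: V}|} :=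
  refined_order (weight_order w) (mnm_image wi).

Lemma image_orderP M (wi : V -> 'X_{1..M}) w : monomial_order (image_order wi w).
Proof.
apply: (refined_orderP (add := @mnm_add M)) => [|x y z|mu nu|mu].
- exact: weight_orderP.
- by rewrite ltmc_add2l.
- exact: mnm_imageD.
- by rewrite mnm_image0 le0m.
Qed.

Lemma weight_order_lt w mu nu : (mnm_weight w mu < mnm_weight w nu)%N ->
  weight_order w mu nu && (mu != nu).
Proof.
move=> lt; rewrite /weight_order /refined_order ltEnat /= lt /=.
by apply: contraTneq lt => ->; rewrite ltnn.
Qed.

Lemma image_order_lt M (wi : V -> 'X_{1..M}) w mu nu :
    (mnm_image wi mu < mnm_image wi nu)%O ||
    (mnm_image wi mu == mnm_image wi nu) && (mnm_weight w mu < mnm_weight w nu)%N ->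
  image_order wi w mu nu && (mu != nu).
Proof.
rewrite /image_order /refined_order => /orP[lt|/andP[/eqP -> /weight_order_lt/andP[-> ->]]].
  by rewrite lt /=; apply: contraTneq lt => ->; rewrite ltxx.
by rewrite eqxx orbT.
Qed.

End Weights.

(** * Leading terms of the polynomials (A) and (B) *)

Lemma bumpE h i : bump h i = if (i < h)%N then i else i.+1.
Proof. by rewrite /bump; case: leqP. Qed.

Lemma bumpS_le h i : (bump h.+1 i <= bump h i)%N.
Proof. by rewrite !bumpE ltnS; case: ltngtP. Qed.

Lemma bumpS_neq h i : i != h -> bump h.+1 i = bump h i.
Proof. by rewrite !bumpE ltnS; case: ltngtP. Qed.

Section LeadingTerms.
Variables (K : fieldType) (m n : nat) (Delta : {set {set 'I_n}}).
Local Notation F := (facet m Delta).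
Local Notation V := ('I_m * 'I_n + F)%type.
Local Notation NX := #|{: 'I_m * 'I_n}|.
Local Notation NRT := #|{: V}|.

(** The initial monomial of the image of a variable in R[t], with t set to 1. *)
Definition var_image (x : V) : 'X_{1..NX} :=
  match x with inl ij => U_(enum_rank ij)%MM | inr a => diag_mnm (elt a) end.

(* A strictly concave increasing function of the sum of a: for incomparable a  *)
(* and b, it makes T_a T_b larger than any T_e T_g with e < a, b and the same  *)
(* content.                                                                    *)
Definition facet_weight (a : F) : nat :=
  (sum_val (elt a) * (2 * (m * n) - sum_val (elt a)))%N.

Definition var_weight (x : V) : nat :=
  match x with inl _ => 0%N | inr a => facet_weight a end.

Definition le_RT : rel 'X_{1..NRT} := image_order var_image var_weight.

Definition le_T : rel 'X_{1..#|{: F}|} := weight_order facet_weight.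

Definition x_mnm (i : 'I_m) (j : 'I_n) : 'X_{1..NRT} := U_(enum_rank (inl (i, j) : V))%MM.

Definition t_mnm (a : F) : 'X_{1..NRT} := U_(enum_rank (inr a : V))%MM.

Definition perm_mnm (p : 'S_m) (s : 'I_m -> 'I_n) : 'X_{1..NRT} :=
  (\sum_j x_mnm (p j) (s j))%MM.

(** The function x(2L - x) increases for x at most L, and L = mn bounds all sums of facets. *)
Lemma facet_weight_lt (a b : F) : (sum_val (elt a) < sum_val (elt b))%N ->
  (facet_weight a < facet_weight b)%N.
Proof.
rewrite /facet_weight => lt; have := sum_val_max (elt b); move: lt.
move: (sum_val (elt a)) (sum_val (elt b)) (m * n)%N => x y L xy yL.
have [p py] : exists p, y = (x + p)%N by exists (y - x)%N; lia.
have [l lL] : exists l, L = (x + p + l)%N by exists (L - y)%N; lia.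
have p0 : (0 < p)%N by lia.
rewrite py lL.
have -> : (2 * (x + p + l) - x = x + 2 * p + 2 * l)%N by lia.
have -> : (2 * (x + p + l) - (x + p) = x + p + 2 * l)%N by lia.
nia.
Qed.

(** For sums x, x+p, x+q and x+p+q of e, a, b and g, the two sides differ by 2pq. *)
Lemma facet_weight_pair (a b e g : F) :
    (sum_val (elt e) < sum_val (elt a))%N -> (sum_val (elt e) < sum_val (elt b))%N ->
    (sum_val (elt e) + sum_val (elt g) = sum_val (elt a) + sum_val (elt b))%N ->
  (facet_weight e + facet_weight g < facet_weight a + facet_weight b)%N.
Proof.
rewrite /facet_weight => ea eb eq_sum; have := sum_val_max (elt g).
move: ea eb eq_sum.
move: (sum_val (elt e)) (sum_val (elt a)) (sum_val (elt b)) (sum_val (elt g)) (m * n)%N => x y z w L xy xz eq_sum wL.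
have [p py] : exists p, y = (x + p)%N by exists (y - x)%N; lia.
have [q qz] : exists q, z = (x + q)%N by exists (z - x)%N; lia.
have wE : w = (x + p + q)%N by lia.
have [l lL] : exists l, L = (x + p + q + l)%N by exists (L - w)%N; lia.
have p0 : (0 < p)%N by lia.
have q0 : (0 < q)%N by lia.
rewrite py qz wE lL.
have -> : (2 * (x + p + q + l) - x = x + 2 * p + 2 * q + 2 * l)%N by lia.
have -> : (2 * (x + p + q + l) - (x + p + q) = x + p + q + 2 * l)%N by lia.
have -> : (2 * (x + p + q + l) - (x + p) = x + p + 2 * q + 2 * l)%N by lia.
have -> : (2 * (x + p + q + l) - (x + q) = x + 2 * p + q + 2 * l)%N by lia.
nia.
Qed.

Definition of_R_morph : {rmorphism ringR K m n -> ringRT K m Delta} :=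
  subst_var (@mpolyC NRT K) (fun ij => var K (inl ij : V)).

Definition of_T_morph : {rmorphism ringT K m Delta -> ringRT K m Delta} :=
  subst_var (@mpolyC NRT K) (fun a => var K (inr a : V)).

Lemma of_RE : @of_R K m n Delta =1 of_R_morph. Proof. by []. Qed.

Lemma of_TE : @of_T K m n Delta =1 of_T_morph. Proof. by []. Qed.

Lemma of_R_xvar i j : @of_R K m n Delta (xvar K i j) = 'X_[x_mnm i j].
Proof. by rewrite of_RE [LHS]subst_var_var. Qed.

Lemma of_T_var a : @of_T K m n Delta (var K a) = 'X_[t_mnm a].
Proof. by rewrite of_TE [LHS]subst_var_var. Qed.

Lemma Tvar_val (a : F) : Tvar K m Delta (val a) = var K a.
Proof. by rewrite /Tvar valK. Qed.

Lemma of_R_minor (a : F) : @of_R K m n Delta (minor K a) =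
  \sum_(p : 'S_m) (-1) ^+ p *: 'X_[perm_mnm p (elt a)].
Proof.
rewrite of_RE /minor -det_map_mx.
transitivity (column_minor (fun i j => 'X_[x_mnm i j] : {mpoly K[NRT]}) (elt a)).
  by congr (\det _); apply/matrixP => i j; rewrite !mxE -of_R_xvar.
rewrite column_minorE; apply: eq_bigr => p _.
by rewrite mprodXE mulr_sign scaler_sign.
Qed.

Lemma typeA_polyE (a b : F) : typeA_poly K a b =
  \sum_(p : 'S_m) (-1) ^+ p *: 'X_[perm_mnm p (elt a) + t_mnm b] -
  \sum_(p : 'S_m) (-1) ^+ p *: 'X_[perm_mnm p (elt b) + t_mnm a].
Proof.
rewrite /typeA_poly !of_R_minor !Tvar_val !of_T_var !mulr_suml.
by congr (_ - _); apply: eq_bigr => p _; rewrite -scalerAl mpolyXD.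
Qed.

Lemma image_perm_mnm p s : mnm_image var_image (perm_mnm p s) = diag_mnm (s \o (p^-1)%g).
Proof.
rewrite mnm_image_sum [RHS](reindex_perm p); apply: eq_bigr => j _.
by rewrite mnm_imageU /= permK.
Qed.

Lemma weight_perm_mnm p s : mnm_weight var_weight (perm_mnm p s) = 0%N.
Proof. by rewrite mnm_weight_sum big1 // => j _; rewrite mnm_weightU. Qed.

Lemma image_t_mnm a : mnm_image var_image (t_mnm a) = diag_mnm (elt a).
Proof. exact: mnm_imageU. Qed.

Lemma weight_t_mnm a : mnm_weight var_weight (t_mnm a) = facet_weight a.
Proof. exact: mnm_weightU. Qed.

(** The two diagonal terms have the same image, and every other term has a smaller one. The tie goes
    to the term with T_a, since [a] has the larger sum. *)
Lemma typeA_lead (a b : F) : (0 < m)%N -> (forall i, (elt b i < elt a i)%N) ->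
  is_lead le_RT (typeA_poly K b a) (perm_mnm 1%g (elt b) + t_mnm a)%MM.
Proof.
move=> hm lt_ba; rewrite typeA_polyE (bigD1 1%g) //= odd_perm1.
apply: (is_leadP (image_orderP _ _) (oner_neq0 _)); first by rewrite -addrA.
have image1 (c : F) : mnm_image var_image (perm_mnm 1%g (elt c)) = diag_mnm (elt c).
  by rewrite image_perm_mnm invg1; apply: eq_bigr => i _; rewrite /= perm1.
have image_lt (c : F) (p : 'S_m) : p != 1%g ->
    (mnm_image var_image (perm_mnm p (elt c)) < diag_mnm (elt c))%O.
  by move=> p1; rewrite image_perm_mnm lt_diag_mnm_perm ?elt_increasing // invg_eq1.
apply: supp_allB; apply: supp_all_sum => p; [move=> p1|move=> _];
  apply: supp_allZ; apply: supp_allX; apply: image_order_lt; rewrite !mnm_imageD !image_t_mnm image1.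
  by rewrite ltmc_add2l image_lt.
have [->|p1] := eqVneq p 1%g; last by rewrite addmC ltmc_add2r image_lt.
rewrite image1 addmC eqxx !mnm_weightD !weight_perm_mnm !weight_t_mnm facet_weight_lt ?orbT //.
apply: sum_val_lt; first by apply/le_pluckerP => i; rewrite ltnW.
by move=> /(_ (Ordinal hm)) eq_ba; have := lt_ba (Ordinal hm); rewrite eq_ba ltnn.
Qed.

Lemma typeB_facets (c : {set 'I_n}) : c \in clique_complex m Delta -> #|c| = m.+1 ->
  exists (e : 'I_m.+1 -> 'I_n) (f : 'I_m.+1 -> F),
  [/\ increasing e, c = [set e j | j : 'I_m.+1],
      forall j, elt (f j) =1 e \o lift j
    & forall i : 'I_m, typeB_poly K Delta i c =
        \sum_(j < m.+1) (-1) ^+ (i + j) *: 'X_[x_mnm i (e j) + t_mnm (f j)]].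
Proof.
rewrite inE => /existsP[W /andP[Wmax cW]] cm.
pose e j : 'I_n := enum_val (cast_ord (esym cm) j).
have e_incr : increasing e by apply/increasingP => i j ij; apply: enum_val_increasing.
have e_inj := increasing_inj e_incr.
have cE : c = [set e j | j : 'I_m.+1].
  apply/setP => k; apply/idP/imsetP => [kc|[j _ ->]]; last exact: enum_valP.
  by exists (cast_ord cm (enum_rank_in kc k)); rewrite // /e cast_ordK enum_rankK_in.
have lift_incr j : increasing (e \o lift j).
  apply/increasingP => x y xy; apply: (increasingP _ e_incr).
  by rewrite /= ltnNge leq_bump2 -ltnNge.
have facet_of j : exists a : F, elt a =1 e \o lift j.
  have [l|a aE _] := clique_facet Wmax (lift_incr j); last by exists a.
  by apply: (fintype.subsetP cW); apply: enum_valP.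
have [f fE] := choice facet_of; exists e, f; split=> // i.
have fval j : val (f j) = c :\ e j.
  rewrite facet_set; apply/setP => k; rewrite !inE cE; apply/imsetP/andP.
    move=> [l _ ->]; rewrite fE /= (inj_eq e_inj) eq_sym neq_lift; split=> //.
    exact: imset_f.
  move=> [kj /imsetP[l _ kl]]; rewrite kl (inj_eq e_inj) eq_sym in kj.
  by have [l' ll'] := unlift_some kj; exists l' => //; rewrite fE /= -ll'.
rewrite /typeB_poly (reindex (cast_ord (esym cm))) /=; last first.
  by apply: onW_bij; exists (cast_ord cm); [exact: cast_ordKV|exact: cast_ordK].
apply: eq_bigr => j _; rewrite -/(e j) -fval Tvar_val of_T_var of_R_xvar mpolyXD.
by rewrite -mulrA -[in LHS]signr_odd mulr_sign -[in RHS]signr_odd scaler_sign.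
Qed.

(** In c, the union of [a] and k, the column k has position i. The terms that omit e_i and e_(i+1)
    have the same image, all other terms have a smaller one, and omitting the smaller column e_i
    leaves the facet of larger weight. *)
Lemma typeB_lead (a : F) (i : 'I_m) (k : 'I_n) (W : {set 'I_n}) :
    maximal_clique m Delta W -> k \in W -> val a \subset W ->
    (k < elt a i)%N -> (forall i' : 'I_m, (i' < i)%N -> (elt a i' < k)%N) ->
  exists2 c, (c \in clique_complex m Delta) && (#|c| == m.+1) &
    is_lead le_RT (typeB_poly K Delta i c) (x_mnm i k + t_mnm a)%MM.
Proof.
move=> Wmax kW aW lt_k k_lt; have a_incr := elt_increasing a.
have ka : k \notin val a.
  apply/negP => /mem_facet[j kj]; have [ji|ij] := ltnP j i.
    by have := k_lt _ ji; rewrite kj ltnn.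
  by have := increasing_le a_incr ij; rewrite kj leqNgt lt_k.
pose c := k |: val a; exists c.
  rewrite cardsU1 ka card_facet eqxx andbT inE; apply/existsP; exists W.
  by rewrite Wmax /= subUset sub1set kW aW.
have cC : c \in clique_complex m Delta.
  by rewrite inE; apply/existsP; exists W; rewrite Wmax subUset sub1set kW aW.
have cm : #|c| = m.+1 by rewrite cardsU1 ka card_facet.
have [e [f [e_incr cE fE ->]]] := typeB_facets cC cm.
have e_inj := increasing_inj e_incr.
pose j0 : 'I_m.+1 := widen_ord (leqnSn m) i.
pose e' j := if unlift j0 j is Some l then elt a l else k.
have e'_incr : increasing e'.
  apply/increasingP => x y; rewrite /e'.
  case: unliftP => [x' ->|->]; case: unliftP => [y' ->|->] /=; rewrite ?ltnn //.
  - by move=> xy; apply: (increasingP _ a_incr); move: xy; rewrite ltnNge leq_bump2 -ltnNge.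
  - by move=> xi; apply: k_lt; move: xi; rewrite bumpE; case: (ltnP x' i) => // ge /ltnW; rewrite ltnNge ge.
  move=> iy; apply: leq_trans lt_k _; apply: increasing_le => //.
  by move: iy; rewrite bumpE; case: (ltnP y' i) => // lt1 lt2; have := ltn_trans lt1 lt2; rewrite ltnn.
have e'E : e =1 e'.
  apply: increasing_image_inj => //; rewrite -cE /c; apply/setP => x; rewrite !inE.
  apply/orP/imsetP => [[/eqP ->|/mem_facet[l <-]]|[j _ ->]].
  - by exists j0; rewrite // /e' unlift_none.
  - by exists (lift j0 l); rewrite // /e' liftK.
  by rewrite /e'; case: unliftP => [l _|_]; [right; exact: elt_mem|left].
have ej0 : e j0 = k by rewrite e'E /e' unlift_none.
have fj0 : f j0 = a by apply: elt_inj => l; rewrite fE /= e'E /e' liftK.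
rewrite (bigD1 j0) //= ej0 fj0.
apply: (is_leadP (image_orderP _ _) _ (erefl _)); first by rewrite signr_eq0.
apply: supp_all_sum => j jj0; apply: supp_allZ; apply: supp_allX; apply: image_order_lt.
have imageE l : mnm_image var_image (x_mnm i (e l) + t_mnm (f l))%MM =
    (U_(enum_rank (i, e l)) + diag_mnm (e \o lift l))%MM.
  rewrite mnm_imageD [X in (X + _)%MM]mnm_imageU image_t_mnm; congr (_ + _)%MM.
  by apply: eq_bigr => i' _; rewrite fE.
rewrite -ej0 -fj0 !imageE.
have coordE l i' k' : (U_(enum_rank (i, e l)) + diag_mnm (e \o lift l))%MM (enum_rank (i', k')) =
    ((i == i') && (e l == k') + (e (lift l i') == k'))%N.
  by rewrite mnmDE mnm1_pair diag_mnmE.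
have degE l : mdeg (U_(enum_rank (i, e l)) + diag_mnm (e \o lift l))%MM = m.+1.
  by rewrite mdegD mdeg1 mdeg_diag_mnm.
have e_lt (x y : 'I_m.+1) : (x < y)%N -> (e x < e y)%N by move/(increasingP _ e_incr).
have e_neq (x y : 'I_m.+1) : x != y -> (e x == e y) = false.
  by move=> xy; rewrite (inj_eq e_inj); apply/negbTE.
have gt_neq x (k' : 'I_n) : (k' < e x)%N -> (e x == k') = false.
  by move=> lt; apply/negbTE; rewrite -val_eqE neq_ltn /= lt orbT.
have im : (i.+1 < m.+1)%N by rewrite ltnS.
(* For j < i, row j of the image has e_(j+1) where the leading term has e_j, and the earlier rows
   agree. *)
have [ji|ij|ij] := ltngtP j i; last by move/eqP: jj0; case; apply/val_inj.
  have jm : (j < m)%N by apply: ltn_trans ji _.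
  pose j' := Ordinal jm.
  have lift_j : lift j j' = Ordinal (jm : (j.+1 < m.+1)%N) by apply/val_inj; rewrite /= /bump leqnn.
  have lift_j0 : lift j0 j' = j by apply/val_inj; rewrite /= /bump leqNgt ji.
  have ij' : (i == j') = false by apply/negbTE; rewrite -val_eqE /= neq_ltn ji orbT.
  apply/orP; left; apply: (@lt_mnm_pair _ _ _ _ j' (e j)); rewrite ?degE //; last first.
    rewrite !coordE ij' lift_j lift_j0 eqxx e_neq //.
    by rewrite -val_eqE /= gtn_eqF.
  move=> i' k' /orP[i'j|/andP[/eqP -> k'e]]; rewrite !coordE.
    have -> : (i == i') = false by apply/negbTE; rewrite -val_eqE /= neq_ltn (ltn_trans i'j) ?orbT.
    by congr (_ + (e _ == _))%N; apply/val_inj; rewrite /= !bumpE i'j (ltn_trans i'j).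
  rewrite ij' lift_j lift_j0 (gt_neq j) // gt_neq //; apply: ltn_trans k'e _.
  exact: e_lt.
pose i1 : 'I_m.+1 := Ordinal im.
have lift_i : lift j i = j0 by apply/val_inj; rewrite /= /bump leqNgt ij.
have lift_i0 : lift j0 i = i1 by apply/val_inj; rewrite /= /bump leqnn.
(* For j > i+1, row i has e_i and e_j, against e_i and e_(i+1) in the leading term. *)
have [ij1|ji1] := ltnP i.+1 j.
  apply/orP; left; apply: (@lt_mnm_pair _ _ _ _ i (e i1)); rewrite ?degE //; last first.
    rewrite !coordE eqxx lift_i lift_i0 eqxx /= e_neq; last by rewrite -val_eqE /= gtn_eqF.
    by rewrite e_neq // -val_eqE /= ltn_eqF.
  move=> i' k' /orP[i'i|/andP[/eqP -> k'e]]; rewrite !coordE.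
    have -> : (i == i') = false by apply/negbTE; rewrite -val_eqE /= neq_ltn i'i orbT.
    by congr (_ + (e _ == _))%N; apply/val_inj; rewrite /= !bumpE i'i (ltn_trans i'i).
  rewrite eqxx lift_i lift_i0 /= addnC (gt_neq i1) // (gt_neq j) //.
  by apply: ltn_trans k'e _; apply: e_lt.
(* For j = i+1 both images have e_i and e_(i+1) in row i, so the weight decides. *)
have jE : j = i1 by apply/val_inj/eqP; rewrite eqn_leq /= ji1 ij.
apply/orP; right; apply/andP; split.
  apply/eqP/mnm_pairP => i' k'; rewrite !coordE; have [<-|/negbTE ii'] := eqVneq i i'.
    by rewrite lift_i lift_i0 jE addnC.
  have -> : lift j i' = lift j0 i'.
    by apply/val_inj; rewrite jE /= bumpS_neq // val_eqE eq_sym ii'.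
  by [].
rewrite !mnm_weightD !weight_t_mnm ![mnm_weight _ (x_mnm _ _)]mnm_weightU !add0n.
apply/facet_weight_lt/sum_val_lt.
  apply/le_pluckerP => l; rewrite !fE /= jE; apply: (increasing_le e_incr); exact: bumpS_le.
by move=> /(_ i); rewrite !fE /= lift_i lift_i0 => /e_inj/(congr1 val)/eqP; rewrite eqn_leq ltnn andbF.
Qed.

End LeadingTerms.

(** * Plücker relations *)

Lemma same_content_forall m n (e g a b : 'I_m -> 'I_n) (P : pred 'I_n) :
  same_content e g a b -> (forall j, P (a j)) -> (forall j, P (b j)) ->
  (forall j, P (e j)) /\ (forall j, P (g j)).
Proof.
move=> eg_ab Pa Pb; have := eg_ab (fun k => ~~ P k : nat).
rewrite [X in _ = (X + _)%N]big1 ?[X in _ = (_ + X)%N]big1 => [|j _|j _]; rewrite ?Pa ?Pb //.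
move/eqP; rewrite addn_eq0 !sum_nat_eq0 => /andP[/forallP eP /forallP gP].
by split=> j; [move: (eP j)|move: (gP j)]; rewrite /= eqb0 negbK.
Qed.

Lemma same_content_count m n (e g a b : 'I_m -> 'I_n) x : same_content e g a b ->
  (count_le e x + count_le g x = count_le a x + count_le b x)%N.
Proof. by move/(_ (fun k => (k <= x)%N : nat)). Qed.

(** The counting functions of both pairs have the same sum, so lowering one row raises the other. *)
Lemma same_content_le m n (e g a b : 'I_m -> 'I_n) :
    increasing e -> increasing g -> increasing a -> increasing b ->
  same_content e g a b -> le_plucker e a -> le_plucker b g.
Proof.
move=> ei gi ai bi eg_ab /(le_plucker_count ei ai) ea.
apply/(le_plucker_count bi gi) => x; have := ea x; have := same_content_count x eg_ab.
lia.
Qed.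

Lemma same_content_swap m n (e g a b : 'I_m -> 'I_n) :
  same_content e g a b -> same_content e g b a.
Proof. by move=> eg_ab f; rewrite eg_ab addnC. Qed.

Section PluckerPairs.
Variables (m n : nat) (Delta : {set {set 'I_n}}).
Variables (r : nat) (u v : 'I_r.+1 -> 'I_n).
Hypothesis hunit : unit_interval m Delta u v.
Local Notation F := (facet m Delta).
Implicit Types (a b e g : F).

(** If the right end decreased, the later maximal clique would be contained in the earlier one. *)
Lemma clique_monotone (i j : 'I_r.+1) : (i <= j)%N -> (u i <= u j)%N && (v i <= v j)%N.
Proof.
rewrite leq_eqVlt => /orP[/eqP ij|ij]; first by rewrite (val_inj ij) !leqnn.
have uij := ui_increasing hunit ij; rewrite (ltnW uij) /= leqNgt; apply/negP => vji.
have maxi : maximal_clique m Delta (Defs.interval (u i) (v i)) by apply/(ui_cliques hunit); exists i.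
have maxj : maximal_clique m Delta (Defs.interval (u j) (v j)) by apply/(ui_cliques hunit); exists j.
have sub : Defs.interval (u j) (v j) \subset Defs.interval (u i) (v i).
  apply/fintype.subsetP => k; rewrite !inE => /andP[uk kv].
  by rewrite (leq_trans (ltnW uij) uk) (leq_trans kv (ltnW vji)).
have /setP/(_ (u i)) := maxsetsup maxj (maxsetp maxi) sub.
by rewrite !inE leqnn (ltnW (ui_nontrivial hunit i)) leqNgt uij.
Qed.

Lemma facet_sub_interval a : exists i, val a \subset Defs.interval (u i) (v i).
Proof.
by have [W Wmax aW] := facet_sub_clique a; move: Wmax aW => /(ui_cliques hunit)[i ->]; exists i.
Qed.

Lemma interval_facet (i : 'I_r.+1) (s : 'I_m -> 'I_n) : increasing s ->
  (forall j, (u i <= s j <= v i)%N) -> exists a, elt a =1 s.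
Proof.
move=> s_incr s_in.
have [|j|a aE _] := @clique_facet m n Delta (Defs.interval (u i) (v i)) s _ s_incr.
- by apply/(ui_cliques hunit); exists i.
- by rewrite inE.
by exists a.
Qed.

(** Let [a] and [b] lie in the cliques i and j, with i at most j. All entries are at least u_i and
    [e] is below [a], so [e] lies in clique i; all entries are at most v_j and [g] is above [b], so
    [g] lies in clique j. The bounds of [e] by both rows allow exchanging [a] and [b]. *)
Lemma content_facets a b (e g : 'I_m -> 'I_n) : increasing e -> increasing g ->
    le_plucker e (elt a) -> le_plucker e (elt b) -> same_content e g (elt a) (elt b) ->
  exists e' g' : F, elt e' =1 e /\ elt g' =1 g.
Proof.
move=> e_incr g_incr ea eb eg_ab.
have [i ai] := facet_sub_interval a; have [j bj] := facet_sub_interval b.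
wlog ij : a b i j ea eb eg_ab ai bj / (i <= j)%N.
  move=> IH; have [ij|/ltnW ji] := leqP i j; first exact: IH ea eb eg_ab ai bj ij.
  exact: IH eb ea (same_content_swap eg_ab) bj ai ji.
have [a_incr b_incr] := (elt_increasing a, elt_increasing b).
have /le_pluckerP bg := same_content_le e_incr g_incr a_incr b_incr eg_ab ea.
move: ea => /le_pluckerP ea.
move: ai bj => /facet_subset_interval ai /facet_subset_interval bj.
have /andP[uij vij] := clique_monotone ij.
have [eu gu] := same_content_forall (P := fun k => (u i <= k)%N) eg_ab
  (fun l => proj1 (andP (ai l))) (fun l => leq_trans uij (proj1 (andP (bj l)))).
have [ev gv] := same_content_forall (P := fun k => (k <= v j)%N) eg_ab
  (fun l => leq_trans (proj2 (andP (ai l))) vij) (fun l => proj2 (andP (bj l))).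
have [e' e'E] : exists e', elt e' =1 e.
  apply: (@interval_facet i) => // l; rewrite eu /=.
  by apply: leq_trans (ea l) _; case/andP: (ai l).
have [g' g'E] : exists g', elt g' =1 g.
  apply: (@interval_facet j) => // l; rewrite gv andbT.
  by apply: leq_trans (bg l); case/andP: (bj l).
by exists e', g'.
Qed.

Lemma row_min_increasing a b : increasing (row_min (elt a) (elt b)).
Proof.
have [a_incr b_incr] := (increasingP _ (elt_increasing a), increasingP _ (elt_increasing b)).
apply/increasingP => i j ij; rewrite !ffunE; have := a_incr _ _ ij; have := b_incr _ _ ij.
by case: (leqP (elt a i) (elt b i)); case: (leqP (elt a j) (elt b j)) => /=; lia.
Qed.

Lemma row_max_increasing a b : increasing (row_max (elt a) (elt b)).
Proof.
have [a_incr b_incr] := (increasingP _ (elt_increasing a), increasingP _ (elt_increasing b)).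
apply/increasingP => i j ij; rewrite !ffunE; have := a_incr _ _ ij; have := b_incr _ _ ij.
by case: (leqP (elt a i) (elt b i)); case: (leqP (elt a j) (elt b j)) => /=; lia.
Qed.

Lemma row_min_le a b :
  le_plucker (row_min (elt a) (elt b)) (elt a) /\ le_plucker (row_min (elt a) (elt b)) (elt b).
Proof.
by split; apply/le_pluckerP => j; rewrite ffunE; case: (leqP (elt a j) (elt b j)) => // /ltnW.
Qed.

Lemma row_min_max_content a b :
  same_content (row_min (elt a) (elt b)) (row_max (elt a) (elt b)) (elt a) (elt b).
Proof.
move=> f; rewrite -!big_split; apply: eq_bigr => j _ /=; rewrite !ffunE.
by case: ifP => // _; rewrite addnC.
Qed.

Lemma min_max_facets a b : exists c d : F,
  [/\ elt c =1 row_min (elt a) (elt b), elt d =1 row_max (elt a) (elt b),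
      [set min_elt a b j | j : 'I_m] = val c & [set max_elt a b j | j : 'I_m] = val d].
Proof.
have [ca cb] := row_min_le a b.
have [c [d [cE dE]]] := content_facets (row_min_increasing a b) (row_max_increasing a b) ca cb
  (row_min_max_content a b).
exists c, d; split=> //; rewrite facet_set; apply: eq_imset => j; rewrite ?cE ?dE ffunE //.
Qed.

Lemma count_facet (P : pred 'I_n) a : count P (enum (val a)) = (\sum_j P (elt a j))%N.
Proof.
rewrite (facet_sum (fun k => P k : nat)) -sum1_count big_mkcond -big_enum.
by apply: eq_bigr => k _; case: (P k).
Qed.

Lemma plucker_pairP a b e g : plucker_pair a b e g ->
  [/\ le_plucker (elt e) (elt g), le_plucker (elt e) (elt a), le_plucker (elt e) (elt b)
    & same_content (elt e) (elt g) (elt a) (elt b)].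
Proof.
case/and4P=> eg /le_pluckerP ec _ perm_eg; split=> //.
- by apply/le_pluckerP => j; apply: leq_trans (ec j) _; rewrite /min_elt; case: (leqP (elt a j) (elt b j)) => // /ltnW.
- by apply/le_pluckerP => j; apply: leq_trans (ec j) _; rewrite /min_elt; case: (leqP (elt a j) (elt b j)) => // /ltnW.
move=> f; rewrite !facet_sum -![(\sum_(k in _) _)%N]big_enum /= -!big_cat.
exact: perm_big.
Qed.

Lemma plucker_pair_intro a b e g : le_plucker (elt e) (elt g) ->
    le_plucker (elt e) (elt a) -> le_plucker (elt e) (elt b) ->
    same_content (elt e) (elt g) (elt a) (elt b) ->
    ~ elt g =1 row_max (elt a) (elt b) ->
  plucker_pair a b e g.
Proof.
move=> eg /le_pluckerP ea /le_pluckerP eb eg_ab gd; apply/and4P; split=> //.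
- by apply/le_pluckerP => j; rewrite /min_elt; case: ifP.
- apply/eqP => gE; apply: gd; apply: increasing_image_inj.
  + exact: elt_increasing.
  + exact: row_max_increasing.
  by rewrite -facet_set gE; apply: eq_imset => j; rewrite ffunE.
apply/seq.permP => P; rewrite !count_cat !count_facet; exact: (eg_ab (fun k => P k : nat)).
Qed.

(** Incomparability makes [e] different from [a] and from [b], so its sum is strictly below both and
    concavity applies. *)
Lemma plucker_pair_weight a b e g : ~~ le_plucker (elt a) (elt b) ->
    ~~ le_plucker (elt b) (elt a) -> le_plucker (elt e) (elt a) -> le_plucker (elt e) (elt b) ->
    same_content (elt e) (elt g) (elt a) (elt b) ->
  (facet_weight e + facet_weight g < facet_weight a + facet_weight b)%N.
Proof.
move=> ab ba ea eb eg_ab; apply: facet_weight_pair; last exact: eg_ab.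
  apply: sum_val_lt => // e_a; move: eb; apply/negP; apply: contra ab => /le_pluckerP eb.
  by apply/le_pluckerP => j; rewrite -e_a.
apply: sum_val_lt => // e_b; move: ea; apply/negP; apply: contra ba => /le_pluckerP ea.
by apply/le_pluckerP => j; rewrite -e_b.
Qed.

End PluckerPairs.

(** * Existence of the Plücker relations on facets *)

Section TypeC.
Variables (K : fieldType) (m n : nat) (Delta : {set {set 'I_n}}).
Variables (r : nat) (u v : 'I_r.+1 -> 'I_n).
Hypothesis hunit : unit_interval m Delta u v.
Local Notation F := (facet m Delta).
Local Notation D := (@generic_minor K m n).
Local Notation row := {ffun 'I_m -> 'I_n}.
Implicit Types (a b c d e g : F).

Lemma minorE a : minor K a = D (elt a).
Proof. by rewrite generic_minor.unlock. Qed.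

(** The first clause says that (C) vanishes on the minors. The second bounds the initial monomials
    of the products that survive in [K], which the leading term of (C) in R[T] depends on. *)
Definition plucker_coefficients (lam : F -> F -> F -> F -> int) := forall a b,
  (forall c d, [set min_elt a b j | j : 'I_m] = val c ->
      [set max_elt a b j | j : 'I_m] = val d ->
    minor K a * minor K b - minor K c * minor K d +
      \sum_(p : F * F | plucker_pair a b p.1 p.2)
        (lam a b p.1 p.2)%:~R *: (minor K p.1 * minor K p.2) = 0) /\
  (forall e g, plucker_pair a b e g -> (lam a b e g)%:~R != 0 :> K ->
    ((diag_mnm (elt e) + diag_mnm (elt g))%MM <= (diag_mnm (elt a) + diag_mnm (elt b))%MM)%O).

(** The coefficients are those of the straightening of [a][b], with opposite sign because (C)
    collects all terms on one side. The sum over pairs of rows becomes a sum over pairs of facets by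
    [content_facets]. *)
Lemma plucker_coefficients_exist : exists lam, plucker_coefficients lam.
Proof.
have rel (p : F * F) := plucker_relation K (elt_increasing p.1) (elt_increasing p.2).
have [L LP] := choice rel.
pose h (p : F * F) : row * row := ([ffun j => elt p.1 j], [ffun j => elt p.2 j]).
have h_inj : injective h.
  move=> [e g] [e' g'] [/ffunP ee /ffunP gg]; congr (_, _); apply: elt_inj => j.
    by have := ee j; rewrite !ffunE.
  by have := gg j; rewrite !ffunE.
have Dh p : D (h p).1 * D (h p).2 = minor K p.1 * minor K p.2.
  have ffE c : D [ffun j => elt c j] = minor K c.
    by rewrite minorE; apply: eq_generic_minor => j; rewrite ffunE.
  by rewrite /= !ffE.
have hE p : h p = ([ffun j => elt p.1 j], [ffun j => elt p.2 j]) by [].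
clearbody h; exists (fun a b e g => - L (a, b) (h (e, g))) => a b.
have [relE supp coef1] := LP (a, b); rewrite /= in relE supp coef1.
split=> [c d cE dE|e g eg lam0]; last first.
  have /supp[_ _] : L (a, b) (h (e, g)) != 0.
    by apply: contraNneq lam0 => ->; rewrite oppr0.
  rewrite hE /=; congr (is_true (_ <= _)%O); congr (_ + _)%MM;
    by apply: eq_bigr => j _; rewrite ffunE.
have hcd : h (c, d) = (row_min (elt a) (elt b), row_max (elt a) (elt b)).
  have [c' [d' [c'E d'E]]] := min_max_facets hunit a b.
  rewrite cE dE => /val_inj cc /val_inj dd; subst c' d'.
  by rewrite hE; congr (_, _); apply/ffunP => j; rewrite ffunE ?c'E ?d'E.
rewrite !minorE relE (bigD1 (h (c, d))) //=.
rewrite {1}hcd coef1 scale1r Dh !minorE [_ + _ - _]addrAC subrr add0r.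
rewrite (bigID (mem [set h p | p : F * F & plucker_pair a b p.1 p.2])) /=.
rewrite [X in _ + X + _]big1 ?addr0; last first.
  move=> p /andP[pcd pN]; have [->|/supp[[e_incr g_incr eg ea eg_ab] eb _]] := eqVneq (L (a, b) p) 0.
    by rewrite scale0r.
  case/negP: pN; have [e [g [eE gE]]] := content_facets hunit e_incr g_incr ea eb eg_ab.
  have pE : p = h (e, g).
    rewrite hE; case: p eE gE {pcd e_incr g_incr eg ea eg_ab eb} => p1 p2 /= eE gE.
    by congr (_, _); apply/ffunP => j; rewrite ffunE.
  have eg_ab' : same_content (elt e) (elt g) (elt a) (elt b).
    by move=> f; rewrite -eg_ab; congr addn; apply: eq_bigr => j _; rewrite ?eE ?gE.
  rewrite pE; apply: imset_f; rewrite inE /=; apply: plucker_pair_intro => //.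
  - by apply/le_pluckerP => j; rewrite eE gE; apply/le_pluckerP.
  - by apply/le_pluckerP => j; rewrite eE; apply/le_pluckerP.
  - by apply/le_pluckerP => j; rewrite eE; apply/le_pluckerP.
  (* If g is the row of maxima, equality of contents makes e the row of minima, and that pair has
     been split off. *)
  move=> gd; move/negP: pcd; apply; rewrite pE hcd hE; apply/eqP; congr (_, _).
    apply/ffunP => j; rewrite ffunE; apply: le_plucker_anti.
    + apply/le_plucker_count; [exact: elt_increasing|exact: row_min_increasing|] => x.
      have := same_content_count x eg_ab'; have := same_content_count x (row_min_max_content a b).
      have -> : count_le (elt g) x = count_le (row_max (elt a) (elt b)) x.
        by apply: eq_bigr => l _; rewrite gd.
      by move=> <- /addIn ->.
    apply/le_plucker_count; [exact: row_min_increasing|exact: elt_increasing|] => x.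
    have := same_content_count x eg_ab'; have := same_content_count x (row_min_max_content a b).
    have -> : count_le (elt g) x = count_le (row_max (elt a) (elt b)) x.
      by apply: eq_bigr => l _; rewrite gd.
    by move=> <- /addIn ->.
  by apply/ffunP => j; rewrite ffunE gd.
rewrite (eq_bigl (mem [set h p | p : F * F & plucker_pair a b p.1 p.2])) => [|p]; last first.
  rewrite /= andb_idl // => /imsetP[q]; rewrite inE => /and4P[_ _ gd _] ->.
  by apply: contra gd => /eqP/h_inj qE; rewrite qE dE.
rewrite big_imset /=; last by move=> p q _ _ /h_inj.
apply/eqP; rewrite addr_eq0 -sumrN; apply/eqP; apply: eq_big => p; first by rewrite inE.
by move=> _; rewrite Dh -surjective_pairing mulrNz scaleNr opprK.
Qed.

End TypeC.

Section TypeCLead.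
Variables (K : fieldType) (m n : nat) (Delta : {set {set 'I_n}}).
Variables (r : nat) (u v : 'I_r.+1 -> 'I_n).
Hypothesis hunit : unit_interval m Delta u v.
Local Notation F := (facet m Delta).
Local Notation V := ('I_m * 'I_n + F)%type.
Variable lam : F -> F -> F -> F -> int.
Hypothesis lamP : plucker_coefficients K lam.
Implicit Types (a b c d e g : F).

Definition fiber_mnm a : 'X_{1..#|{: F}|} := U_(enum_rank a)%MM.

Lemma typeC_polyE a b : exists c d, [/\
  [set min_elt a b j | j : 'I_m] = val c, [set max_elt a b j | j : 'I_m] = val d,
  [/\ le_plucker (elt c) (elt a), le_plucker (elt c) (elt b)
    & same_content (elt c) (elt d) (elt a) (elt b)]
  & typeC_poly K lam a b = 'X_[fiber_mnm a + fiber_mnm b] - 'X_[fiber_mnm c + fiber_mnm d] +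
    \sum_(p : F * F | plucker_pair a b p.1 p.2)
      (lam a b p.1 p.2)%:~R *: 'X_[fiber_mnm p.1 + fiber_mnm p.2]].
Proof.
have [c [d [cE dE cV dV]]] := min_max_facets hunit a b.
have [ca cb] := row_min_le a b; have cd_ab := row_min_max_content a b.
exists c, d; split=> //.
  split; last by move=> f; rewrite -cd_ab; congr addn; apply: eq_bigr => j _; rewrite ?cE ?dE.
    by apply/le_pluckerP => j; rewrite cE; apply/le_pluckerP.
  by apply/le_pluckerP => j; rewrite cE; apply/le_pluckerP.
rewrite /typeC_poly cV dV !Tvar_val !mpolyXD; congr (_ + _); apply: eq_bigr => p _.
by rewrite !Tvar_val mpolyXD -mulrA mulrzl scaler_int.
Qed.

Definition psi_morph : {rmorphism ringT K m Delta -> ringR K m n} :=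
  subst_var (@mpolyC _ K) (@minor K m n Delta).

Lemma psiE : @psi K m n Delta =1 psi_morph. Proof. by []. Qed.

Lemma psi_fiber_mnm2 a b : psi_morph 'X_[fiber_mnm a + fiber_mnm b] = minor K a * minor K b.
Proof. by rewrite mpolyXD rmorphM /= ![subst_var _ _ _]subst_var_var. Qed.

Lemma typeC_kerK a b : kerK (typeC_poly K lam a b).
Proof.
have [c [d [cV dV _ ->]]] := typeC_polyE a b; rewrite /kerK psiE.
have [/(_ c d cV dV) <- _] := lamP a b.
rewrite rmorphD rmorphB !psi_fiber_mnm2 rmorph_sum; congr (_ + _).
apply: eq_bigr => p _; rewrite -psi_fiber_mnm2 -!mul_mpolyC rmorphM; congr (_ * _).
exact: subst_varC.
Qed.

Lemma typeC_supp (P : 'X_{1..#|{: F}|} -> Prop) a b :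
    P (fiber_mnm a + fiber_mnm b)%MM ->
    (forall e g, le_plucker (elt e) (elt a) -> le_plucker (elt e) (elt b) ->
       same_content (elt e) (elt g) (elt a) (elt b) -> P (fiber_mnm e + fiber_mnm g)%MM) ->
  supp_all P (typeC_poly K lam a b).
Proof.
move=> Pab Peg; have [c [d [_ _ [ca cb cd] ->]]] := typeC_polyE a b.
apply: supp_allD; first by apply: supp_allB; apply: supp_allX; [exact: Pab|exact: Peg].
apply: supp_all_sum => p /plucker_pairP[_ ea eb eg]; apply: supp_allZ; apply: supp_allX.
exact: Peg.
Qed.

Lemma typeC_lead a b : ~~ le_plucker (elt a) (elt b) -> ~~ le_plucker (elt b) (elt a) ->
  is_lead (@le_T m n Delta) (typeC_poly K lam a b) (fiber_mnm a + fiber_mnm b)%MM.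
Proof.
move=> ab ba; have [c [d [_ _ [ca cb cd] ->]]] := typeC_polyE a b.
apply: (is_leadP (weight_orderP _) (oner_neq0 K)); first by rewrite scale1r -addrA.
have lower e g : le_plucker (elt e) (elt a) -> le_plucker (elt e) (elt b) ->
    same_content (elt e) (elt g) (elt a) (elt b) ->
    weight_order (@facet_weight m n Delta) (fiber_mnm e + fiber_mnm g)%MM (fiber_mnm a + fiber_mnm b)%MM &&
    ((fiber_mnm e + fiber_mnm g)%MM != (fiber_mnm a + fiber_mnm b)%MM).
  move=> ea eb eg; apply: weight_order_lt; rewrite !mnm_weightD !mnm_weightU.
  exact: plucker_pair_weight.
apply: supp_allD; first by apply: supp_allN; apply: supp_allX; apply: lower.
apply: supp_all_sum => p /plucker_pairP[_ ea eb eg]; apply: supp_allZ; apply: supp_allX.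
exact: lower.
Qed.

Lemma of_T_fiber_mnm2 a b :
  of_T (K := K) 'X_[fiber_mnm a + fiber_mnm b] = 'X_[t_mnm a + t_mnm b].
Proof. by rewrite of_TE mpolyXD rmorphM mpolyXD; congr (_ * _); exact: of_T_var. Qed.

(** Terms with a nonzero coefficient have images at most that of T_a T_b by the choice of [lam];
    ties, such as that of the min-max term, are broken by the weight. *)
Lemma of_T_typeC_lead a b : ~~ le_plucker (elt a) (elt b) -> ~~ le_plucker (elt b) (elt a) ->
  is_lead (@le_RT m n Delta) (of_T (typeC_poly K lam a b)) (t_mnm a + t_mnm b)%MM.
Proof.
move=> ab ba; have [c [d [cV dV [ca cb cd] ->]]] := typeC_polyE a b.
have of_TZ (x : K) f : of_T_morph K m Delta (x *: f) = x *: of_T_morph K m Delta f.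
  by rewrite [LHS]subst_varZ mul_mpolyC.
rewrite of_TE rmorphD rmorphB rmorph_sum -!of_TE !of_T_fiber_mnm2.
apply: (is_leadP (image_orderP _ _) (oner_neq0 K)); first by rewrite scale1r -addrA.
have lower e g : le_plucker (elt e) (elt a) -> le_plucker (elt e) (elt b) ->
    same_content (elt e) (elt g) (elt a) (elt b) ->
    ((diag_mnm (elt e) + diag_mnm (elt g))%MM <= (diag_mnm (elt a) + diag_mnm (elt b))%MM)%O ->
    le_RT (t_mnm e + t_mnm g)%MM (t_mnm a + t_mnm b)%MM &&
    ((t_mnm e + t_mnm g)%MM != (t_mnm a + t_mnm b)%MM).
  move=> ea eb eg leq_eg; apply: image_order_lt; rewrite !mnm_imageD !image_t_mnm.
  move: leq_eg; rewrite le_eqVlt orbC => /orP[->//|->] /=.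
  by rewrite !mnm_weightD !weight_t_mnm plucker_pair_weight ?orbT.
apply: supp_allD.
  apply: supp_allN; apply: supp_allX; apply: lower => //.
  suff -> : (diag_mnm (elt c) + diag_mnm (elt d) = diag_mnm (elt a) + diag_mnm (elt b))%MM by [].
  have [c' [d' [c'E d'E c'V d'V]]] := min_max_facets hunit a b.
  have cc : c = c' by apply/val_inj; rewrite -cV.
  have dd : d = d' by apply/val_inj; rewrite -dV.
  apply: mnm_pairP => i j; rewrite !mnmDE !diag_mnmE cc dd c'E d'E !ffunE.
  by case: ifP => // _; rewrite addnC.
apply: supp_all_sum => p pl; rewrite of_TZ -of_TE of_T_fiber_mnm2.
have [->|lam0] := eqVneq ((lam a b p.1 p.2)%:~R : K) 0.
  by rewrite scale0r; apply: supp_all0.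
apply: supp_allZ; apply: supp_allX; have [_ ea eb eg] := plucker_pairP pl.
by apply: lower => //; have [_] := lamP a b; apply.
Qed.

End TypeCLead.

(** * Initial monomials of the images in R[t] *)

Section Kernels.
Variables (K : fieldType) (m n : nat) (Delta : {set {set 'I_n}}).
Local Notation F := (facet m Delta).
Local Notation V := ('I_m * 'I_n + F)%type.
Local Notation NX := #|{: 'I_m * 'I_n}|.
Local Notation NRT := #|{: V}|.
Implicit Types (a b c d e g : F) (mu : 'X_{1..NRT}).

Definition phi_base (x : V) : ringR K m n :=
  match x with inl ij => xvar K ij.1 ij.2 | inr a => minor K a end.

Definition t_degree (x : V) : nat := match x with inl _ => 0%N | inr _ => 1%N end.

Definition phi_morph : {rmorphism ringRT K m Delta -> {poly ringR K m n}} :=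
  subst_var (polyC \o @mpolyC NX K)
    (fun x : V => match x with inl ij => (xvar K ij.1 ij.2)%:P | inr a => minor K a *: 'X end).

Lemma phiE : @phi K m n Delta =1 phi_morph. Proof. by []. Qed.

Definition phi_coef mu : ringR K m n := \prod_x phi_base x ^+ mu (enum_rank x).

Lemma phi_mnm mu : phi_morph 'X_[mu] = phi_coef mu *: 'X^(mnm_weight t_degree mu).
Proof.
rewrite [LHS]subst_varX /phi_coef /mnm_weight -prodrXr -scaler_prod.
apply: eq_bigr => -[ij|a] _ /=; rewrite ?mul0n ?mul1n ?expr0 ?exprZn //.
by rewrite alg_polyC rmorphXn.
Qed.

(** The power of t records the degree in the T variables, so the kernel can be tested in each such
    degree separately. *)
Lemma phi_coefE (f : ringRT K m Delta) (k : nat) : (phi f)`_k =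
  \sum_(mu <- [seq mu <- msupp f | mnm_weight t_degree mu == k]) f@_mu *: phi_coef mu.
Proof.
rewrite phiE {1}[f]mpolyE rmorph_sum coef_sum big_filter [RHS]big_mkcond /=.
apply: eq_bigr => mu _; rewrite [subst_var _ _ _]subst_varZ phi_mnm /=.
rewrite mul_polyC coefZ coefZ coefXn eq_sym; case: eqP => _.
  by rewrite mulr1 mul_mpolyC.
by rewrite !mulr0.
Qed.

Lemma phi_base_lead x : phi_base x != 0 /\ mlead (phi_base x) = var_image x.
Proof.
case: x => [ij|a] /=; last first.
  by rewrite minorE generic_minor_neq0 ?mlead_generic_minor ?elt_increasing.
rewrite /xvar /var -surjective_pairing mleadXm; split=> //.
by rewrite -mleadc_eq0 mleadXm mcoeffX eqxx oner_eq0.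
Qed.

Lemma phi_coef_neq0 mu : phi_coef mu != 0.
Proof.
by rewrite /phi_coef; apply/prodf_neq0 => x _; rewrite expf_neq0 //; case: (phi_base_lead x).
Qed.

Lemma mlead_phi_coef mu : mlead (phi_coef mu) = mnm_image (@var_image m n Delta) mu.
Proof.
rewrite /phi_coef mlead_prod => [|x _ _]; last by rewrite expf_neq0 //; case: (phi_base_lead x).
by apply: eq_bigr => x _; have [nz <-] := phi_base_lead x; rewrite mleadX.
Qed.

Lemma t_degreeE mu : mnm_weight t_degree mu = (\sum_(a : F) mu (enum_rank (inr a)))%N.
Proof.
rewrite /mnm_weight big_sumType /= big1 ?add0n => [|i _]; last by rewrite mul0n.
by apply: eq_bigr => a _; rewrite mul1n.
Qed.

Lemma image_pair mu i k : mnm_image (@var_image m n Delta) mu (enum_rank (i, k)) =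
  (mu (enum_rank (inl (i, k))) + \sum_(a | elt a i == k) mu (enum_rank (inr a)))%N.
Proof.
rewrite /mnm_image mnm_sumE big_sumType /=; congr addn.
  rewrite (bigD1 (i, k)) //= mulmnE mnm1_pair !eqxx mul1n big1 ?addn0 // => -[i' k'] ne.
  by rewrite mulmnE mnm1_pair -[_ && _]/((i', k') == (i, k)) (negbTE ne).
by rewrite [RHS]big_mkcond; apply: eq_bigr => a _; rewrite mulmnE diag_mnmE; case: eqP; rewrite ?mul1n.
Qed.

End Kernels.

(** * The presentation ideal of the Rees algebra *)

Section GroebnerBases.
Variables (K : fieldType) (m n : nat) (Delta : {set {set 'I_n}}).
Variables (r : nat) (u v : 'I_r.+1 -> 'I_n).
Hypotheses (hm : (0 < m)%N) (hunit : unit_interval m Delta u v).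
Local Notation F := (facet m Delta).
Local Notation V := ('I_m * 'I_n + F)%type.
Local Notation NX := #|{: 'I_m * 'I_n}|.
Local Notation NRT := #|{: V}|.
Variable lam : F -> F -> F -> F -> int.
Hypothesis lamP : plucker_coefficients K lam.
Implicit Types (a b : F) (mu : 'X_{1..NRT}).

Lemma phi_of_R p : phi_morph K m Delta (of_R_morph K m Delta p) = p%:P.
Proof.
pose h (ij : 'I_m * 'I_n) : {poly ringR K m n} := (xvar K ij.1 ij.2)%:P.
pose g1 : {rmorphism ringR K m n -> {poly ringR K m n}} :=
  phi_morph K m Delta \o of_R_morph K m Delta.
pose g2 : {rmorphism ringR K m n -> {poly ringR K m n}} := polyC.
have g1E : g1 =1 subst_var (polyC \o @mpolyC NX K) h.
  apply: subst_var_unique => [x|ij]; rewrite /g1 /=.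
    by rewrite [subst_var _ _ _%:MP]subst_varC; apply: subst_varC.
  by rewrite [subst_var _ _ (var K ij)]subst_var_var; apply: subst_var_var.
have g2E : g2 =1 subst_var (polyC \o @mpolyC NX K) h.
  by apply: subst_var_unique => [x|[i j]].
exact: etrans (g1E p) (esym (g2E p)).
Qed.

Lemma phi_of_T_var a : phi_morph K m Delta 'X_[t_mnm a] = minor K a *: 'X.
Proof. exact: subst_var_var. Qed.

Lemma phi_x_t i k a :
  phi_morph K m Delta 'X_[x_mnm Delta i k + t_mnm a] = (xvar K i k * minor K a) *: 'X.
Proof.
have phi_x : phi_morph K m Delta 'X_[x_mnm Delta i k] = (xvar K i k)%:P by exact: subst_var_var.
by rewrite mpolyXD rmorphM phi_of_T_var phi_x mul_polyC scalerA.
Qed.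

Let eps : {rmorphism ringR K m n -> {poly ringR K m n}} :=
  subst_var (polyC \o @mpolyC NX K) (fun ij : 'I_m * 'I_n =>
    if ij.1 == Ordinal hm then xvar K ij.1 ij.2 *: 'X else (xvar K ij.1 ij.2)%:P).

Lemma eps_minor a : eps (minor K a) = minor K a *: 'X.
Proof.
pose d : 'rV[{poly ringR K m n}]_m := \row_i (if i == Ordinal hm then 'X else 1).
rewrite /minor -det_map_mx -mul_polyC mulrC -det_map_mx.
have <- : \det (diag_mx d) = 'X.
  rewrite det_diag (bigD1 (Ordinal hm)) //= big1 ?mulr1 ?mxE ?eqxx // => i /negbTE ni.
  by rewrite mxE ni.
rewrite -det_mulmx; congr (\det _); apply/matrixP => i j.
rewrite mul_diag_mx !mxE [LHS]subst_var_var /=; case: eqP => _; last by rewrite mul1r.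
by rewrite -mul_polyC mulrC.
Qed.

(* Scaling the first row of X by t multiplies every maximal minor by t. *)
Lemma phi_of_T f : phi_morph K m Delta (of_T_morph K m Delta f) = eps (psi_morph K m Delta f).
Proof.
pose h a : {poly ringR K m n} := minor K a *: 'X.
transitivity (subst_var (polyC \o @mpolyC NX K) h f).
  apply: (subst_var_unique (g := phi_morph K m Delta \o of_T_morph K m Delta)) => [x|a] /=.
    by rewrite [subst_var _ _ _%:MP]subst_varC; apply: subst_varC.
  by rewrite [subst_var _ _ (var K a)]subst_var_var; apply: subst_var_var.
symmetry; apply: (subst_var_unique (g := eps \o psi_morph K m Delta)) => [x|a] /=.
  by rewrite [subst_var _ _ _%:MP]subst_varC; apply: subst_varC.
by rewrite [subst_var _ _ (var K a)]subst_var_var; apply: eps_minor.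
Qed.

(** On K[T] the map [phi] factors through [psi] followed by the scaling [eps], so the relation need
    not be split into homogeneous parts. *)
Lemma kerK_kerJ f : @kerK K m n Delta f -> kerJ (of_T f).
Proof.
by rewrite /kerK psiE /kerJ phiE of_TE => psif; rewrite [LHS]phi_of_T psif rmorph0.
Qed.

Lemma phi_R_t p a :
  phi_morph K m Delta (of_R_morph K m Delta p * 'X_[t_mnm a]) = (p * minor K a) *: 'X.
Proof. by rewrite rmorphM phi_of_R phi_of_T_var mul_polyC scalerA. Qed.

Lemma typeA_kerJ a b : kerJ (typeA_poly K a b).
Proof.
have typeAE : typeA_poly K a b = of_R_morph K m Delta (minor K a) * 'X_[t_mnm b] -
    of_R_morph K m Delta (minor K b) * 'X_[t_mnm a].
  by rewrite /typeA_poly !Tvar_val !of_T_var.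
rewrite /kerJ phiE typeAE rmorphB.
have -> : phi_morph K m Delta (of_R_morph K m Delta (minor K a) * 'X_[t_mnm b]) =
    (minor K a * minor K b) *: 'X by exact: phi_R_t.
have -> : phi_morph K m Delta (of_R_morph K m Delta (minor K b) * 'X_[t_mnm a]) =
    (minor K b * minor K a) *: 'X by exact: phi_R_t.
by rewrite mulrC subrr.
Qed.

Lemma facets_laplace (e : 'I_m.+1 -> 'I_n) (f : 'I_m.+1 -> F) (i : 'I_m) :
  (forall j, elt (f j) =1 e \o lift j) ->
  \sum_(j < m.+1) (-1) ^+ (i + j) *: (xvar K i (e j) * minor K (f j)) = 0.
Proof.
move=> fE.
(* For row 0 [unlift] gives [None], and the default puts a second copy of row [i] of X above the
   rows of X. *)
pose M : 'M[ringR K m n]_m.+1 := \matrix_(k, l) xvar K (odflt i (unlift ord0 k)) (e l).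
have M0 : \det M = 0.
  apply: (determinant_alternate (neq_lift ord0 i)) => l.
  by rewrite !mxE unlift_none liftK.
have : (-1) ^+ i * \det M = 0 by rewrite M0 mulr0.
rewrite (expand_det_row M ord0) mulr_sumr => M0'; rewrite -[RHS]M0'.
apply: eq_bigr => j _; rewrite /cofactor mxE unlift_none /= add0n exprD.
have -> : \det (row' ord0 (col' j M)) = minor K (f j).
  by congr (\det _); apply/matrixP => k l; rewrite !mxE liftK /= fE.
have signE k : (-1) ^+ k = ((-1) ^+ k)%:MP :> ringR K m n.
  by rewrite rmorphXn rmorphN1.
by rewrite -scalerA -!mul_mpolyC -!signE [X in _ = _ * X]mulrCA.
Qed.

Lemma typeB_kerJ (i : 'I_m) (c : {set 'I_n}) :
  c \in clique_complex m Delta -> #|c| = m.+1 -> kerJ (typeB_poly K Delta i c).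
Proof.
move=> cC cm; have [e [f [_ _ fE ->]]] := typeB_facets K cC cm.
rewrite /kerJ phiE rmorph_sum /=.
have := congr1 (fun p : ringR K m n => p *: 'X) (facets_laplace i fE).
rewrite scale0r scaler_suml => laplace; rewrite -[RHS]laplace.
apply: eq_bigr => j _; rewrite [LHS]subst_varZ phi_x_t /=.
by rewrite mul_polyC -mul_mpolyC scalerA.
Qed.

Definition rees_generators : seq (ringRT K m Delta) :=
  typeA K m Delta ++ typeB K m Delta ++ map (@of_T K m n Delta) (typeC K lam u v).

Lemma typeA_mem a b : in_distinct_cliques a b -> typeA_poly K a b \in rees_generators.
Proof.
by move=> ab; rewrite mem_cat; apply/orP; left; apply/imageP; exists (a, b).
Qed.

Lemma typeB_mem (i : 'I_m) (c : {set 'I_n}) : c \in clique_complex m Delta -> #|c| = m.+1 ->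
  typeB_poly K Delta i c \in rees_generators.
Proof.
move=> cC cm; rewrite !mem_cat; apply/orP; right; apply/orP; left.
by apply/imageP; exists (i, c) => //; rewrite inE /= cC cm eqxx.
Qed.

(** Type (C) lists a pair in the order of its clique indices, so one of the two orders occurs. Both
    have the same leading monomial. *)
Lemma typeC_mem a b : ~~ le_plucker (elt a) (elt b) -> ~~ le_plucker (elt b) (elt a) ->
  (typeC_poly K lam a b \in typeC K lam u v) || (typeC_poly K lam b a \in typeC K lam u v).
Proof.
move=> ab ba; case: (leqP (clique_index u v a) (clique_index u v b)) => [le|/ltnW le].
  by apply/orP; left; apply/imageP; exists (a, b) => //; rewrite inE /= ab ba le.
by apply/orP; right; apply/imageP; exists (b, a) => //; rewrite inE /= ab ba le.
Qed.

Lemma rees_generatorsP g : g \in rees_generators -> [\/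
  exists a b, g = typeA_poly K a b,
  exists (i : 'I_m) (c : {set 'I_n}), [/\ c \in clique_complex m Delta, #|c| = m.+1 & g = typeB_poly K Delta i c]
  | exists a b, g = of_T (typeC_poly K lam a b)].
Proof.
rewrite !mem_cat => /or3P[/imageP[[a b] _ ->]|/imageP[[i c] /andP[/= cC /eqP cm] ->]|].
- by apply: Or31; exists a, b.
- by apply: Or32; exists i, c.
by move=> /mapP[_ /imageP[[a b] _ ->] ->]; apply: Or33; exists a, b.
Qed.

Lemma rees_generators_kerJ g : g \in rees_generators -> kerJ g.
Proof.
case/rees_generatorsP=> [[a [b ->]]|[i [c [cC cm ->]]]|[a [b ->]]].
- exact: typeA_kerJ.
- exact: typeB_kerJ.
apply: kerK_kerJ; exact: (typeC_kerK hunit lamP).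
Qed.

Lemma mdeg_perm_mnm (p : 'S_m) (s : 'I_m -> 'I_n) : mdeg (perm_mnm Delta p s) = m.
Proof.
rewrite mdeg_sum (eq_bigr (fun=> 1%N)) => [|i _]; last exact: mdeg1.
by rewrite sum1_card card_ord.
Qed.

Lemma of_T_supp P (f : ringT K m Delta) :
  supp_all (fun tau => P (mnm_image (@t_mnm m n Delta) tau)) f -> supp_all P (of_T f).
Proof.
move=> fP; rewrite of_TE [f]mpolyE rmorph_sum big_seq; apply: supp_all_sum => tau /fP Ptau.
have -> : of_T_morph K m Delta (f@_tau *: 'X_[tau]) =
    f@_tau *: 'X_[mnm_image (@t_mnm m n Delta) tau].
  rewrite [LHS]subst_varZ mul_mpolyC subst_varX /mnm_image -mprodXE; congr (_ *: _).
  by apply: eq_bigr => a _; rewrite -mpolyXn.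
by apply: supp_allZ; apply: supp_allX.
Qed.

(** In the total degree, with every x and T of degree 1, the relations (A) have degree m+1, and (B)
    and (C) have degree 2. *)
Lemma rees_generators_homog g : g \in rees_generators ->
  exists k, forall mu, mu \in msupp g -> mdeg mu = k.
Proof.
case/rees_generatorsP=> [[a [b ->]]|[i [c [cC cm ->]]]|[a [b ->]]].
- exists m.+1; rewrite typeA_polyE; apply: supp_allB; apply: supp_all_sum => p _;
    by apply: supp_allZ; apply: supp_allX; rewrite mdegD mdeg1 mdeg_perm_mnm addn1.
- exists 2%N; have [e [f [_ _ fE ->]]] := typeB_facets K cC cm.
  by apply: supp_all_sum => j _; apply: supp_allZ; apply: supp_allX; rewrite mdegD !mdeg1.
exists 2%N; apply: of_T_supp; apply: (typeC_supp hunit) => [|e g' _ _ _];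
  by rewrite mnm_imageD !mnm_imageU mdegD !mdeg1.
Qed.

Lemma perm_mnm1E (s : 'I_m -> 'I_n) (x : V) : perm_mnm Delta 1%g s (enum_rank x) =
  match x with inl ij => s ij.1 == ij.2 | inr _ => false end :> nat.
Proof.
rewrite mnm_sumE; case: x => [[i k]|a] /=; last first.
  by rewrite big1 // => j _; rewrite mnm1E (inj_eq enum_rank_inj).
rewrite (bigD1 i) //= perm1 mnm1E (inj_eq enum_rank_inj) big1 ?addn0 => [|j ji].
  by rewrite -[_ == _]/((i, s i) == (i, k)) xpair_eqE eqxx.
rewrite perm1 mnm1E (inj_eq enum_rank_inj) -[_ == _]/((j, s j) == (i, k)).
by rewrite xpair_eqE (negbTE ji).
Qed.

Lemma irreducible_normal mu : ~ reducible (@le_RT m n Delta) rees_generators mu ->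
  normal_form (fun i k => mu (enum_rank (inl (i, k) : V))) (fun a => mu (enum_rank (inr a : V))).
Proof.
move=> irr.
have add_le (x y : V) : x != y -> (0 < mu (enum_rank x))%N -> (0 < mu (enum_rank y))%N ->
    (U_(enum_rank x) + U_(enum_rank y) <= mu)%MM.
  move=> xy x0 y0; apply/mnm_lepP => k; rewrite mnmDE !mnm1E.
  have [<-|_] := eqVneq (enum_rank x) k; last by case: eqP => [<-|].
  by rewrite (inj_eq enum_rank_inj) eq_sym (negbTE xy) addn0.
split=> [a b a0 b0|a a0 i k W Wmax kW aW ka before|a a0 b ba_distinct ba].
- have [//|ab] := boolP (le_plucker (elt a) (elt b)).
  have [//|ba] := boolP (le_plucker (elt b) (elt a)); exfalso; apply: irr.
  have dvd : (t_mnm a + t_mnm b <= mu)%MM.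
    apply: add_le => //; apply: contra ab => /eqP[->]; by apply/le_pluckerP.
  case/orP: (typeC_mem ab ba) => Cmem.
    exists (of_T (typeC_poly K lam a b)), (t_mnm a + t_mnm b)%MM; split=> //.
      by rewrite !mem_cat; apply/orP; right; apply/orP; right; apply: map_f.
    exact: (of_T_typeC_lead hunit lamP).
  exists (of_T (typeC_poly K lam b a)), (t_mnm b + t_mnm a)%MM; split=> //.
  - by rewrite !mem_cat; apply/orP; right; apply/orP; right; apply: map_f.
  - exact: (of_T_typeC_lead hunit lamP).
  by rewrite addmC.
- apply/eqP; rewrite -leqn0 leqNgt; apply/negP => x0; apply: irr.
  have [c /andP[cC /eqP cm] lead] := typeB_lead K Wmax kW aW ka before.
  exists (typeB_poly K Delta i c), (x_mnm Delta i k + t_mnm a)%MM; split=> //.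
    exact: typeB_mem.
  exact: add_le.
move=> b0; apply: irr.
exists (typeA_poly K b a), (perm_mnm Delta 1%g (elt b) + t_mnm a)%MM; split.
- exact: typeA_mem.
- exact: typeA_lead.
apply/mnm_lepP => k; rewrite mnmDE -[k]enum_valK perm_mnm1E mnm1E (inj_eq enum_rank_inj).
case: (enum_val k) => [[i j]|c] /=.
  by rewrite addn0; case: eqP => // <-.
by rewrite add0n; case: eqP => // [[<-]].
Qed.

Lemma irreducible_inj mu nu :
    ~ reducible (@le_RT m n Delta) rees_generators mu ->
    ~ reducible (@le_RT m n Delta) rees_generators nu ->
    mnm_weight (@t_degree m n Delta) mu = mnm_weight (@t_degree m n Delta) nu ->
    mnm_image (@var_image m n Delta) mu = mnm_image (@var_image m n Delta) nu ->
  mu = nu.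
Proof.
move=> /irreducible_normal muN /irreducible_normal nuN; rewrite !t_degreeE => deg image.
have rows i k := congr1 (fun la : 'X_{1..NX} => la (enum_rank (i, k))) image.
have tau : forall a, mu (enum_rank (inr a)) = nu (enum_rank (inr a)).
  apply: (normal_unique hunit muN nuN) deg => i k.
  by have := rows i k; rewrite !image_pair.
apply/mnmP => k; rewrite -[k]enum_valK; case: (enum_val k) => [[i j]|a] //.
have := rows i j; rewrite !image_pair.
by rewrite (eq_bigr _ (fun a _ => tau a)) => /addIn.
Qed.

(** In a fixed degree in T, irreducible monomials have images with pairwise distinct initial
    monomials, so these images are linearly independent. *)
Lemma kerJ_irreducible (f : ringRT K m Delta) : kerJ f ->
  (forall mu, mu \in msupp f -> ~ reducible (@le_RT m n Delta) rees_generators mu) -> f = 0.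
Proof.
move=> phif irr; apply/eqP; apply: contraT => f0.
have muf := mlead_supp f0; move: (mlead f) muf => mu muf.
pose s := [seq nu <- msupp f | mnm_weight (@t_degree m n Delta) nu ==
                               mnm_weight (@t_degree m n Delta) mu].
have mus : mu \in s by rewrite mem_filter eqxx.
have : f@_mu = 0.
  apply: (triangular_free (r := s) (c := fun nu => f@_nu) (F := @phi_coef K m n Delta) _ _ _ _ mus).
  - by rewrite filter_uniq // msupp_uniq.
  - by move=> x _ _; apply: phi_coef_neq0.
  - move=> x y; rewrite !mem_filter => /andP[/eqP dx xf] /andP[/eqP dy yf] _ _.
    by rewrite !mlead_phi_coef; apply: irreducible_inj; rewrite ?dx ?dy //; apply: irr.
  by rewrite -phi_coefE (_ : phi f = 0) // coef0.
by move/eqP; rewrite mcoeff_eq0 muf.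
Qed.

Lemma kerJ0 : @kerJ K m n Delta 0.
Proof. by rewrite /kerJ phiE rmorph0. Qed.

Lemma kerJD f g : @kerJ K m n Delta f -> kerJ g -> kerJ (f + g).
Proof. by rewrite /kerJ !phiE => f0 g0; rewrite rmorphD /= f0 g0 addr0. Qed.

Lemma kerJM f g : @kerJ K m n Delta g -> kerJ (f * g).
Proof. by rewrite /kerJ !phiE => g0; rewrite rmorphM /= g0 mulr0. Qed.

Lemma groebner_basis_kerJ : groebner_basis (@le_RT m n Delta) rees_generators (@kerJ K m n Delta).
Proof.
exact: (groebner_basisP (image_orderP _ _) rees_generators_homog kerJ0 kerJD kerJM
  rees_generators_kerJ kerJ_irreducible).
Qed.

Lemma kerJ_generated f : kerJ f -> ideal_gen (fun g => g \in rees_generators) f.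
Proof.
exact: (groebner_generates (image_orderP _ _) rees_generators_homog kerJ0 kerJD kerJM
  rees_generators_kerJ kerJ_irreducible).
Qed.

End GroebnerBases.

(** * The symmetric algebra *)

Module SymmetricAlgebraEvaluation.
Import finmap monalg.

Section CmonomEvaluation.
Variables (I : choiceType) (S : comNzRingType) (h : I -> S).

Definition cmonom_eval (k : {cmonom I}) : S := \prod_(i <- finsupp k) h i ^+ k i.

Lemma cmonom_evalEw (k : {cmonom I}) (d : {fset I}) : (finsupp k `<=` d)%fset ->
  cmonom_eval k = \prod_(i <- d) h i ^+ k i.
Proof.
move=> le_kd; rewrite /cmonom_eval (big_fset_incl _ le_kd) // => i _.
by rewrite -cmE_eq0 => /eqP ->.
Qed.

Lemma cmonom_eval_morph : mmorphism cmonom_eval.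
Proof.
split=> [k l|]; last by rewrite /cmonom_eval mdom1 big_seq_fset0.
rewrite /cmonom_eval mdomD -/(cmonom_eval k) -/(cmonom_eval l).
rewrite (cmonom_evalEw (fsubsetUl _ (finsupp l))) (cmonom_evalEw (fsubsetUr (finsupp k) _)).
by rewrite -big_split /=; apply: eq_bigr => i _; rewrite cmM exprD.
Qed.

Lemma cmonom_evalU i : cmonom_eval (ucm i) = h i.
Proof. by rewrite /cmonom_eval mdomU big_seq_fset1 cmUU expr1. Qed.

HB.instance Definition _ :=
  isMultiplicative.Build {cmonom I} S cmonom_eval cmonom_eval_morph.

End CmonomEvaluation.

Section SymEvaluation.
Variables (A : comNzRingType) (J : A -> Prop) (S : comNzRingType).
Variables (f : {rmorphism A -> S}) (h : ideal_elt J -> S).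

(** The universal property of the polynomial ring over A in the elements of J; the later arguments
    use only these values on constants and variables. *)
Lemma sym_cover_universal : exists g : {rmorphism sym_cover J -> S},
  (forall c, g c%:A = f c) /\ (forall w, g (sym_var w) = h w).
Proof.
exists (mmap f (cmonom_eval h : {mmorphism {cmonom ideal_elt J} -> S})); split.
  by move=> c; rewrite -mul_malgC mulr1; apply: mmapC.
by move=> w; rewrite [LHS]mmapU /= rmorph1 mul1r; apply: cmonom_evalU.
Qed.

End SymEvaluation.
End SymmetricAlgebraEvaluation.
Import SymmetricAlgebraEvaluation.

Section SymRel.
Variables (A : comNzRingType) (J : A -> Prop).

Lemma sym_rel_kernel (S : comNzRingType) (f : A -> S) (h : ideal_elt J -> S)
    (g : {rmorphism sym_cover J -> S}) :
    (forall c, g c%:A = f c) -> (forall w, g (sym_var w) = h w) ->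
    (forall x y z, val z = val x + val y -> h z = h x + h y) ->
    (forall a x z, val z = a * val x -> h z = f a * h x) ->
  forall p, sym_rel p -> g p = 0.
Proof.
move=> gA gh hD hZ; apply: (@ideal_gen_min _ _ (fun p => g p = 0)).
- exact: rmorph0.
- by move=> x y x0 y0; rewrite rmorphD x0 y0 addr0.
- by move=> x y y0; rewrite rmorphM y0 mulr0.
have gB x y : g (x - y) = g x - g y by exact: rmorphB.
have gZ a x : g (a *: x) = f a * g x by rewrite -mulr_algl rmorphM gA.
have [X XE] : exists X, X = @sym_var A J by exists (@sym_var A J).
rewrite -XE in gh.
move=> _ [[x [y [z [zE ->]]]]|[a [x [z [zE ->]]]]]; rewrite -XE {XE}.
  by rewrite !gB !gh (hD _ _ _ zE) addrAC addrK subrr.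
by rewrite gB gZ !gh (hZ _ _ _ zE) subrr.
Qed.

(** Modulo the relations of Sym(J), a linear combination of variables equals the variable of its
    value in J, by induction on the length. The variable of 0 vanishes, because 0 is 0 times any
    element. *)
Lemma sym_rel_linear : J 0 -> (forall x y, J x -> J y -> J (x + y)) ->
    (forall a x, J x -> J (a * x)) ->
  forall (I : Type) (s : seq I) (c : I -> A) (w : I -> ideal_elt J),
    \sum_(i <- s) c i * val (w i) = 0 ->
  sym_rel (\sum_(i <- s) c i *: sym_var (w i)).
Proof.
move=> J0 JD JM I s c w sum0.
have JP (x : ideal_elt J) : J (val x) by apply/asboolP; case: x.
pose mk x (Jx : J x) : ideal_elt J := exist _ x (asboolT Jx).
have relD (x y z : ideal_elt J) : val z = val x + val y ->
    sym_rel (sym_var z - sym_var x - sym_var y).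
  by move=> zE; apply: ideal_gen_mem; left; exists x, y, z.
have relZ a (x z : ideal_elt J) : val z = a * val x -> sym_rel (sym_var z - a *: sym_var x).
  by move=> zE; apply: ideal_gen_mem; right; exists a, x, z.
have sumJ (t : seq I) : J (\sum_(i <- t) c i * val (w i)).
  by apply: big_ind => // i _; apply: JM.
have rel (t : seq I) (x : ideal_elt J) : val x = \sum_(i <- t) c i * val (w i) ->
    sym_rel (\sum_(i <- t) c i *: sym_var (w i) - sym_var x).
  elim: t x => [|i t IHt] x; rewrite ?big_nil ?big_cons => xE.
    rewrite sub0r; apply: ideal_genN; rewrite -[sym_var x]subr0 -(scale0r (sym_var x)).
    by apply: relZ; rewrite xE mul0r.
  pose y := mk _ (JM (c i) _ (JP (w i))); pose z := mk _ (sumJ t).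
  have -> : c i *: sym_var (w i) + \sum_(j <- t) c j *: sym_var (w j) - sym_var x =
      - (sym_var y - c i *: sym_var (w i)) + (\sum_(j <- t) c j *: sym_var (w j) - sym_var z) -
      (sym_var x - sym_var y - sym_var z).
    rewrite !opprB; move: (sym_var x) (sym_var y) (sym_var z) (_ *: _) (\sum_(j <- t) _).
    by move=> X Y Z P Q; rewrite !addrA [X in X = _]addrAC; ring.
  apply: ideal_genB; last exact: relD.
  by apply: ideal_genD; [apply/ideal_genN/relZ|apply: IHt].
pose zero := mk 0 J0.
rewrite -[\sum_(i <- s) _](subrK (sym_var zero)); apply: ideal_genD; first exact: rel.
by rewrite -[sym_var zero]subr0 -(scale0r (sym_var zero)); apply: relZ; rewrite mul0r.
Qed.

End SymRel.

(** * The special fiber ring and fiber type *)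

Section SpecialFiber.
Variables (K : fieldType) (m n : nat) (Delta : {set {set 'I_n}}).
Variables (r : nat) (u v : 'I_r.+1 -> 'I_n).
Hypotheses (hm : (0 < m)%N) (hunit : unit_interval m Delta u v).
Local Notation F := (facet m Delta).
Local Notation NX := #|{: 'I_m * 'I_n}|.
Variable lam : F -> F -> F -> F -> int.
Hypothesis lamP : plucker_coefficients K lam.
Implicit Types (a b : F) (tau : 'X_{1..#|{: F}|}).

Definition psi_coef tau : ringR K m n := \prod_a minor K a ^+ tau (enum_rank a).

Definition fiber_image tau : 'X_{1..NX} := mnm_image (fun a => diag_mnm (elt a)) tau.

Lemma psiE_sum (f : ringT K m Delta) :
  psi f = \sum_(tau <- msupp f) f@_tau *: psi_coef tau.
Proof.
rewrite psiE {1}[f]mpolyE rmorph_sum; apply: eq_bigr => tau _.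
by rewrite [LHS]subst_varZ mul_mpolyC; congr (_ *: _); apply: subst_varX.
Qed.

Lemma psi_coef_neq0 tau : psi_coef tau != 0.
Proof.
apply/prodf_neq0 => a _; rewrite expf_neq0 // minorE.
exact: generic_minor_neq0 (elt_increasing a).
Qed.

Lemma mlead_psi_coef tau : mlead (psi_coef tau) = fiber_image tau.
Proof.
have minor_lead a : minor K a != 0 /\ mlead (minor K a) = diag_mnm (elt a).
  by rewrite minorE generic_minor_neq0 ?mlead_generic_minor ?elt_increasing.
rewrite /psi_coef mlead_prod => [|a _ _]; last by rewrite expf_neq0 //; case: (minor_lead a).
by apply: eq_bigr => a _; have [nz <-] := minor_lead a; rewrite mleadX.
Qed.

Lemma fiber_imageE tau (i : 'I_m) (k : 'I_n) :
  fiber_image tau (enum_rank (i, k)) = (\sum_(a | elt a i == k) tau (enum_rank a))%N.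
Proof.
rewrite /fiber_image mnm_sumE [RHS]big_mkcond; apply: eq_bigr => a _.
by rewrite mulmnE diag_mnmE; case: eqP; rewrite ?mul1n.
Qed.

Lemma mdeg_fiber_image tau : mdeg (fiber_image tau) = (m * \sum_a tau (enum_rank a))%N.
Proof.
rewrite mdeg_sum big_distrr; apply: eq_bigr => a _ /=.
by rewrite mdegMn mdeg_diag_mnm.
Qed.

(** Without x variables all exponents [al] are zero: the condition from (B) is trivial, and the one
    from (A) holds because m > 0. *)
Lemma fiber_irreducible_normal tau :
    ~ reducible (@le_T m n Delta) (typeC K lam u v) tau ->
  normal_form (fun _ _ => 0%N) (fun a => tau (enum_rank a)).
Proof.
move=> irr; split=> [a b a0 b0|//|a _ b _ _ /(_ (Ordinal hm)) //].
have [//|ab] := boolP (le_plucker (elt a) (elt b)).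
have [//|ba] := boolP (le_plucker (elt b) (elt a)); exfalso; apply: irr.
have dvd : (fiber_mnm a + fiber_mnm b <= tau)%MM.
  apply/mnm_lepP => k; rewrite mnmDE !mnm1E.
  have [<-|_] := eqVneq (enum_rank a) k; last by case: eqP => [<-|].
  rewrite (inj_eq enum_rank_inj); have [eab|_] := eqVneq b a; last by rewrite addn0.
  by case/negP: ab; rewrite eab; apply/le_pluckerP.
case/orP: (typeC_mem K u v lam ab ba) => Cmem.
  exists (typeC_poly K lam a b), (fiber_mnm a + fiber_mnm b)%MM; split=> //.
  exact: (typeC_lead K hunit lam).
exists (typeC_poly K lam b a), (fiber_mnm b + fiber_mnm a)%MM; split=> //; last by rewrite addmC.
exact: (typeC_lead K hunit lam).
Qed.

Lemma kerK_irreducible (f : ringT K m Delta) : kerK f ->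
  (forall tau, tau \in msupp f -> ~ reducible (@le_T m n Delta) (typeC K lam u v) tau) -> f = 0.
Proof.
move=> psif irr; apply/mpolyP => tau; rewrite mcoeff0.
have [tauf|] := boolP (tau \in msupp f); last exact: memN_msupp_eq0.
apply: (triangular_free (r := msupp f) (c := fun la => f@_la) (F := @psi_coef) _ _ _ _ tauf).
- exact: msupp_uniq.
- by move=> x _ _; apply: psi_coef_neq0.
- move=> x y xf yf _ _; rewrite !mlead_psi_coef => image.
  have coord : forall a, x (enum_rank a) = y (enum_rank a).
    apply: (normal_unique hunit (fiber_irreducible_normal (irr _ xf))
                                (fiber_irreducible_normal (irr _ yf))).
      by move=> i k; rewrite !add0n -!fiber_imageE image.
    (* There is no t here: the degree in T is the degree of the image divided by m. *)
    by have := congr1 (@mdeg _) image; rewrite !mdeg_fiber_image => /eqP; rewrite eqn_pmul2l // => /eqP.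
  by apply/mnmP => k; rewrite -[k]enum_valK.
by rewrite -psiE_sum.
Qed.

Lemma typeC_homog g : g \in typeC K lam u v ->
  exists k, forall tau, tau \in msupp g -> mdeg tau = k.
Proof.
move=> /imageP[[a b] _ ->]; exists 2%N; apply: (typeC_supp hunit) => [|e g' _ _ _];
  by rewrite mdegD !mdeg1.
Qed.

Lemma groebner_basis_kerK :
  groebner_basis (@le_T m n Delta) (typeC K lam u v) (@kerK K m n Delta).
Proof.
apply: (groebner_basisP (weight_orderP _) typeC_homog _ _ _ _ kerK_irreducible).
- by rewrite /kerK psiE rmorph0.
- by move=> f g; rewrite /kerK !psiE => f0 g0; rewrite rmorphD /= f0 g0 addr0.
- by move=> f g; rewrite /kerK !psiE => g0; rewrite rmorphM /= g0 mulr0.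
by move=> _ /imageP[[a b] _ ->]; apply: (typeC_kerK hunit lamP).
Qed.

End SpecialFiber.

Section FiberType.
Variables (K : fieldType) (m n : nat) (Delta : {set {set 'I_n}}).
Variables (r : nat) (u v : 'I_r.+1 -> 'I_n).
Hypotheses (hm : (0 < m)%N) (hunit : unit_interval m Delta u v).
Local Notation F := (facet m Delta).
Local Notation V := ('I_m * 'I_n + F)%type.
Local Notation NX := #|{: 'I_m * 'I_n}|.
Local Notation J := (@det_facet_ideal K m n Delta).
Implicit Types (a b : F).

Definition minor_elt a : ideal_elt J := exist _ (minor K a) (minor_in_ideal K a).

Definition rho_morph : {rmorphism ringRT K m Delta -> sym_cover J} :=
  subst_var (in_alg (sym_cover J) \o @mpolyC NX K)
    (fun x : V => match x with
                  | inl ij => (xvar K ij.1 ij.2)%:A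
                  | inr a => sym_var (minor_elt a)
                  end).

Lemma rho_coverE : @rho_cover K m n Delta =1 rho_morph. Proof. by []. Qed.

Lemma rho_of_R p : rho_morph (of_R_morph K m Delta p) = p%:A.
Proof.
pose h (ij : 'I_m * 'I_n) : sym_cover J := (xvar K ij.1 ij.2)%:A.
pose g1 : {rmorphism ringR K m n -> sym_cover J} := rho_morph \o of_R_morph K m Delta.
pose g2 : {rmorphism ringR K m n -> sym_cover J} := in_alg (sym_cover J).
have g1E : g1 =1 subst_var (in_alg (sym_cover J) \o @mpolyC NX K) h.
  apply: subst_var_unique => [x|ij]; rewrite /g1 /=.
    by rewrite [subst_var _ _ _%:MP]subst_varC; apply: subst_varC.
  by rewrite [subst_var _ _ (var K ij)]subst_var_var; apply: subst_var_var.
have g2E : g2 =1 subst_var (in_alg (sym_cover J) \o @mpolyC NX K) h.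
  by apply: subst_var_unique => [x|[i j]].
exact: etrans (g1E p) (esym (g2E p)).
Qed.

Lemma rho_t_mnm a : rho_morph 'X_[t_mnm a] = sym_var (minor_elt a).
Proof. exact: subst_var_var. Qed.

Lemma rho_R_t p a : rho_morph (of_R_morph K m Delta p * 'X_[t_mnm a]) = p *: sym_var (minor_elt a).
Proof. by rewrite rmorphM rho_of_R rho_t_mnm mulr_algl. Qed.

(** [phi] factors through Sym(J): [theta] sends the variable of w to w t, which is linear in w. *)
Lemma kerL_kerJ f : @kerL K m n Delta f -> kerJ f.
Proof.
have [theta [thetaA theta_var]] := sym_cover_universal
  (polyC : {rmorphism ringR K m n -> {poly ringR K m n}})
  (fun w : ideal_elt J => val w *: 'X).
have theta_rho : theta \o rho_morph =1 phi_morph K m Delta.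
  apply: subst_var_unique => [x|x] /=.
    by rewrite [subst_var _ _ _%:MP]subst_varC; apply: thetaA.
  by rewrite [subst_var _ _ (var K x)]subst_var_var; case: x => [ij|a]; rewrite ?thetaA ?theta_var.
rewrite /kerL rho_coverE /kerJ phiE -[phi_morph _ _ _ f]theta_rho.
apply: (sym_rel_kernel thetaA theta_var) => [x y z zE|p x z zE].
  by rewrite zE scalerDl.
by rewrite zE -scalerA mul_polyC.
Qed.

Lemma kerL_linear (I : Type) (s : seq I) (c : I -> ringR K m n) (a : I -> F) :
  \sum_(i <- s) c i * minor K (a i) = 0 ->
  kerL (\sum_(i <- s) of_R_morph K m Delta (c i) * 'X_[t_mnm (a i)]).
Proof.
move=> sum0; rewrite /kerL rho_coverE rmorph_sum.
under eq_bigr do rewrite rho_R_t.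
exact: (@sym_rel_linear _ J (@ideal_gen0 _ _) (@ideal_genD _ _) (@ideal_genM _ _) I s c
  (minor_elt \o a) sum0).
Qed.

Lemma kerL_linear2 (p q : ringR K m n) a b : p * minor K a + q * minor K b = 0 ->
  kerL (of_R_morph K m Delta p * 'X_[t_mnm a] + of_R_morph K m Delta q * 'X_[t_mnm b]).
Proof.
have sum2 (W : nmodType) (T : Type) (x y : T) (G : T -> W) :
    \sum_(z <- [:: x; y]) G z = G x + G y.
  by rewrite 2!big_cons big_nil addr0.
by have := @kerL_linear _ [:: (p, a); (q, b)] fst snd; rewrite !sum2; apply.
Qed.

Lemma typeA_kerL a b : kerL (typeA_poly K a b).
Proof.
have sum0 : minor K a * minor K b + - minor K b * minor K a = 0.
  by move: (minor K a) (minor K b) => p q; rewrite mulNr mulrC subrr.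
have := kerL_linear2 sum0.
have -> : of_R_morph K m Delta (- minor K b) = - of_R_morph K m Delta (minor K b).
  exact: rmorphN.
by rewrite mulNr /typeA_poly !Tvar_val !of_T_var.
Qed.

Lemma typeB_kerL (i : 'I_m) (c : {set 'I_n}) :
  c \in clique_complex m Delta -> #|c| = m.+1 -> kerL (typeB_poly K Delta i c).
Proof.
move=> cC cm; have [e [f [_ _ fE ->]]] := typeB_facets K cC cm.
have scaleE (j : nat) (p : ringR K m n) : (-1) ^+ j *: p = (-1) ^+ j * p.
  by rewrite -signr_odd scaler_sign -mulr_sign signr_odd.
have := @kerL_linear 'I_m.+1 (index_enum _)
  (fun j => (-1) ^+ (i + j) * xvar K i (e j)) f.
have := facets_laplace K i fE; under eq_bigr do rewrite scaleE mulrA.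
move=> laplace /(_ laplace); congr kerL; apply: eq_bigr => j _.
rewrite rmorphM rmorphXn rmorphN1 -of_RE of_R_xvar -mulrA -mpolyXD.
by rewrite -[in LHS]signr_odd mulr_sign -[in RHS]signr_odd scaler_sign.
Qed.

Lemma det_facet_ideal_fiber_type : fiber_type K m Delta.
Proof.
have [lam lamP] := plucker_coefficients_exist K hunit.
have kerL0 : kerL (0 : ringRT K m Delta).
  by rewrite /kerL rho_coverE rmorph0; apply: ideal_gen0.
have kerLD (f g : ringRT K m Delta) : kerL f -> kerL g -> kerL (f + g).
  by rewrite /kerL !rho_coverE rmorphD; apply: ideal_genD.
have kerLM (f g : ringRT K m Delta) : kerL g -> kerL (f * g).
  by rewrite /kerL !rho_coverE rmorphM; apply: ideal_genM.
move=> f; split; last first.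
  case=> g [h [/kerL_kerJ gJ hK ->]]; apply: kerJD gJ _.
  apply: (ideal_gen_min _ _ _ _ hK); [exact: kerJ0|exact: kerJD|exact: kerJM|].
  by move=> _ [k kK ->]; apply: kerK_kerJ.
move=> /(kerJ_generated hm hunit lamP).
apply: (@ideal_gen_min _ _ (ideal_add (@kerL K m n Delta)
    (ideal_gen (fun h => exists2 k, kerK k & h = of_T k)))).
- by exists 0, 0; split; rewrite ?addr0 //; apply: ideal_gen0.
- move=> _ _ [g [h [gL hK ->]]] [g' [h' [gL' hK' ->]]].
  by exists (g + g'), (h + h'); split; [exact: kerLD|exact: ideal_genD|rewrite addrACA].
- move=> c _ [g [h [gL hK ->]]].
  by exists (c * g), (c * h); split; [exact: kerLM|exact: ideal_genM|rewrite mulrDr].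
move=> g /rees_generatorsP[[a [b ->]]|[i [c [cC cm ->]]]|[a [b ->]]].
- by exists (typeA_poly K a b), 0; split; [exact: typeA_kerL|exact: ideal_gen0|rewrite addr0].
- by exists (typeB_poly K Delta i c), 0; split; [exact: typeB_kerL|exact: ideal_gen0|rewrite addr0].
exists 0, (of_T (typeC_poly K lam a b)); split; rewrite ?add0r //.
apply: ideal_gen_mem; exists (typeC_poly K lam a b) => //.
exact: (typeC_kerK hunit lamP).
Qed.

End FiberType.

Theorem theorem4p5 (K : fieldType) (m n : nat) (Delta : {set {set 'I_n}})
    (r : nat) (u v : 'I_r.+1 -> 'I_n)
    (hm : (0 < m)%N) (hmn : (m <= n)%N)
    (hDelta : simplicial_complex Delta) (hpure : pure_complex m Delta)
    (hunit : unit_interval m Delta u v) :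
  exists lam : facet m Delta -> facet m Delta ->
               facet m Delta -> facet m Delta -> int,
    (exists le' : rel 'X_{1..#|{: 'I_m * 'I_n + facet m Delta}|},
       monomial_order le' /\
       groebner_basis le'
         (typeA K m Delta ++ typeB K m Delta
            ++ map (@of_T K m n Delta) (typeC K lam u v))
         (@kerJ K m n Delta))
    /\ (exists le : rel 'X_{1..#|{: facet m Delta}|},
          monomial_order le /\
          groebner_basis le (typeC K lam u v) (@kerK K m n Delta))
    /\ fiber_type K m Delta.
Proof.
have [lam lamP] := plucker_coefficients_exist K hunit; exists lam; split; last split.
- exists (@le_RT m n Delta); split; first exact: image_orderP.
  exact: (groebner_basis_kerJ hm hunit lamP).
- exists (@le_T m n Delta); split; first exact: weight_orderP.
  exact: (groebner_basis_kerK hm hunit lamP).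
exact: (det_facet_ideal_fiber_type hm hunit).
Qed.
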